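(* Let $\Omega\subset\mathbb R^N$ be a bounded domain with $C^{1,1}$ boundary and $\delta(x)=\mathrm{dist}(x,\Omega^c)$. There exists $\rho>0$, depending on $N,p,s,\Omega$, such that $\delta^s$ is a weak solution of $(-\Delta)^s_p\delta^s=f$ in $\Omega_\rho:=\{x\in\Omega:\delta(x)<\rho\}$ for some $f\in L^\infty(\Omega_\rho)$.
   Context: Fixed $s\in(0,1)$, $p\in(1,\infty)$. $a^q:=|a|^{q-1}a$. $\delta^s$ is extended by $0$ on $\Omega^c$. Weak solution of $(-\Delta)^s_pu=f$ in an open set $U$: for every bounded open $U'\subseteq U$ and every $\varphi\in W^{s,p}_0(U')$, $\int_{\mathbb R^N\times\mathbb R^N}\frac{(u(x)-u(y))^{p-1}(\varphi(x)-\varphi(y))}{|x-y|^{N+ps}}dxdy=\int f\varphi\,dx$. *)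

(* Defs.v *)
From HB Require Import structures.
From mathcomp Require Import all_boot all_order all_algebra.
From mathcomp Require Import all_classical all_reals all_analysis.
Set Implicit Arguments. Unset Strict Implicit. Unset Printing Implicit Defensive.
Import Order.TTheory GRing.Theory Num.Theory.
Import numFieldNormedType.Exports.
Local Open Scope classical_set_scope.
Local Open Scope ring_scope.

(* R^N is 'rV[R]_N (with the library's product topology = Euclidean topology),
   equipped with its Borel sigma-algebra. *)
Definition Rn (R : realType) (N : nat) := g_sigma_algebraType (@open 'rV[R]_N).

Definition eucl (R : realType) (N : nat) (x : 'rV[R]_N) : R :=
  Num.sqrt (\sum_(i < N) (x ord0 i) ^+ 2).

(* mu is Lebesgue measure: it gives every half-open box its volume
   (this determines it uniquely on Borel sets). *)
Definition is_lebesgue (R : realType) (N : nat) (mu : set (Rn R N) -> \bar R) :=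
  forall a b : 'rV[R]_N, (forall i, a ord0 i <= b ord0 i) ->
    mu [set x : Rn R N | forall i, a ord0 i <= x ord0 i < b ord0 i]
    = (\prod_(i < N) (b ord0 i - a ord0 i))%:E.

Definition boundedset (R : realType) (N : nat) (A : set 'rV[R]_N) :=
  exists M : R, forall x, A x -> eucl x <= M.

Definition distc (R : realType) (N : nat) (O : set 'rV[R]_N) (x : 'rV[R]_N) : R :=
  inf [set eucl (x - y) | y in ~` O].

Definition rfirst (R : realType) (n : nat) (y : 'rV[R]_n.+1) : 'rV[R]_n :=
  \row_(i < n) y ord0 (widen_ord (leqnSn n) i).
Definition rlast (R : realType) (n : nat) (y : 'rV[R]_n.+1) : R := y ord0 ord_max.

Definition C11fun (R : realType) (n : nat) (g : 'rV[R]_n -> R) :=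
  (forall y, differentiable g y) /\
  exists L : R, forall (i : 'I_n) (y z : 'rV[R]_n),
    `|'D_(delta_mx 0 i) g y - 'D_(delta_mx 0 i) g z| <= L * eucl (y - z).

Definition C11_boundary (R : realType) (n : nat) (O : set 'rV[R]_n.+1) :=
  forall x0, closure O x0 -> ~ O x0 ->
    exists r : R, 0 < r /\
    exists Q : 'M[R]_n.+1, Q *m Q^T = 1%:M /\
    exists g : 'rV[R]_n -> R, C11fun g /\
    forall x, eucl (x - x0) < r ->
      (O x <-> g (rfirst ((x - x0) *m Q)) < rlast ((x - x0) *m Q)).

Definition spow (R : realType) (a q : R) : R := Num.sg a * (`|a| `^ q).

Definition Wsp0 (R : realType) (N : nat)
  (mu : {sigma_finite_measure set (Rn R N) -> \bar R}) (s p : R)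
  (U : set 'rV[R]_N) (phi : 'rV[R]_N -> R) :=
  measurable_fun [set: Rn R N] (phi : Rn R N -> R) /\
  (forall x, ~ U x -> phi x = 0) /\
  (\int[mu]_x (`|phi x| `^ p)%:E < +oo)%E /\
  (\int[(mu \x mu)%E]_z
      (`|phi z.1 - phi z.2| `^ p / eucl (z.1 - z.2) `^ (N%:R + p * s))%:E < +oo)%E.

Definition Linfty (R : realType) (N : nat)
  (mu : {sigma_finite_measure set (Rn R N) -> \bar R})
  (U : set 'rV[R]_N) (f : 'rV[R]_N -> R) :=
  measurable_fun (U : set (Rn R N)) (f : Rn R N -> R) /\
  exists M : R, {ae mu, forall x : Rn R N, U x -> `|f x| <= M}.

Definition weak_sol (R : realType) (N : nat)
  (mu : {sigma_finite_measure set (Rn R N) -> \bar R}) (s p : R)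
  (U : set 'rV[R]_N) (u f : 'rV[R]_N -> R) :=
  forall U' : set 'rV[R]_N, open U' -> boundedset U' -> U' `<=` U ->
  forall phi, Wsp0 mu s p U' phi ->
  (\int[(mu \x mu)%E]_z
      (spow (u z.1 - u z.2) (p - 1) * (phi z.1 - phi z.2)
        / eucl (z.1 - z.2) `^ (N%:R + p * s))%:E
   = \int[mu]_x (f x * phi x)%:E)%E.

(* Main.v *)
(** Write [d] for the distance to the complement of [Omega], [u = d^s],
    [K(z) = |z|^(-N-ps)] and [J(A,B) = |A-B|^(p-2)(A-B)].  Principal values are avoided by
    working with the antisymmetric regularization [J_h(A,B) = J(A,B)|A-B|/(|A-B|+h(A+B))],
    which keeps the homogeneity of [J] and makes
    [f_h(x) = 2 int J_h(u(x),u(y)) K(x-y) dy] absolutely convergent; then [h] tends to [0].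

    Interior and exterior tangent balls of a fixed radius give, for [x] near the boundary, a
    unit vector [v] with [d(x+z) = (d(x) + v.z)_+] up to [O(|z|^2)].  Comparing [u] with the
    half-space profile [U(z) = ((d(x) + v.z)_+)^s] costs an error
    [int |J_h(u(x),u(x+z)) - J_h(u(x),U(z))| K(z) dz] bounded uniformly in [x] and [h], because
    [|t|^(-b) |z|^(c-N)], with [t] the signed distance to a hyperplane, is locally integrable
    uniformly in the hyperplane when [0 <= b < 1] and [b < c].  By homogeneity
    [int J_h(u(x),U(z)) K(z) dz = kappa_v c_h d(x)^(-s)], where [kappa_v] is bounded and the
    one-dimensional constant [c_h] tends to [0]: after an inversion its limit is computed from
    the primitive [(1-(1-t)^s)^p t^(-ps)].  So [f_h] converges on the boundary layer to a
    bounded [f], with [|f_h| <= C (1 + d^(-s))].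

    By antisymmetry and Fubini, the form obtained from [J_h] equals [int f_h phi].  Dominated
    convergence applies to the right side by the Hardy inequality
    [int |phi|^p d^(-ps) <= C [phi]^p], which follows from the exterior balls since [phi]
    vanishes there, and to the left side by Young's inequality where [|x-y| < max(d(x),d(y))]
    and again by Hardy elsewhere. *)

Require Import Defs.
From HB Require Import structures.
From mathcomp Require Import all_boot all_order all_algebra.
From mathcomp Require Import all_classical all_reals all_analysis.
From mathcomp Require Import measurable_realfun ring lra.
Import Order.TTheory GRing.Theory Num.Theory.
Import numFieldNormedType.Exports.
Local Open Scope classical_set_scope.
Local Open Scope ring_scope.

(** * The Euclidean norm *)

Section Euclid.
Set Implicit Arguments. Unset Strict Implicit.
Context {R : realType} {N : nat}.
Implicit Types x y z : 'rV[R]_N.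

(** A cut |x-y| > eps would give half-space constants depending on eps/d(x). The weight in [jreg]
    has degree 0, so one sequence c_h serves all points. Its extra power of |A-B| leaves
    |z|^(p-ps-N) near the diagonal, integrable as s < 1, at a cost 1/h that is never made uniform.

    As h tends to 0, the half-line integrals on the two sides of the point may both diverge. The
    inversion writes them as X_h + 1/((1+h)ps) and X_h + Y_h with the same X_h, which cancels before
    the limit; then Y_h tends to 1/(ps). Here the exponent of t^s is decisive.

    The term kappa_v c_h d^(-s) tends to 0 at each point, but not uniformly up to the boundary. This
    is why the bound on f_h keeps d^(-s), and why the Hardy inequality has to absorb it.

    For p < 2 the function J is not Lipschitz at 0, so the comparison error is singular on v.z = 0,
    where the profile equals u(x), as well as on d(x) + v.z = 0, where the profile reaches 0. Hence
    error terms with two hyperplanes. *)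

Definition dotv x y : R := \sum_(i < N) x ord0 i * y ord0 i.

Lemma dotvC x y : dotv x y = dotv y x.
Proof. by apply: eq_bigr => i _; rewrite mulrC. Qed.

Lemma dotvDl x y z : dotv (x + y) z = dotv x z + dotv y z.
Proof. by rewrite -big_split; apply: eq_bigr => i _; rewrite mxE mulrDl. Qed.

Lemma dotvZl a x y : dotv (a *: x) y = a * dotv x y.
Proof. by rewrite mulr_sumr; apply: eq_bigr => i _; rewrite mxE mulrA. Qed.

Lemma dotvNl x y : dotv (- x) y = - dotv x y.
Proof. by rewrite -scaleN1r dotvZl mulN1r. Qed.

Lemma dotvBl x y z : dotv (x - y) z = dotv x z - dotv y z.
Proof. by rewrite dotvDl dotvNl. Qed.

Lemma dotvDr x y z : dotv z (x + y) = dotv z x + dotv z y.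
Proof. by rewrite dotvC dotvDl !(dotvC z). Qed.

Lemma dotvZr a x y : dotv y (a *: x) = a * dotv y x.
Proof. by rewrite dotvC dotvZl dotvC. Qed.

Lemma dotvNr x y : dotv y (- x) = - dotv y x.
Proof. by rewrite dotvC dotvNl dotvC. Qed.

Lemma dotvBr x y z : dotv z (x - y) = dotv z x - dotv z y.
Proof. by rewrite dotvDr dotvNr. Qed.

Lemma dotv_ge0 x : 0 <= dotv x x.
Proof. by apply: sumr_ge0 => i _; rewrite -expr2 sqr_ge0. Qed.

Lemma eucl_ge0 x : 0 <= eucl x. Proof. exact: sqrtr_ge0. Qed.

Lemma sqr_eucl x : eucl x ^+ 2 = dotv x x.
Proof.
rewrite /eucl sqr_sqrtr; last by apply: sumr_ge0 => i _; rewrite sqr_ge0.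
by apply: eq_bigr => i _; rewrite expr2.
Qed.

Lemma euclE x : eucl x = Num.sqrt (dotv x x).
Proof. by rewrite -sqr_eucl sqrtr_sqr ger0_norm ?eucl_ge0. Qed.

Lemma euclN x : eucl (- x) = eucl x.
Proof. by rewrite !euclE dotvNl dotvNr opprK. Qed.

Lemma euclZ a x : eucl (a *: x) = `|a| * eucl x.
Proof.
by rewrite !euclE dotvZl dotvZr mulrA -expr2 sqrtrM ?sqr_ge0// sqrtr_sqr.
Qed.

Lemma euclB x y : eucl (x - y) = eucl (y - x).
Proof. by rewrite -opprB euclN. Qed.

Lemma eucl0 : eucl (0 : 'rV[R]_N) = 0.
Proof. by rewrite -(scale0r (0 : 'rV_N)) euclZ normr0 mul0r. Qed.

Lemma coord_le_eucl x i : `|x ord0 i| <= eucl x.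
Proof.
rewrite -sqrtr_sqr euclE ler_wsqrtr// /dotv (bigD1 i)//= -expr2 lerDl.
by apply: sumr_ge0 => j _; rewrite -expr2 sqr_ge0.
Qed.

Lemma eucl_eq0 x : (eucl x == 0) = (x == 0).
Proof.
apply/idP/idP => [/eqP e0|/eqP->]; last by rewrite eucl0.
apply/eqP/rowP => i; rewrite mxE; apply/eqP; rewrite -normr_le0 -e0.
exact: coord_le_eucl.
Qed.

Lemma eucl_gt0 x : (0 < eucl x) = (x != 0).
Proof. by rewrite lt_def eucl_ge0 andbT eucl_eq0. Qed.

Lemma dotv_le x y : dotv x y <= eucl x * eucl y.
Proof.
have [->|x0] := eqVneq x 0.
  by rewrite eucl0 mul0r -(scale0r (0 : 'rV_N)) dotvZl mul0r.
have [->|y0] := eqVneq y 0.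
  by rewrite eucl0 mulr0 -(scale0r (0 : 'rV_N)) dotvZr mul0r.
move: x0 y0; rewrite -!eucl_gt0 => x0 y0.
have := dotv_ge0 (eucl y *: x - eucl x *: y).
rewrite !(dotvBl,dotvBr,dotvZl,dotvZr) -!sqr_eucl (dotvC y x).
move=> h; have xy0 : 0 < eucl x * eucl y by rewrite mulr_gt0.
rewrite -(ler_pM2l xy0); lra.
Qed.

Lemma norm_dotv_le x y : `|dotv x y| <= eucl x * eucl y.
Proof.
rewrite ler_norml dotv_le andbT lerNl -dotvNl (le_trans (dotv_le _ _))//.
by rewrite euclN.
Qed.

Lemma ler_euclD x y : eucl (x + y) <= eucl x + eucl y.
Proof.
rewrite -(@ler_pXn2r _ 2)// ?nnegrE ?eucl_ge0 ?addr_ge0 ?eucl_ge0//.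
rewrite sqr_eucl sqrrD !(dotvDl,dotvDr) !sqr_eucl (dotvC y x).
have := dotv_le x y; lra.
Qed.

Lemma ler_eucl_dist x y z : eucl (x - z) <= eucl (x - y) + eucl (y - z).
Proof. by apply: le_trans (ler_euclD _ _); rewrite addrA subrK. Qed.

Lemma ler_dist_eucl x y : `|eucl x - eucl y| <= eucl (x - y).
Proof.
have h (a b : 'rV[R]_N) : eucl a - eucl b <= eucl (a - b).
  by rewrite lerBlDr; apply: le_trans (ler_euclD _ _); rewrite subrK.
by rewrite ler_norml h andbT lerNl opprB euclB h.
Qed.

Lemma eucl_le_coord x c : 0 <= c -> (forall i, `|x ord0 i| <= c) ->
  eucl x <= N%:R * c.
Proof.
move=> c0 h; have Nc0 : 0 <= N%:R * c by rewrite mulr_ge0.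
rewrite -(@ler_pXn2r _ 2)// ?nnegrE ?eucl_ge0// sqr_eucl /dotv.
apply: (@le_trans _ _ (\sum_(i < N) c ^+ 2)).
  by apply: ler_sum => i _; rewrite -expr2 -real_normK ?num_real// lerXn2r ?nnegrE ?h.
rewrite sumr_const card_ord exprMn -[leLHS]mulr_natl ler_wpM2r ?sqr_ge0//.
by rewrite -natrX ler_nat; case: (N) => // k; rewrite expnS expn1 leq_pmulr.
Qed.

Lemma eucl_le_norm x : eucl x <= N%:R * `|x|.
Proof.
apply: eucl_le_coord => // i; rewrite [leRHS]/Num.norm/= mx_normrE.
by apply: (le_trans _ (le_bigmax _ _ (ord0, i))).
Qed.

Lemma norm_le_eucl x : `|x| <= eucl x.
Proof.
rewrite [leLHS]/Num.norm/= mx_normrE; apply: bigmax_le; first exact: eucl_ge0.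
by move=> [i j] _ /=; rewrite ord1 coord_le_eucl.
Qed.

Lemma continuous_lipeucl (f : 'rV[R]_N -> R) (c : R) :
  (forall x y, `|f x - f y| <= c * eucl (x - y)) -> continuous f.
Proof.
move=> fc x; apply/(@cvgrPdist_le _ _ _ (nbhs x) (nbhs_filter x)) => /= e e0.
pose c' := N%:R * `|c| + 1.
have c'0 : 0 < c' by rewrite ltr_wpDl// mulr_ge0.
near=> y.
apply: (le_trans (fc x y)); apply: (@le_trans _ _ (c' * `|x - y|)).
  apply: (@le_trans _ _ (`|c| * (N%:R * `|x - y|))).
    apply: (le_trans (ler_wpM2r (eucl_ge0 _) (ler_norm c))).
    by rewrite ler_wpM2l// eucl_le_norm.
  rewrite mulrA ler_wpM2r// mulrC /c' lerDl//.
rewrite mulrC -ler_pdivlMr//; near: y.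
apply/nbhs_ballP; exists (e / c'); first by rewrite /= divr_gt0.
by move=> y; rewrite -ball_normE/= => /ltW.
Unshelve. all: by end_near. Qed.

Lemma continuous_eucl : continuous (@eucl R N).
Proof. by apply: (@continuous_lipeucl _ 1) => x y; rewrite mul1r ler_dist_eucl. Qed.

Lemma continuous_dotv y : continuous (dotv y).
Proof.
apply: (@continuous_lipeucl _ (eucl y)) => x z.
by rewrite -dotvBr norm_dotv_le.
Qed.

(** The topology on row vectors is that of the sup norm; equivalence of norms lets all later
    neighbourhoods be Euclidean balls. *)
Lemma nbhs_euclP (x : 'rV[R]_N) (A : set 'rV[R]_N) :
  nbhs x A <-> exists2 e : R, 0 < e & [set y | eucl (y - x) < e] `<=` A.
Proof.
split.
  move=> /nbhs_ballP[e /= e0 xA]; exists e => // y /= ye; apply: xA.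
  rewrite -ball_normE/= -normrN opprB (le_lt_trans (norm_le_eucl _))//.
move=> [e e0 xA]; apply/nbhs_ballP; exists (e / N.+1%:R); first by rewrite /= divr_gt0.
move=> y; rewrite -ball_normE/= => ye; apply: xA => /=.
apply: (le_lt_trans (eucl_le_norm _)).
rewrite -normrN opprB; rewrite ltr_pdivlMr// mulrC in ye.
by apply: le_lt_trans ye; rewrite ler_wpM2r// ler_nat.
Qed.

Lemma open_euclP (A : set 'rV[R]_N) :
  open A <-> forall x, A x -> exists2 e : R, 0 < e & [set y | eucl (y - x) < e] `<=` A.
Proof.
rewrite openE; split=> h x Ax; first by apply/nbhs_euclP; exact: h.
by rewrite /interior; apply/nbhs_euclP; exact: h.
Qed.

End Euclid.

Section Orthogonal.
Set Implicit Arguments. Unset Strict Implicit.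
Context {R : realType} {N : nat}.
Implicit Types x y : 'rV[R]_N.

Lemma dotv_mulmx x y : dotv x y = (x *m y^T) ord0 ord0.
Proof. by rewrite mxE; apply: eq_bigr => i _; rewrite mxE. Qed.

Lemma dotv_orth (Q : 'M[R]_N) x y : Q *m Q^T = 1%:M ->
  dotv (x *m Q) (y *m Q) = dotv x y.
Proof. by move=> QQ; rewrite !dotv_mulmx trmx_mul mulmxA -(mulmxA x) QQ mulmx1. Qed.

Lemma eucl_orth (Q : 'M[R]_N) x : Q *m Q^T = 1%:M -> eucl (x *m Q) = eucl x.
Proof. by move=> QQ; rewrite !euclE dotv_orth. Qed.

End Orthogonal.

Section Measurability.
Set Implicit Arguments. Unset Strict Implicit.
Context {R : realType} {N : nat}.

Lemma measurable_open (A : set 'rV[R]_N) : open A -> measurable (A : set (Rn R N)).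
Proof. exact: sub_sigma_algebra. Qed.

Lemma continuous_measurable_Rn (f : 'rV[R]_N -> R) : continuous f ->
  measurable_fun [set: Rn R N] (f : Rn R N -> R).
Proof.
move=> cf; apply: (measurability _ (RGenOpens.measurableE R)).
move=> _ -[_ [a [b ->] <-]]; rewrite setTI.
by apply: measurable_open; move/continuousP : cf; apply; exact: interval_open.
Qed.

Lemma measurable_coord i : measurable_fun [set: Rn R N] (fun x : Rn R N => x ord0 i).
Proof. by apply: continuous_measurable_Rn; exact: coord_continuous. Qed.

End Measurability.

(** * Lebesgue measure on R^N *)

Section LebesgueRn.
Set Implicit Arguments. Unset Strict Implicit.
Context {R : realType} {N : nat}.

Definition box (a b : 'rV[R]_N) : set (Rn R N) :=
  [set x : Rn R N | forall i, a ord0 i <= x ord0 i < b ord0 i].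

Definition boxes : set (set (Rn R N)) :=
  [set X | exists a b : 'rV[R]_N, (forall i, a ord0 i <= b ord0 i) /\ X = box a b].

Lemma measurable_box a b : measurable (box a b).
Proof.
rewrite (_ : box a b = \bigcap_(i in [set: 'I_N])
    ((fun x : Rn R N => x ord0 i) @^-1` `[a ord0 i, b ord0 i[)).
  apply: fin_bigcap_measurable => // i _; rewrite -[X in measurable X]setTI.
  exact: (measurable_coord i).
by apply/seteqP; split => [x h i _|x h i]; have := h i; rewrite /= in_itv//=; apply.
Qed.

(** Each point of [O] lies in a box with rational corners contained in [O]. There are countably many
    such boxes, and [F] enumerates them through [unpickle]. *)
Lemma open_boxes (O : set 'rV[R]_N) : open O -> (<<s boxes >>) O.
Proof.
move=> oO; have [s0 _ sU] := smallest_sigma_algebra setT boxes.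
pose F (k : nat) : set (Rn R N) :=
  if unpickle k is Some (a, b) then
    if `[< box (map_mx ratr a) (map_mx ratr b) `<=` O /\
           forall i, (a ord0 i <= b ord0 i :> rat) >]
    then box (map_mx ratr (a : 'rV[rat]_N)) (map_mx ratr (b : 'rV[rat]_N)) else set0
  else set0.
suff -> : O = \bigcup_k F k.
  apply: sU => k; rewrite /F; case: (unpickle k) => // -[a b].
  case: ifPn => // /asboolP[_ ab]; apply: sub_sigma_algebra.
  exists (map_mx ratr a), (map_mx ratr b); split => // i.
  by rewrite !mxE ler_rat.
apply/seteqP; split => [x Ox|x [k _]]; last first.
  rewrite /F; case: (unpickle k) => // -[a b].
  by case: ifPn => // /asboolP[+ _]; apply.
have [e e0 xe] := (open_euclP O).1 oO x Ox.
(* Coordinates within [e'] keep the Euclidean distance at most [N e'], which is strictly below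
   [e]. *)
pose e' := e / N.+1%:R.
have e'0 : 0 < e' by rewrite divr_gt0.
have /choice[fa ha] (i : 'I_N) : exists q : rat, x ord0 i - e' < ratr q < x ord0 i.
  have [|q] := @rat_in_itvoo R (x ord0 i - e') (x ord0 i); first by rewrite gtrBl.
  by rewrite in_itv /=; exists q.
have /choice[fb hb] (i : 'I_N) : exists q : rat, x ord0 i < ratr q < x ord0 i + e'.
  have [|q] := @rat_in_itvoo R (x ord0 i) (x ord0 i + e'); first by rewrite ltrDl.
  by rewrite in_itv /=; exists q.
exists (pickle ((\row_i fa i), (\row_i fb i))) => //.
rewrite /F pickleK; case: ifPn => [_|/asboolP].
  move=> i; rewrite !mxE; have /andP[_ /ltW ->] := ha i.
  by have /andP[-> _] := hb i.
case; split => [y yab|i].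
  apply: xe => /=; have ye i : `|(y - x) ord0 i| <= e'.
    have := yab i; rewrite !mxE => /andP[h1 h2].
    have /andP[h3 h4] := ha i; have /andP[h5 h6] := hb i.
    rewrite ler_norml; apply/andP; split; lra.
  apply: (le_lt_trans (eucl_le_coord (ltW e'0) ye)).
  by rewrite /e' mulrCA -[ltRHS]mulr1 ltr_pM2l// ltr_pdivrMr// mul1r ltr_nat.
rewrite !mxE -(ler_rat R); have /andP[_ h1] := ha i; have /andP[h2 _] := hb i.
exact: ltW (lt_trans h1 h2).
Qed.

Lemma measurable_boxes : @measurable _ (Rn R N) = <<s boxes >>.
Proof.
apply/seteqP; split.
  apply: smallest_sub; first exact: smallest_sigma_algebra.
  exact: open_boxes.
apply: smallest_sub; first exact: sigma_algebra_measurable.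
by move=> _ [a [b [_ ->]]]; exact: measurable_box.
Qed.

Lemma setI_closed_boxes : setI_closed boxes.
Proof.
move=> _ _ [a [b [ab ->]]] [a' [b' [ab' ->]]].
pose lo := \row_i Num.max (a ord0 i) (a' ord0 i).
(* The maximum with [lo] keeps the corners ordered; a disjoint pair then gives an empty box. *)
pose hi := \row_i Num.max (lo ord0 i) (Num.min (b ord0 i) (b' ord0 i)).
exists lo, hi; split=> [i|]; first by rewrite !mxE le_max lexx.
apply/seteqP; split => [x [h h'] i|x h].
  have /andP[h1 h2] := h i; have /andP[h3 h4] := h' i.
  by rewrite !mxE ge_max h1 h3 /= !lt_max lt_min h2 h4 !orbT.
have {}h i : (a ord0 i <= x ord0 i < b ord0 i) && (a' ord0 i <= x ord0 i < b' ord0 i).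
  have := h i; rewrite !mxE ge_max !lt_max lt_min => /andP[/andP[h1 h2]].
  by rewrite !ltNge h1 h2 /= -!ltNge => /andP[-> ->].
by split=> i; have /andP[] := h i.
Qed.

Lemma Rn_measure_unique (m1 m2 : {measure set (Rn R N) -> \bar R}) :
  (forall a b : 'rV[R]_N, (forall i, a ord0 i <= b ord0 i) -> m1 (box a b) = m2 (box a b)) ->
  (forall a b : 'rV[R]_N, (forall i, a ord0 i <= b ord0 i) -> (m1 (box a b) < +oo)%E) ->
  forall A, measurable A -> m1 A = m2 A.
Proof.
move=> m12 m1y; pose g (k : nat) : set (Rn R N) := box (const_mx (- k%:R)) (const_mx k%:R).
have kk (k : nat) (i : 'I_N) : (const_mx (- k%:R) : 'rV[R]_N) ord0 i <= (const_mx k%:R : 'rV[R]_N) ord0 i.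
  by rewrite !mxE; apply: (@le_trans _ _ 0); rewrite ?oppr_le0.
apply: (@measure_unique _ _ _ boxes g); first exact: measurable_boxes.
- exact: setI_closed_boxes.
- by move=> k; exists (const_mx (- k%:R)), (const_mx k%:R); split => // i; exact: kk.
- apply/seteqP; split => // x _.
  have [k xk] : exists k : nat, eucl x < k%:R.
    by exists (Num.truncn (eucl x)).+1; exact: Num.Theory.truncnS_gt.
  exists k => // i; rewrite !mxE.
  have := le_lt_trans (coord_le_eucl x i) xk.
  by rewrite ltr_norml => /andP[/ltW -> ->].
- by move=> _ [a [b [ab ->]]]; exact: m12.
- by move=> k; apply: m1y => i; exact: kk.
Qed.

Lemma measurable_fun_Rn d (T : measurableType d) (f : T -> Rn R N) :
  (forall i, measurable_fun setT (fun t => f t ord0 i)) -> measurable_fun setT f.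
Proof.
move=> mf; apply: (measurability _ measurable_boxes).
move=> _ [_ [a [b [_ ->]]] <-]; rewrite setTI.
rewrite (_ : f @^-1` _ = \bigcap_(i in [set: 'I_N])
    ((fun t => f t ord0 i) @^-1` `[a ord0 i, b ord0 i[)).
  apply: fin_bigcap_measurable => // i _; rewrite -[X in measurable X]setTI.
  exact: mf.
by apply/seteqP; split => [x h i _|x h i]; have := h i; rewrite /= in_itv//=; apply.
Qed.

Definition affine (c : R) (v : 'rV[R]_N) (x : Rn R N) : Rn R N :=
  c *: (x : 'rV[R]_N) + v.

Lemma measurable_affine (c : R) (v : 'rV[R]_N) :
  measurable_fun setT (affine c v).
Proof.
apply: measurable_fun_Rn => i; rewrite /affine; under eq_fun do rewrite !mxE.
apply: measurable_funD => //; apply: measurable_funM => //; exact: measurable_coord.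
Qed.

Hypothesis N0 : (0 < N)%N.
Context (mu : {sigma_finite_measure set (Rn R N) -> \bar R}) (lmu : is_lebesgue mu).

Lemma prod_scale (c : R) (f : 'I_N -> R) :
  \prod_(i < N) (c * f i) = c ^+ N * \prod_(i < N) f i.
Proof. by rewrite big_split/= prodr_const card_ord. Qed.

(** Scaling by a negative factor swaps the closed and open sides of a box. For every [t > 1] the
    measure is squeezed between those of two boxes closed on the left, of volumes [P / t] and
    [t P]. *)
Lemma lebesgue_oc_box (a b : 'rV[R]_N) : (forall i, a ord0 i <= b ord0 i) ->
  mu [set x : Rn R N | forall i, a ord0 i < x ord0 i <= b ord0 i]
  = (\prod_(i < N) (b ord0 i - a ord0 i))%:E.
Proof.
move=> ab; set O := [set x | _]; set P := \prod_(i < N) _.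
have P0 : 0 <= P by apply: prodr_ge0 => i _; rewrite subr_ge0.
have mO : measurable O.
  rewrite (_ : O = \bigcap_(i in [set: 'I_N])
    ((fun x : Rn R N => x ord0 i) @^-1` `]a ord0 i, b ord0 i])).
    apply: fin_bigcap_measurable => // i _; rewrite -[X in measurable X]setTI.
    exact: (measurable_coord i).
  by apply/seteqP; split => [x h i _|x h i]; have := h i; rewrite /= in_itv//=; apply.
have key (t : R) : 1 < t -> (mu O <= (t * P)%:E)%E /\ ((t^-1 * P)%:E <= mu O)%E.
  move=> t1; have t0 : 0 < t by rewrite (lt_trans _ t1).
  have tV1 : t^-1 < 1 by rewrite invf_lt1.
  (* Each side is stretched or shrunk by the [N]-th root of [t], so that the volume changes by
     [t]. *)
  pose l := t `^ (N%:R^-1).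
  have lN : l ^+ N = t.
    rewrite -powR_mulrn ?powR_ge0// -powRrM mulVf ?powRr1 ?ltW//.
    by rewrite pnatr_eq0 -lt0n.
  have l0 : 0 < l by rewrite powR_gt0.
  have l1 : 1 < l.
    rewrite ltNge; apply/negP => l1; have := exprn_ile1 N (ltW l0) l1.
    by rewrite lN leNgt t1.
  have lV1 : l^-1 < 1 by rewrite invf_lt1.
  split.
    have := lmu (a := a) (b := a + l *: (b - a)).
    have h i : a ord0 i <= (a + l *: (b - a)) ord0 i.
      by rewrite !mxE lerDl mulr_ge0 ?(ltW l0)// subr_ge0.
    move=> /(_ h) e; have : (mu O <= mu (box a (a + l *: (b - a))))%E.
      apply: le_measure; rewrite ?inE//; first exact: measurable_box.
      move=> x hx i; have /andP[ax xb] := hx i; rewrite (ltW ax) !mxE /=.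
      have : b ord0 i - a ord0 i < l * (b ord0 i - a ord0 i).
        by rewrite ltr_pMl// subr_gt0 (lt_le_trans ax).
      lra.
    rewrite /box e => /le_trans; apply; rewrite lee_fin -lN /P -prod_scale.
    by under eq_bigr do rewrite !mxE addrAC subrr add0r.
  have := lmu (a := b - l^-1 *: (b - a)) (b := b).
  have h i : (b - l^-1 *: (b - a)) ord0 i <= b ord0 i.
    by rewrite !mxE gerBl mulr_ge0 ?invr_ge0 ?(ltW l0)// subr_ge0.
  move=> /(_ h) e; have : (mu (box (b - l^-1 *: (b - a)) b) <= mu O)%E.
    apply: le_measure; rewrite ?inE//; first exact: measurable_box.
    move=> x hx i; have /andP[ax xb] := hx i; rewrite (ltW xb) andbT.
    move: ax; rewrite !mxE.
    have [/eqP ba|ba] := boolP (b ord0 i - a ord0 i == 0).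
      by rewrite ba mulr0; lra.
    have : l^-1 * (b ord0 i - a ord0 i) < (b ord0 i - a ord0 i).
      by rewrite gtr_pMl// lt_def ba subr_ge0 ab.
    lra.
  rewrite /box e => /(le_trans _); apply; rewrite lee_fin -lN -exprVn /P -prod_scale.
  by under [leRHS]eq_bigr do rewrite !mxE opprD addrA subrr add0r opprK.
have [h1 h2] := key 2 (ltr1n _ 2).
have fO : mu O \is a fin_num by rewrite ge0_fin_numE// (le_lt_trans h1)// ltry.
move: key; rewrite -(fineK fO); set m := fine (mu O) => key; congr EFin.
apply/eqP; rewrite eq_le; apply/andP; split.
  apply/ler_addgt0Pr => e e0.
  have t1 : 1 < 1 + e / (P + 1) by rewrite ltrDl divr_gt0// ltr_wpDl.
  have [+ _] := key _ t1; rewrite lee_fin => /le_trans; apply.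
  rewrite mulrDl mul1r lerD2l -mulrA ler_piMr ?ltW// mulrC.
  by rewrite ltr_pdivrMr ?ltr_wpDl// mul1r ltrDl.
apply/ler_addgt0Pr => e e0.
have m0 : 0 <= m by rewrite fine_ge0.
have t1 : 1 < 1 + e / (m + 1) by rewrite ltrDl divr_gt0// ltr_wpDl.
have [_] := key _ t1; rewrite lee_fin mulrC ler_pdivrMr ?(lt_trans ltr01)// => /le_trans; apply.
rewrite mulrDr mulr1 lerD2l mulrCA ler_piMr ?ltW//.
by rewrite ltr_pdivrMr ?ltr_wpDl// mul1r ltrDl.
Qed.

(** Both sides are measures in [A], hence it suffices to compare them on boxes; for [c < 0] the
    preimage of a box is of the kind treated in [lebesgue_oc_box]. *)
Lemma lebesgue_affine (c : R) (v : 'rV[R]_N) (A : set (Rn R N)) : c != 0 -> measurable A ->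
  ((`|c| ^+ N)%:E * mu (affine c v @^-1` A) = mu A)%E.
Proof.
move=> c0 mA; set phi := affine c v.
have c0' : 0 <= `|c| ^+ N by rewrite exprn_ge0.
have mphi : measurable_fun setT phi := measurable_affine c v.
pose m0 := measure_function_pushforward__canonical__measure_function_Measure mu mphi.
pose m1 : {measure set _ -> \bar R} := mscale (NngNum c0') m0.
transitivity (m1 A); first by [].
have Em1 (a b : 'rV[R]_N) : (forall i, a ord0 i <= b ord0 i) -> m1 (box a b) = mu (box a b).
  move=> ab; rewrite (lmu ab) /m1/= /mscale/= /pushforward/=.
  suff -> : mu (phi @^-1` box a b) = (\prod_(i < N) ((b ord0 i - a ord0 i) / `|c|))%:E.
    rewrite -EFinM -prod_scale.
    congr EFin; apply: eq_bigr => i _; rewrite mulrC divfK// normr_eq0//.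
  have [c_gt0|c_lt0] := ltrP 0 c.
    rewrite (_ : _ @^-1` _ = box (c^-1 *: (a - v)) (c^-1 *: (b - v))).
      rewrite (lmu (a := c^-1 *: (a - v)) (b := c^-1 *: (b - v))).
        congr EFin; apply: eq_bigr => i _; rewrite !mxE gtr0_norm//; ring.
      by move=> i; rewrite !mxE ler_wpM2l ?invr_ge0 ?(ltW c_gt0)// lerB.
    apply/seteqP; split => x h i; have := h i; rewrite /phi/affine !mxE;
      by rewrite -lerBlDr -ltrBrDr ler_pdivrMl// ltr_pdivlMl.
  have {c_lt0}c_lt0 : c < 0 by rewrite lt_neqAle c0.
  rewrite (_ : _ @^-1` _ = [set x : Rn R N | forall i,
     (c^-1 *: (b - v)) ord0 i < x ord0 i <= (c^-1 *: (a - v)) ord0 i]).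
    rewrite lebesgue_oc_box.
      congr EFin; apply: eq_bigr => i _; rewrite !mxE ltr0_norm// invrN; ring.
    by move=> i; rewrite !mxE ler_wnM2l ?invr_le0 ?(ltW c_lt0)// lerB.
  apply/seteqP; split => x h i; have := h i; rewrite /phi/affine !mxE;
    by rewrite -lerBlDr -ltrBrDr ler_ndivlMl// ltr_ndivrMl// andbC.
apply: Rn_measure_unique => // a b ab; rewrite Em1// /box (lmu ab) ltry//.
Qed.

Lemma ge0_integral_affine (c : R) (v : 'rV[R]_N) (f : Rn R N -> \bar R) : c != 0 ->
  measurable_fun setT f -> (forall x, 0 <= f x)%E ->
  (\int[mu]_x f x = (`|c| ^+ N)%:E * \int[mu]_x f (affine c v x))%E.
Proof.
move=> c0 mf f0.
have c0' : 0 <= `|c| ^+ N by rewrite exprn_ge0.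
have mphi : measurable_fun setT (affine c v) := measurable_affine c v.
pose m0 := measure_function_pushforward__canonical__measure_function_Measure mu mphi.
transitivity (\int[mscale (NngNum c0') m0]_x f x)%E.
  by apply: eq_measure_integral => //= A mA _; rewrite -(lebesgue_affine v c0 mA).
rewrite ge0_integral_mscale//=; congr (_ * _)%E.
by rewrite ge0_integral_pushforward.
Qed.

Lemma ge0_integral_translate (v : 'rV[R]_N) (f : Rn R N -> \bar R) :
  measurable_fun setT f -> (forall x, 0 <= f x)%E ->
  (\int[mu]_x f x = \int[mu]_x f ((x : 'rV[R]_N) + v)%R)%E.
Proof.
move=> mf f0; rewrite (ge0_integral_affine v (c := 1))// ?oner_neq0//.
rewrite normr1 expr1n mul1e; apply: eq_integral => x _.
by rewrite /affine scale1r.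
Qed.

Lemma integral_translate (v : 'rV[R]_N) (f : Rn R N -> \bar R) :
  measurable_fun setT f ->
  (\int[mu]_x f x = \int[mu]_x f ((x : 'rV[R]_N) + v)%R)%E.
Proof.
move=> mf; rewrite integralE [in RHS]integralE; congr (_ - _)%E.
- rewrite (ge0_integral_translate v).
  + by apply: eq_integral => x _; rewrite !funeposE.
  + exact: measurable_funepos.
  + by move=> x; rewrite funeposE le_max lexx orbT.
- rewrite (ge0_integral_translate v).
  + by apply: eq_integral => x _; rewrite !funenegE.
  + exact: measurable_funeneg.
  + by move=> x; rewrite funenegE le_max lexx orbT.
Qed.

(** Only the order of growth in [r] matters later, so balls are compared with circumscribed and
    inscribed cubes and their volume is never computed. *)
Lemma lebesgue_ball (r : R) (x : 'rV[R]_N) : 0 <= r ->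
  (mu [set y : Rn R N | (eucl ((y : 'rV[R]_N) - x) < r)%R] <= ((2 * r) ^+ N)%:E)%E.
Proof.
move=> r0; pose v : 'rV[R]_N := const_mx r.
have h i : (x - v) ord0 i <= (x + v) ord0 i.
  by rewrite !mxE; lra.
have := lmu h.
rewrite (_ : \prod_(i < N) _ = (2 * r) ^+ N) => [<-|]; last first.
  rewrite -[in RHS](card_ord N) -prodr_const; apply: eq_bigr => i _; rewrite !mxE; ring.
apply: le_measure; rewrite ?inE.
- apply: measurable_open; apply/open_euclP => y /= yr.
  exists (r - eucl (y - x)); first by rewrite subr_gt0.
  move=> z /= zy; have := ler_eucl_dist z y x; lra.
- exact: measurable_box.
- move=> y yr i; have := le_lt_trans (coord_le_eucl (y - x) i) yr.
  by rewrite !mxE ltr_norml => /andP[? ?]; apply/andP; split; lra.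
Qed.

Lemma lebesgue_ball_ge (r : R) (x : 'rV[R]_N) : 0 < r ->
  (((r / N%:R) ^+ N)%:E <= mu [set y : Rn R N | (eucl ((y : 'rV[R]_N) - x) < r)%R])%E.
Proof.
move=> r0; have NR0 : 0 < N%:R :> R by rewrite ltr0n.
pose w := r / N%:R / 2; pose v : 'rV[R]_N := const_mx w.
have w0 : 0 < w by rewrite !divr_gt0.
have h i : (x - v) ord0 i <= (x + v) ord0 i.
  by rewrite !mxE; lra.
have := lmu h.
rewrite (_ : \prod_(i < N) _ = (r / N%:R) ^+ N) => [<-|]; last first.
  rewrite -[in RHS](card_ord N) -prodr_const; apply: eq_bigr => i _; rewrite !mxE /w card_ord; field.
  by rewrite gt_eqF.
apply: le_measure; rewrite ?inE.
- exact: measurable_box.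
- apply: measurable_open; apply/open_euclP => y /= yr.
  exists (r - eucl (y - x)); first by rewrite subr_gt0.
  move=> z /= zy; have := ler_eucl_dist z y x; lra.
- move=> y yx /=; have yxi i : `|(y - x) ord0 i| <= w.
    have := yx i; rewrite !mxE => /andP[h1 h2].
    by rewrite ler_norml; apply/andP; split; lra.
  apply: (le_lt_trans (eucl_le_coord (ltW w0) yxi)).
  have -> : N%:R * w = r / 2 by rewrite /w; field; rewrite gt_eqF.
  lra.
Qed.

End LebesgueRn.

(** * One-dimensional integrals of powers *)

Section OneDim.
Set Implicit Arguments. Unset Strict Implicit.
Context {R : realType}.
Local Notation leb := (@lebesgue_measure R).
Implicit Types (f : R -> R) (a b c x : R).

Lemma powR_addp x a b : 0 < x -> x `^ (a + b) = x `^ a * x `^ b.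
Proof. by move=> x0; rewrite powRD//; apply/implyP => _; rewrite gt_eqF. Qed.

Lemma integral_indicE d (T : measurableType d) (m : {measure set T -> \bar R})
    (D : set T) (f : T -> R) :
  (\int[m]_(x in D) (f x)%:E = \int[m]_x (\1_D x * f x)%:E)%E.
Proof.
rewrite integral_mkcond; apply: eq_integral => x _.
by rewrite /patch indicE; case: (x \in D); rewrite ?mul1r// mul0r.
Qed.

Lemma lebesgue_affine1 a b (A : set (measurableTypeR R)) : a != 0 -> measurable A ->
  (`|a|%:E * leb ((fun x : measurableTypeR R => (a * x + b)%R : measurableTypeR R) @^-1` A)
   = leb A)%E.
Proof.
move=> a0 mA; set phi : measurableTypeR R -> measurableTypeR R := fun x => _.
have mphi : measurable_fun setT phi.
  by apply: measurable_funD => //; exact: measurable_funM.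
pose m0 := measure_function_pushforward__canonical__measure_function_Measure leb mphi.
pose m1 : {measure set _ -> \bar R} := mscale (NngNum (normr_ge0 a)) m0.
transitivity (m1 A); first by [].
apply/esym/lebesgue_measure_unique => // _ [[c d] _ <-].
rewrite /m1/= /mscale/= /pushforward/=.
have [a_gt0|a_lt0] := ltrP 0 a.
  rewrite (_ : _ @^-1` _ = `](c - b) / a, (d - b) / a]%classic); last first.
    apply/seteqP; split => x /=; rewrite !in_itv/= /phi;
      by rewrite ltr_pdivrMr// ler_pdivlMr// ltrBlDr lerBrDr (mulrC x).
  rewrite !lebesgue_measure_itv/= !lte_fin ltr_pM2r ?invr_gt0// ltrD2r.
  case: ifPn => _; rewrite ?mule0// -!EFinD -EFinM gtr0_norm//; congr EFin.
  by field; rewrite gt_eqF.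
have {a_lt0}a_lt0 : a < 0 by rewrite lt_neqAle a0.
rewrite (_ : _ @^-1` _ = `[(d - b) / a, (c - b) / a[%classic); last first.
  apply/seteqP; split => x /=; rewrite !in_itv/= /phi;
    by rewrite ltr_ndivlMr// ler_ndivrMr// ltrBlDr lerBrDr (mulrC x) andbC.
rewrite !lebesgue_measure_itv/= !lte_fin ltr_nM2r ?invr_lt0// ltrD2r.
case: ifPn => _; rewrite ?mule0// -!EFinD -EFinM ltr0_norm//; congr EFin.
by field; rewrite lt_eqF.
Qed.

Lemma ge0_integral_affine1 a b (f : R -> \bar R) : a != 0 ->
  measurable_fun setT f -> (forall x, 0 <= f x)%E ->
  (\int[leb]_x f x = `|a|%:E * \int[leb]_x f (a * x + b)%R)%E.
Proof.
move=> a0 mf f0; pose phi : measurableTypeR R -> measurableTypeR R := fun x => a * x + b.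
have mphi : measurable_fun setT phi.
  by apply: measurable_funD => //; exact: measurable_funM.
pose m0 := measure_function_pushforward__canonical__measure_function_Measure leb mphi.
transitivity (\int[mscale (NngNum (normr_ge0 a)) m0]_x f x)%E.
  by apply: eq_measure_integral => //= A mA _; rewrite -(lebesgue_affine1 b a0 mA).
rewrite ge0_integral_mscale//=; congr (_ * _)%E.
by rewrite ge0_integral_pushforward.
Qed.

(** For integrands that may blow up at both ends: the fundamental theorem on compact subintervals,
    then monotone convergence. *)
Lemma ge0_FTC_oo (f F : R -> R) a b la lb : a < b ->
  {in `]a, b[, forall x, 0 <= f x} -> {in `]a, b[, continuous f} ->
  {in `]a, b[, forall x, is_derive x 1 F (f x)} ->
  F x @[x --> a^'+] --> la -> F x @[x --> b^'-] --> lb ->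
  (\int[leb]_(x in `]a, b[) (f x)%:E = (lb - la)%:E)%E.
Proof.
move=> ab f0 cf dF Fa Fb.
(* The factor [(b - a) / 3] keeps [a + e k < b - e k] for every [k]. *)
pose e (k : nat) : R := (b - a) / 3 * k.+1%:R^-1.
have e0 k : 0 < e k by rewrite mulr_gt0 ?invr_gt0// divr_gt0// subr_gt0.
have e3 k : e k <= (b - a) / 3.
  by rewrite ler_piMr ?invf_le1 ?ler1n// divr_ge0// subr_ge0 ltW.
have ecvg : e k @[k --> \oo] --> 0.
  rewrite -(mulr0 ((b - a) / 3)); apply: cvgM; first exact: cvg_cst.
  exact: cvg_harmonic.
pose D k : set R := `[a + e k, b - e k]%classic.
have Dsub k : D k `<=` `]a, b[.
  move=> x; rewrite /D /= !in_itv/= => /andP[h1 h2].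
  have ek := e0 k; apply/andP; split; lra.
have mD k : measurable (D k) by exact: measurable_itv.
have mf k : measurable_fun (D k) f.
  apply: (measurable_funS _ (Dsub k)) => //.
  by apply: open_continuous_measurable_fun => //; move=> x; rewrite inE; exact: cf.
have UD : \bigcup_k D k = `]a, b[%classic.
  apply/seteqP; split => [x [k _] /Dsub//|x]; rewrite /= in_itv/= => /andP[ax xb].
  have m0 : 0 < Num.min (x - a) (b - x) by rewrite lt_min !subr_gt0 ax xb.
  have /cvgrPdist_lt/(_ _ m0)[k _ /(_ k (leqnn k))] := ecvg.
  rewrite /= sub0r normrN gtr0_norm// lt_min => /andP[h1 h2].
  exists k => //; rewrite /D/= in_itv/=; apply/andP; split; lra.
have DI k : (\int[leb]_(x in D k) (f x)%:E = (F (b - e k) - F (a + e k))%:E)%E.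
  have lek : a + e k < b - e k.
    have := e3 k; have := e0 k; lra.
  rewrite /D (@continuous_FTC2 _ f F)//.
  - apply: continuous_in_subspaceT => x; rewrite inE => /Dsub.
    exact: cf.
  - have hin x : x \in `[a + e k, b - e k] -> x \in `]a, b[ by exact: Dsub.
    have cF x : x \in `]a, b[ -> F y @[y --> x] --> F x.
      move=> /dF dFx; apply: differentiable_continuous.
      by apply/derivable1_diffP; exact: ex_derive.
    split.
    + by move=> x xab; apply: (@ex_derive _ _ _ _ _ _ (f x)); apply: dF; apply: hin; apply: subset_itv_oo_cc xab.
    + by apply: cvg_at_right_filter; apply: cF; apply: hin; rewrite in_itv/= lexx ltW.
    + by apply: cvg_at_left_filter; apply: cF; apply: hin; rewrite in_itv/= lexx ltW.
  - move=> x /subset_itv_oo_cc /Dsub /dF dFx.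
    by rewrite derive1E; exact: derive_val.
have nd : {homo D : n m / (n <= m)%N >-> (n <= m)%O}.
  move=> n m nm; apply/subsetPset => x; rewrite /D/= !in_itv/= => /andP[h1 h2].
  have : e m <= e n.
    rewrite /e ler_wpM2l ?divr_ge0 ?subr_ge0 ?(ltW ab)// lef_pV2 ?posrE//.
    by rewrite ler_nat.
  by move=> h; apply/andP; split; lra.
have := @ge0_nondecreasing_set_cvg_integral _ (measurableTypeR R) R D (EFin \o f) leb nd mD.
have mEf i : measurable_fun (D i) (EFin \o f) by apply/measurable_EFinP; exact: mf.
move=> /(_ mEf).
have h0 : forall i x, D i x -> (0 <= (EFin \o f) x)%E.
  by move=> k x /Dsub xab /=; rewrite lee_fin; exact: f0.
move=> /(_ h0); rewrite UD => cI.
have cJ : (\int[leb]_(x in D i) (f x)%:E)%E @[i --> \oo] --> (lb - la)%:E.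
  rewrite (_ : (fun i => _) = (fun k => (F (b - e k) - F (a + e k))%:E)); last first.
    by apply/funext => k; rewrite DI.
  apply: cvg_EFin; first by near=> k.
  apply: cvgB.
    apply: (cvg_at_leftP F b lb).1 => //; split=> [k|]; first by rewrite gtrBl.
    by rewrite -[X in _ --> X]subr0; apply: cvgB => //; exact: cvg_cst.
  apply: (cvg_at_rightP F a la).1 => //; split=> [k|]; first by rewrite ltrDl.
  by rewrite -[X in _ --> X]addr0; apply: cvgD => //; exact: cvg_cst.
exact: (cvg_unique _ cI cJ).
Unshelve. all: by end_near. Qed.

Lemma is_derive_powR (k x : R) : 0 < x -> is_derive x 1 (fun y : R => y `^ k) (k * x `^ (k - 1)).
Proof.
move=> x0; have xin : x \in `]0, +oo[ by rewrite in_itv/= x0.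
by apply: DeriveDef; [exact: derivable_powR|rewrite -derive1E powR_derive1].
Qed.

Lemma continuous_powR (k x : R) : 0 < x -> {for x, continuous (fun y : R => y `^ k)}.
Proof.
move=> x0; apply: differentiable_continuous; apply/derivable1_diffP.
by apply: derivable_powR; rewrite in_itv/= x0.
Qed.

Lemma powRN_cvgy (k : R) : 0 < k -> x `^ (- k) @[x --> +oo] --> 0.
Proof.
move=> k0; apply/cvgrPdist_le => /= e e0; near=> x.
have x0 : 0 < x by near: x; exists 0; split => //; exact: num_real.
have ex : e^-1 `^ k^-1 <= x.
  by near: x; exists (e^-1 `^ k^-1); split => [|y /ltW//]; exact: num_real.
rewrite sub0r normrN ger0_norm ?powR_ge0// powRN invf_ple ?posrE ?powR_gt0//.
have -> : e^-1 = (e^-1 `^ k^-1) `^ k.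
  by rewrite -powRrM mulVf ?gt_eqF// powRr1// invr_ge0 ltW.
by rewrite ge0_ler_powR ?nnegrE ?powR_ge0 ?(ltW k0) ?(ltW x0).
Unshelve. all: by end_near. Qed.

Lemma integral_powR_tail (k r : R) : 0 < k -> 0 < r ->
  (\int[leb]_(x in `]r, +oo[%classic) (x `^ (- k - 1))%:E = (r `^ (- k) / k)%:E)%E.
Proof.
move=> k0 r0.
have mf : measurable_fun setT (fun x : R => (x `^ (- k - 1))%:E).
  by apply/measurable_EFinP; exact: measurable_powR.
rewrite integral_itv_obnd_cbnd; last exact: measurable_funTS.
have dF (x : R) : 0 < x -> is_derive x 1 (fun x : R => - k^-1 * x `^ (- k)) (x `^ (- k - 1)).
  move=> x0; have h := is_derive_powR (- k) x0.
  have : is_derive x 1 ((- k^-1) *: (fun y : R => y `^ (- k))) ((- k^-1) *: (- k * x `^ (- k - 1))).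
    exact: is_deriveZ.
  by rewrite /GRing.scale/= mulrA mulrNN mulVf ?mul1r// gt_eqF.
have cF (x : R) : 0 < x -> {for x, continuous (fun x : R => - k^-1 * x `^ (- k))}.
  by move=> x0; apply: cvgM; [exact: cvg_cst|exact: continuous_powR].
rewrite (@ge0_continuous_FTC2y _ _ (fun x => - k^-1 * x `^ (- k)) r 0).
- by rewrite -EFinB sub0r mulNr opprK mulrC.
- by move=> x _; exact: powR_ge0.
- apply: continuous_in_subspaceT => x; rewrite inE/= in_itv/= andbT => rx.
  by apply: continuous_powR; exact: lt_le_trans rx.
- rewrite -[X in _ --> X](mulr0 (- k^-1)).
  by apply: cvgM; [exact: cvg_cst|exact: powRN_cvgy].
- by move=> x rx; apply: (@ex_derive _ _ _ _ _ _ (x `^ (- k - 1))); apply: dF; exact: lt_trans rx.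
- by apply: cvg_at_right_filter; exact: cF.
- move=> x; rewrite in_itv/= andbT => rx.
  by rewrite derive1E; have h := dF x (lt_trans r0 rx); exact: derive_val.
Qed.

Lemma integral_powR_head (k r : R) : 0 < k -> 0 < r ->
  (\int[leb]_(x in `]0%R, r[) (x `^ (k - 1))%:E = (r `^ k / k)%:E)%E.
Proof.
move=> k0 r0; rewrite (@ge0_FTC_oo _ (fun x => k^-1 * x `^ k) 0 r 0 (k^-1 * r `^ k))//.
- by rewrite subr0 mulrC.
- by move=> x _; exact: powR_ge0.
- by move=> x; rewrite in_itv/= => /andP[x0 _]; exact: continuous_powR.
- move=> x; rewrite in_itv/= => /andP[x0 _].
  have := is_derive_powR k x0 => h.
  have : is_derive x 1 (k^-1 *: (fun y : R => y `^ k)) (k^-1 *: (k * x `^ (k - 1))) by exact: is_deriveZ.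
  by rewrite /GRing.scale/= mulKf// gt_eqF.
- by rewrite -[X in _ --> X](mulr0 k^-1); apply: cvgM; [exact: cvg_cst|exact: powR_cvg0].
- apply: cvg_at_left_filter; apply: cvgM; [exact: cvg_cst|exact: continuous_powR].
Qed.

(** The bound is uniform in [c]. Where [0 < |c + x| < L] the integrand is a translate or a reflected
    translate of [H], one for each sign of [c + x]; where [|c + x| >= L] it is at most [L^(-k)]. *)
Lemma integral_powR_shift (k L c : R) : 0 <= k -> k < 1 -> 0 < L ->
  (\int[leb]_x (\1_(`[0%R, L]%classic) x * `|c + x| `^ (- k))%:E <= ((2 / (1 - k) + 1) * L `^ (1 - k))%:E)%E.
Proof.
move=> k0 k1 L0; pose H x := \1_(`]0, L[%classic) x * x `^ (- k).
have mH : measurable_fun setT (EFin \o H).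
  apply/measurable_EFinP; apply: measurable_funM; first exact: measurable_indic.
  exact: measurable_powR.
have H0 x : 0 <= H x by rewrite mulr_ge0 ?powR_ge0.
have HI : (\int[leb]_x (H x)%:E = (L `^ (1 - k) / (1 - k))%:E)%E.
  rewrite -integral_indicE -integral_powR_head ?subr_gt0//.
  by apply: eq_integral => x _; rewrite addrAC subrr sub0r.
have HIp : (\int[leb]_x (H (1 * x + c))%:E = (L `^ (1 - k) / (1 - k))%:E)%E.
  rewrite -HI (ge0_integral_affine1 c (oner_neq0 R) (f := EFin \o H))//.
  by rewrite normr1 mul1e.
have HIn : (\int[leb]_x (H (-1 * x + - c))%:E = (L `^ (1 - k) / (1 - k))%:E)%E.
  have n10 : - 1 != 0 :> R by rewrite oppr_eq0 oner_eq0.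
  rewrite -HI (@ge0_integral_affine1 (-1) (- c) (EFin \o H))//.
  by rewrite normrN1 mul1e.
have mHa a b : measurable_fun setT (fun x => (H (a * x + b))%:E).
  apply: (measurableT_comp (f := EFin \o H) (g := fun x => a * x + b)) => //.
  by apply: measurable_funD => //; exact: measurable_funM.
have mHp := mHa 1 c; have mHn := mHa (-1) (- c).
have mI : measurable_fun setT (fun x => (L `^ (- k) * \1_(`[0, L]%classic) x)%:E).
  apply/measurable_EFinP; apply: measurable_funM => //; exact: measurable_indic.
apply: (@le_trans _ _ (\int[leb]_x ((H (1 * x + c))%:E + (H (-1 * x + - c))%:E +
    (L `^ (- k) * \1_(`[0, L]%classic) x)%:E))%E).
  apply: ge0_le_integral => //.
  - apply/measurable_EFinP; apply: measurable_funM; first exact: measurable_indic.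
    apply: (measurableT_comp (measurable_powR _)); apply: measurableT_comp => //.
    exact: measurable_funD.
  - by apply: emeasurable_funD => //; exact: emeasurable_funD.
  - move=> x _; rewrite -!EFinD lee_fin mul1r mulN1r (addrC x) -opprD (addrC x).
    rewrite [in leLHS]indicE; case: (boolP (x \in _)) => xL; last first.
      by rewrite mul0r !addr_ge0// mulr_ge0 ?powR_ge0.
    rewrite mul1r indicE xL mulr1.
    set y := c + x.
    have [y0|y0|y0] := ltrgtP y 0.
    + have [yL|yL] := ltP (- y) L.
        rewrite ltr0_norm// {2}/H indicE mem_set ?mul1r; last by rewrite /= in_itv/= oppr_gt0 y0.
        by rewrite -addrA addrCA lerDl addr_ge0 ?powR_ge0.
      apply: ler_wpDl; first by rewrite addr_ge0.
      rewrite ltr0_norm// !powRN lef_pV2 ?posrE ?powR_gt0// ?oppr_gt0//.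
      by rewrite ge0_ler_powR ?nnegrE// ?(ltW L0)// ltW// oppr_gt0.
    + have [yL|yL] := ltP y L.
        rewrite gtr0_norm// {1}/H indicE mem_set ?mul1r; last by rewrite /= in_itv/= y0.
        by rewrite -addrA lerDl addr_ge0 ?powR_ge0.
      apply: ler_wpDl; first by rewrite addr_ge0.
      rewrite gtr0_norm// !powRN lef_pV2 ?posrE ?powR_gt0//.
      by rewrite ge0_ler_powR ?nnegrE// ?(ltW L0)// ltW.
    + apply: ler_wpDl; first by rewrite addr_ge0.
      (* At [c + x = 0] the power is 1 if [k = 0], and 0 otherwise. *)
      have [k00|k00] := eqVneq k 0; first by rewrite k00 oppr0 !powRr0.
      by rewrite y0 normr0 powR0 ?powR_ge0// oppr_eq0.
have mS : measurable_fun setT (fun x => ((H (1 * x + c))%:E + (H (-1 * x + - c))%:E)%E).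
  exact: emeasurable_funD.
have I0 x : (0 <= (L `^ (- k) * \1_(`[0%R, L]%classic) x)%:E)%E.
  by rewrite lee_fin mulr_ge0 ?powR_ge0.
have S0 x : (0 <= (H (1 * x + c))%:E + (H (-1 * x + - c))%:E)%E.
  by rewrite -EFinD lee_fin addr_ge0.
rewrite ge0_integralD//.
have E1 : (\int[leb]_x ((H (1 * x + c))%:E + (H (-1 * x + - c))%:E) =
    (L `^ (1 - k) / (1 - k))%:E + (L `^ (1 - k) / (1 - k))%:E)%E.
  have He0 a b x : (0 <= (H (a * x + b))%:E)%E by rewrite lee_fin.
  by rewrite ge0_integralD// -{1}HIp -HIn.
have E2 : (\int[leb]_x (L `^ (- k) * \1_(`[0%R, L]%classic) x)%:E = (L `^ (1 - k))%:E)%E.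
  under eq_integral do rewrite EFinM.
  rewrite ge0_integralZl_EFin//; last 2 first.
  - by apply/measurable_EFinP; exact: measurable_indic.
  - exact: powR_ge0.
  transitivity ((L `^ (- k))%:E * leb `[0%R, L]%classic)%E.
    by rewrite integral_indic// setIT.
  rewrite lebesgue_measure_itv/= lte_fin L0 sube0 -EFinM.
  by rewrite (addrC 1) powR_addp// powRr1// ltW.
apply: (@le_trans _ _ ((L `^ (1 - k) / (1 - k))%:E + (L `^ (1 - k) / (1 - k))%:E + (L `^ (1 - k))%:E)%E).
  by apply: leeD; [rewrite -E1|rewrite -E2].
rewrite -!EFinD lee_fin le_eqVlt; apply/orP; left; apply/eqP; ring.
Qed.

End OneDim.

(** * Singular kernels *)

Section MeasTools.
Set Implicit Arguments. Unset Strict Implicit.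
Context {R : realType} d (T : measurableType d).
Implicit Types (f g : T -> R).

Lemma measurable_natr (b : T -> bool) :
  measurable_fun setT b -> measurable_fun setT (fun t => (b t)%:R : R).
Proof.
move=> mb; rewrite (_ : (fun t => _) = \1_(b @^-1` [set true])).
  by apply: measurable_indic; rewrite -[X in measurable X]setTI; exact: mb.
apply/funext => t; rewrite indicE; congr (nat_of_bool _)%:R.
by apply/idP/idP => [bt|]; rewrite inE.
Qed.

Lemma measurable_powRl f k : measurable_fun setT f ->
  measurable_fun setT (fun t => f t `^ k).
Proof. by move=> mf; apply: (measurableT_comp (measurable_powR k)). Qed.

Lemma measurable_normrc f : measurable_fun setT f -> measurable_fun setT (fun t => `|f t|).
Proof. by move=> mf; apply: measurableT_comp. Qed.

Lemma measurable_oppc f : measurable_fun setT f -> measurable_fun setT (fun t => - f t).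
Proof. by move=> mf; apply: measurableT_comp. Qed.

(** Inversion is not continuous at 0, so it is rewritten on each sign through [powR] with exponent
    -1, which is measurable on the whole line. *)
Lemma measurable_invc f : measurable_fun setT f -> measurable_fun setT (fun t => (f t)^-1).
Proof.
move=> mf.
rewrite (_ : (fun t => _) = (fun t => (0 < f t)%R%:R * `|f t| `^ (-1) - (f t < 0)%R%:R * `|f t| `^ (-1))).
  apply: measurable_funB; apply: measurable_funM.
  - by apply: measurable_natr; exact: measurable_fun_ltr.
  - by apply: measurable_powRl; exact: measurable_normrc.
  - by apply: measurable_natr; exact: measurable_fun_ltr.
  - by apply: measurable_powRl; exact: measurable_normrc.
apply/funext => t; rewrite powR_inv1//.
by have [x0|x0|->] := ltrgt0P (f t); rewrite ?mul1r ?mul0r ?subr0 ?sub0r ?invrN ?opprK ?invr0.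
Qed.

Lemma measurable_spowc f q : measurable_fun setT f -> measurable_fun setT (fun t => spow (f t) q).
Proof.
move=> mf.
rewrite (_ : (fun t => _) = (fun t => (0 < f t)%R%:R * `|f t| `^ q - (f t < 0)%R%:R * `|f t| `^ q)).
  apply: measurable_funB; apply: measurable_funM.
  - by apply: measurable_natr; exact: measurable_fun_ltr.
  - by apply: measurable_powRl; exact: measurable_normrc.
  - by apply: measurable_natr; exact: measurable_fun_ltr.
  - by apply: measurable_powRl; exact: measurable_normrc.
apply/funext => t; rewrite /spow.
have [x0|x0|->] := ltrgt0P (f t); rewrite ?sgr0 ?mul1r ?mul0r ?subr0 ?sub0r//.
  by rewrite gtr0_sg// mul1r.
by rewrite ltr0_sg// mulN1r.
Qed.

Context {N : nat}.
Implicit Types (u v : T -> Rn R N).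

Lemma measurable_coordc u i : measurable_fun setT u -> measurable_fun setT (fun t => u t ord0 i).
Proof. by move=> mu; apply: (measurableT_comp (measurable_coord i)). Qed.

Lemma measurable_euclc u : measurable_fun setT u -> measurable_fun setT (fun t => eucl (u t)).
Proof.
move=> mu; apply: (measurableT_comp (f := fun x : Rn R N => eucl x)) => //.
by apply: continuous_measurable_Rn; exact: continuous_eucl.
Qed.

Lemma measurable_dotvc (w : 'rV[R]_N) u : measurable_fun setT u ->
  measurable_fun setT (fun t => dotv w (u t)).
Proof.
move=> mu; apply: (measurableT_comp (f := fun x : Rn R N => dotv w x)) => //.
by apply: continuous_measurable_Rn; exact: continuous_dotv.
Qed.

Lemma measurable_addv u v : measurable_fun setT u -> measurable_fun setT v ->
  measurable_fun setT (fun t => (u t : 'rV[R]_N) + v t : Rn R N).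
Proof.
move=> mu mv; apply: measurable_fun_Rn => i; under eq_fun do rewrite mxE.
by apply: measurable_funD; exact: measurable_coordc.
Qed.

Lemma measurable_oppv u : measurable_fun setT u ->
  measurable_fun setT (fun t => - (u t : 'rV[R]_N) : Rn R N).
Proof.
move=> mu; apply: measurable_fun_Rn => i; under eq_fun do rewrite mxE.
by apply: measurable_oppc; exact: measurable_coordc.
Qed.

Lemma measurable_scalev f u : measurable_fun setT f -> measurable_fun setT u ->
  measurable_fun setT (fun t => f t *: (u t : 'rV[R]_N) : Rn R N).
Proof.
move=> mf mu; apply: measurable_fun_Rn => i; under eq_fun do rewrite mxE.
by apply: measurable_funM => //; exact: measurable_coordc.
Qed.

End MeasTools.

Ltac mstep_slow := first
 [ assumption | exact: measurable_cst | exact: measurable_id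
 | exact: measurable_fst | exact: measurable_snd
 | apply: measurable_natr | apply: measurable_fun_ltr | apply: measurable_fun_ler
 | apply: measurable_powRl | apply: measurable_normrc | apply: measurable_dotvc | apply: measurable_euclc
 | apply: measurable_spowc | apply: measurable_invc | apply: measurable_maxr
 | apply: measurable_addv | apply: measurable_oppv | apply: measurable_scalev
 | apply: measurable_funM | apply: measurable_funD | apply: measurable_oppc ].
(* Dispatching on the head symbol avoids the costly failing unifications of [mstep_slow]. *)
Ltac mstep := lazymatch goal with
 | |- measurable_fun _ (fun x => x) => exact: measurable_id
 | |- measurable_fun _ (fun _ => ?c) => exact: measurable_cst
 | |- measurable_fun _ (fun x => (nat_of_bool _)%:R) => first [exact: measurable_cst | apply: measurable_natr]
 | |- measurable_fun _ (fun x => _ `^ _) => apply: measurable_powRl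
 | |- measurable_fun _ (fun x => _ * _) => apply: measurable_funM
 | |- measurable_fun _ (fun x => `| _ |) => apply: measurable_normrc
 | |- measurable_fun _ (fun x => eucl _) => apply: measurable_euclc
 | |- measurable_fun _ (fun x => dotv _ _) => apply: measurable_dotvc
 | _ => mstep_slow end.
Ltac mfun := repeat mstep.

Section RealIntegrals.
Set Implicit Arguments. Unset Strict Implicit.
Context {R : realType} d (T : measurableType d) (m : {measure set T -> \bar R}).
Implicit Types (f g : T -> R).

Lemma int_scale (k : R) f : 0 <= k -> measurable_fun setT f -> (forall x, 0 <= f x) ->
  (\int[m]_x (k * f x)%:E = k%:E * \int[m]_x (f x)%:E)%E.
Proof.
move=> k0 /measurable_EFinP mf f0; under eq_integral do rewrite EFinM.
by rewrite ge0_integralZl_EFin// => x _; rewrite lee_fin.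
Qed.

Lemma int_add f g : measurable_fun setT f -> measurable_fun setT g ->
  (forall x, 0 <= f x) -> (forall x, 0 <= g x) ->
  (\int[m]_x (f x + g x)%:E = \int[m]_x (f x)%:E + \int[m]_x (g x)%:E)%E.
Proof.
move=> /measurable_EFinP mf /measurable_EFinP mg f0 g0.
under eq_integral do rewrite EFinD.
by rewrite ge0_integralD// => x _; rewrite lee_fin.
Qed.

Lemma int_le f g : measurable_fun setT f -> measurable_fun setT g ->
  (forall x, 0 <= f x) -> (forall x, f x <= g x) ->
  (\int[m]_x (f x)%:E <= \int[m]_x (g x)%:E)%E.
Proof.
move=> /measurable_EFinP mf /measurable_EFinP mg f0 fg.
by apply: ge0_le_integral => // x _; rewrite lee_fin.
Qed.

End RealIntegrals.

(** * Layer-cake bounds for kernel integrals *)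

Section Layer.
Set Implicit Arguments. Unset Strict Implicit.
Context {R : realType} {N : nat}.
Hypothesis N0 : (0 < N)%N.
Context (mu : {sigma_finite_measure set (Rn R N) -> \bar R}) (lmu : is_lebesgue mu).
Local Notation leb := (@lebesgue_measure R).

(* Layer-cake form of a power of the norm: every kernel integral below reduces to integrals over balls. *)
Lemma layer_point (a r : R) : 0 < a -> 0 < r ->
  ((r `^ (- a))%:E = a%:E * \int[leb]_x ((r < x)%R%:R * x `^ (- a - 1))%:E)%E.
Proof.
move=> a0 r0; transitivity (a%:E * (r `^ (- a) / a)%:E)%E.
  by rewrite -EFinM mulrC divfK// gt_eqF.
rewrite -integral_powR_tail// integral_indicE; congr (_ * _)%E.
apply: eq_integral => x _; congr (_ * _)%:E; rewrite indicE; congr (nat_of_bool _)%:R.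
by apply/idP/idP; rewrite inE /= in_itv/= andbT.
Qed.

(** Tonelli applied to [layer_point]. At the origin a negative power of the norm is 0 by convention,
    while the integral over [x] diverges; [g 0 = 0] reconciles the two without a null set. *)
Lemma layer_integral (a : R) (g : Rn R N -> R) : 0 < a -> measurable_fun setT g ->
  (forall z, 0 <= g z) -> g 0 = 0 ->
  (\int[mu]_z (g z * eucl z `^ (- a))%:E =
   a%:E * \int[leb]_x (((0 < x)%R%:R * x `^ (- a - 1))%:E *
            \int[mu]_z ((eucl z < x)%R%:R * g z)%:E))%E.
Proof.
move=> a0 mg g0 g00.
pose H (w : Rn R N * measurableTypeR R) : \bar R :=
  ((0 < w.2)%R%:R * w.2 `^ (- a - 1) * ((eucl w.1 < w.2)%R%:R * g w.1))%:E.
have mH : measurable_fun setT H.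
  apply/measurable_EFinP; mfun.
  exact: (measurableT_comp mg measurable_fst).
have H0 w : (0 <= H w)%E by rewrite lee_fin !mulr_ge0 ?powR_ge0.
have E1 z : ((g z * eucl z `^ (- a))%:E = a%:E * \int[leb]_x H (z, x))%E.
  have [->|z0] := eqVneq z 0.
    rewrite g00 mul0r integral0_eq ?mule0// => x _.
    by rewrite /H /= g00 !mulr0.
  have ez : 0 < eucl z by rewrite eucl_gt0.
  rewrite EFinM (layer_point a0 ez) muleCA; congr (_ * _)%E.
  rewrite -ge0_integralZl_EFin//; last 2 first.
  - by move=> x _; rewrite lee_fin mulr_ge0 ?powR_ge0.
  - by apply/measurable_EFinP; mfun.
  apply: eq_integral => x _; rewrite -EFinM /H/=; congr EFin.
  have [zx|xz] := ltP (eucl z) x; last by rewrite !mul0r !mulr0.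
  by rewrite (lt_trans ez zx) !mul1r mulrC.
under eq_integral do rewrite E1.
rewrite ge0_integralZl_EFin//; last 3 first.
- by move=> z _; apply: integral_ge0.
- exact: (@measurable_fun_fubini_tonelli_F _ _ _ _ _ leb H mH H0).
- exact: ltW.
congr (_ * _)%E; rewrite (@fubini_tonelli _ _ _ _ _ mu leb H mH H0).
apply: eq_integral => x _; rewrite -ge0_integralZl_EFin//.
- by move=> z _; rewrite lee_fin mulr_ge0.
- by apply/measurable_EFinP; mfun.
- by rewrite mulr_ge0 ?powR_ge0.
Qed.

Lemma layer_le (a : R) (g : Rn R N -> R) (Phi : R -> R) : 0 < a -> measurable_fun setT g ->
  (forall z, 0 <= g z) -> measurable_fun setT Phi -> (forall x, 0 <= Phi x) ->
  (forall x : R, (0 < x)%R -> \int[mu]_z ((eucl z < x)%R%:R * g z)%:E <= (Phi x)%:E)%E ->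
  (\int[mu]_z (g z * eucl z `^ (- a))%:E <=
   a%:E * \int[leb]_x ((0 < x)%R%:R * x `^ (- a - 1) * Phi x)%:E)%E.
Proof.
move=> a0 mg g0 mP P0 gP; pose g' (z : Rn R N) : R := (z != 0)%:R * g z.
have mz : measurable_fun setT (fun z : Rn R N => (z != 0 : bool)).
  have -> : (fun z : Rn R N => (z != 0 : bool)) = (fun z : Rn R N => 0 < eucl z).
    by apply/funext => z; rewrite eucl_gt0.
  by mfun.
have mg' : measurable_fun setT g' by rewrite /g'; mfun.
have g'0 z : 0 <= g' z by rewrite mulr_ge0.
have gg z : g' z <= g z by rewrite /g'; case: (z != 0); rewrite ?mul1r ?mul0r.
(* Removing the origin does not change the integral, since the negative power vanishes there, and it
   makes [layer_integral] applicable to [g']. *)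
have -> : (\int[mu]_z (g z * eucl z `^ (- a))%:E = \int[mu]_z (g' z * eucl z `^ (- a))%:E)%E.
  apply: eq_integral => z _; rewrite /g'; have [->|z0] := eqVneq z 0; last by rewrite mul1r.
  by rewrite eucl0 powR0 ?mulr0// oppr_eq0 gt_eqF.
rewrite layer_integral//; last by rewrite /g' eqxx mul0r.
rewrite lee_wpmul2l ?lee_fin ?(ltW a0)//; apply: ge0_le_integral => //.
- move=> x _; apply: mule_ge0; first by rewrite lee_fin mulr_ge0 ?powR_ge0.
  by apply: integral_ge0 => z _; rewrite lee_fin mulr_ge0.
- apply: emeasurable_funM; first by apply/measurable_EFinP; mfun.
  pose H (w : Rn R N * measurableTypeR R) : \bar R := ((eucl w.1 < w.2)%R%:R * g' w.1)%:E.
  have mH : measurable_fun setT H.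
    have mg1 : measurable_fun setT (fun w : Rn R N * measurableTypeR R => g' w.1).
      exact: (measurableT_comp mg' measurable_fst).
    by apply/measurable_EFinP; mfun.
  apply: (@measurable_fun_fubini_tonelli_G _ _ _ _ _ mu H mH) => w.
  by rewrite lee_fin mulr_ge0.
- by apply/measurable_EFinP; mfun.
- move=> x _; have [x0|x0] := ltP 0 x; last by rewrite !mul0r mul0e.
  rewrite [leRHS]EFinM lee_wpmul2l ?lee_fin ?mulr_ge0 ?powR_ge0//.
  apply: le_trans (gP x x0); apply: ge0_le_integral => //.
  - by move=> z _; rewrite lee_fin mulr_ge0.
  - by apply/measurable_EFinP; mfun.
  - by apply/measurable_EFinP; mfun.
  - by move=> z _; rewrite lee_fin ler_wpM2l.
Qed.

(** If [g] has mass at most [C0 x^(N-b)] on the ball of radius [x], the layer-cake integrand is of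
    order [x^(c-b-1)] near 0, which is integrable as [b < c]. Beyond [d] the mass no longer grows,
    and [c < N] makes the tail converge. *)
Lemma near_kernel_bound (b c C0 d : R) (g : Rn R N -> R) : b < c -> c < N%:R -> 0 <= C0 -> 0 < d ->
  measurable_fun setT g -> (forall z, 0 <= g z) ->
  (forall x : R, (0 < x)%R ->
     \int[mu]_z ((eucl z < x)%R%:R * g z)%:E <= (C0 * x `^ (N%:R - b))%:E)%E ->
  (\int[mu]_z ((eucl z < d)%R%:R * g z * eucl z `^ (c - N%:R))%:E <=
   (C0 * (N%:R - c) * (2 `^ (c - b) / (c - b) + (N%:R - c)^-1) * d `^ (c - b))%:E)%E.
Proof.
move=> bc cN C00 d0 mg g0 gC.
have cb0 : 0 < c - b by rewrite subr_gt0.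
have Nc0 : 0 < N%:R - c by rewrite subr_gt0.
have Nb0 : 0 < N%:R - b by rewrite subr_gt0 (lt_trans bc).
pose Phi x := C0 * Num.min x d `^ (N%:R - b).
rewrite -(opprB N%:R c).
apply: (le_trans (@layer_le _ (fun z => (eucl z < d)%R%:R * g z) Phi Nc0 _ _ _ _ _)).
- by mfun.
- by move=> z; rewrite mulr_ge0.
- by rewrite /Phi; apply: measurable_funM => //; apply: measurable_powRl; exact: measurable_minr.
- by move=> x; rewrite mulr_ge0 ?powR_ge0.
- move=> x x0; have m0 : 0 < Num.min x d by rewrite lt_min x0 d0.
  apply: le_trans (gC _ m0); rewrite le_eqVlt; apply/orP; left; apply/eqP.
  apply: eq_integral => z _; rewrite mulrA -natrM lt_min mulnb//.
(* The head runs up to [2 * d] so that it covers [x = d], a point missed by the open half-line of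
   [B]. *)
pose A x : R := (\1_(`]0%R, (2 * d)[%classic) x * x `^ (c - b - 1)).
pose B x : R := (\1_(`]d, +oo[%classic) x * x `^ (- (N%:R - c) - 1)).
have mA : measurable_fun setT A by apply: measurable_funM; [exact: measurable_indic|exact: measurable_powR].
have mB : measurable_fun setT B by apply: measurable_funM; [exact: measurable_indic|exact: measurable_powR].
have A0 x : 0 <= A x by rewrite mulr_ge0 ?powR_ge0.
have B0 x : 0 <= B x by rewrite mulr_ge0 ?powR_ge0.
have IA : (\int[leb]_x (A x)%:E = ((2 * d) `^ (c - b) / (c - b))%:E)%E.
  by rewrite /A -integral_indicE integral_powR_head// mulr_gt0.
have IB : (\int[leb]_x (B x)%:E = (d `^ (- (N%:R - c)) / (N%:R - c))%:E)%E.
  by rewrite /B -integral_indicE integral_powR_tail.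
have key : (\int[leb]_x ((0 < x)%R%:R * x `^ (- (N%:R - c) - 1) * Phi x)%:E <=
    \int[leb]_x (C0 * (A x + d `^ (N%:R - b) * B x))%:E)%E.
  apply: ge0_le_integral => //.
  - by move=> x _; rewrite lee_fin !mulr_ge0 ?powR_ge0.
  - apply/measurable_EFinP; mfun; exact: measurable_minr.
  - by apply/measurable_EFinP; mfun.
  - move=> x _; rewrite lee_fin.
    have [x0|x0] := ltP 0 x; last first.
      by rewrite !mul0r !mulr_ge0 ?addr_ge0 ?mulr_ge0 ?powR_ge0.
    rewrite mul1r /Phi mulrCA ler_wpM2l//.
    have [xd|dx] := ltP x d.
      rewrite /A indicE mem_set ?mul1r; last by rewrite /= in_itv/= x0/=; lra.
      apply: ler_wpDr; first by rewrite mulr_ge0 ?powR_ge0.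
      by rewrite -powR_addp// le_eqVlt; apply/orP; left; apply/eqP; congr (_ `^ _); ring.
    have [{}dx|xd] := ltrP d x.
      apply: ler_wpDl => //.
      by rewrite /B indicE mem_set ?mul1r 1?mulrC// /= in_itv/= dx.
    have -> : x = d by apply/eqP; rewrite eq_le dx xd.
    apply: ler_wpDr; first by rewrite mulr_ge0 ?powR_ge0.
    rewrite /A indicE mem_set ?mul1r; last by rewrite /= in_itv/= d0/=; lra.
    by rewrite -powR_addp// le_eqVlt; apply/orP; left; apply/eqP; congr (_ `^ _); ring.
apply: (le_trans (lee_wpmul2l _ key)); first by rewrite lee_fin ltW.
have AB0 x : 0 <= A x + d `^ (N%:R - b) * B x by rewrite addr_ge0// mulr_ge0// powR_ge0.
rewrite (@int_scale _ _ (measurableTypeR R))//; last by mfun.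
rewrite (_ : (\int[leb]_x _)%E =
  ((2 * d) `^ (c - b) / (c - b) + (d `^ (N%:R - b)) * (d `^ (- (N%:R - c)) / (N%:R - c)))%:E); last first.
  rewrite (@int_add _ _ (measurableTypeR R) _ A)//; [|by mfun|by move=> x; rewrite mulr_ge0 ?powR_ge0].
  by rewrite (@int_scale _ _ (measurableTypeR R)) ?powR_ge0// EFinD EFinM IA IB.
set X := (X in (C0%:E * X%:E)%E); apply: (@le_trans _ _ (((N%:R - c) * (C0 * X))%:E)); first by rewrite !EFinM.
rewrite lee_fin /X powRM ?(ltW d0)//.
have -> : d `^ (N%:R - b) * (d `^ (- (N%:R - c)) / (N%:R - c)) = (N%:R - c)^-1 * d `^ (c - b).
  by rewrite mulrA -powR_addp// mulrC; congr (_ * _ `^ _); ring.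
rewrite le_eqVlt; apply/orP; left; apply/eqP; ring.
Qed.

Lemma integral_ball_le (x : R) : 0 <= x ->
  (\int[mu]_z ((eucl z < x)%R%:R : R)%:E <= ((2 * x) ^+ N)%:E)%E.
Proof.
move=> x0; apply: le_trans (lebesgue_ball lmu 0 x0).
rewrite -[in leRHS](setIT [set y | _]) -integral_indic//; last first.
  rewrite -[X in measurable X]setTI.
  have : measurable_fun setT (fun z : Rn R N => (eucl ((z : 'rV[R]_N) - 0) < x)%R) by mfun.
  by move=> /(_ measurableT [set true]); rewrite /preimage/=; apply.
rewrite le_eqVlt; apply/orP; left; apply/eqP; apply: eq_integral => z _.
rewrite indicE; congr (nat_of_bool _)%:R%:E.
by apply/idP/idP; rewrite inE /= subr0.
Qed.

Lemma far_kernel_bound (c d : R) : 0 < c -> 0 < d ->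
  (\int[mu]_z ((d <= eucl z)%R%:R * eucl z `^ (- (N%:R + c)))%:E <=
   ((N%:R + c) * 2 ^+ N / c * d `^ (- c))%:E)%E.
Proof.
move=> c0 d0; have Nc0 : 0 < N%:R + c by rewrite ltr_wpDl.
(* For [x <= d] no [z] satisfies [d <= eucl z < x]; for larger [x] the volume of the enclosing cube
   is enough. *)
pose Phi x := (d < x)%R%:R * (2 * x) `^ N%:R : R.
apply: (le_trans (@layer_le _ (fun z => (d <= eucl z)%R%:R) Phi Nc0 _ _ _ _ _)).
- by mfun.
- by [].
- by rewrite /Phi; mfun.
- by move=> x; rewrite mulr_ge0 ?powR_ge0.
- move=> x x0; rewrite /Phi; have [dx|xd] := ltP d x; last first.
    rewrite mul0r integral0_eq// => z _; have [zx|] := ltP (eucl z) x; last by rewrite mul0r.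
    by rewrite leNgt (lt_le_trans zx xd) mulr0.
  rewrite mul1r powR_mulrn ?mulr_ge0 ?(ltW x0)//.
  apply: le_trans (integral_ball_le (ltW x0)); apply: ge0_le_integral => //.
  - by apply/measurable_EFinP; mfun.
  - by apply/measurable_EFinP; mfun.
  - by move=> z _; rewrite lee_fin ler_piMr// lern1 leq_b1.
have -> : (\int[leb]_x ((0 < x)%R%:R * x `^ (- (N%:R + c) - 1) * Phi x)%:E =
   (2 ^+ N)%:E * \int[leb]_x (\1_(`]d, +oo[%classic) x * x `^ (- c - 1))%:E)%E.
  have mI : measurable_fun setT (fun x : measurableTypeR R => \1_(`]d, +oo[%classic) x * x `^ (- c - 1)).
    by apply: measurable_funM; [exact: measurable_indic|exact: measurable_powR].
  have hI (x : measurableTypeR R) : 0 <= \1_(`]d, +oo[%classic) x * x `^ (- c - 1).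
    by rewrite mulr_ge0 ?powR_ge0.
  rewrite -(@int_scale _ _ (measurableTypeR R) leb _ _ (exprn_ge0 _ (ler0n _ 2)) mI hI).
  apply: eq_integral => x _; congr EFin; rewrite /Phi indicE.
  have [dx|xd] := ltP d x; last by rewrite memNset ?mul0r ?mulr0//= in_itv/= andbT; apply/negP; rewrite -leNgt.
  have x0 := lt_trans d0 dx; rewrite x0 !mul1r mem_set ?mul1r; last by rewrite /= in_itv/= dx.
  rewrite powRM ?(ltW x0)// powR_mulrn// mulrCA -powR_addp//; congr (_ * _ `^ _); ring.
rewrite -integral_indicE integral_powR_tail// -!EFinM lee_fin le_eqVlt; apply/orP; left; apply/eqP; ring.
Qed.

End Layer.

Section Slab.
Set Implicit Arguments. Unset Strict Implicit.
Context {R : realType} {N : nat}.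
Hypothesis N0 : (0 < N)%N.
Context (mu : {sigma_finite_measure set (Rn R N) -> \bar R}) (lmu : is_lebesgue mu).
Local Notation leb := (@lebesgue_measure R).

(* Averaging over the translates by [t e], [0 <= t <= x], reduces the bound to a one-dimensional integral in [t]. *)
Lemma slab_bound (k x : R) (G : Rn R N -> R) (e : 'rV[R]_N) : 0 <= k -> k < 1 -> 0 < x ->
  measurable_fun setT G -> eucl e <= 1 ->
  (forall (z : 'rV[R]_N) (t : R), G (z + t *: e) = G z + t) ->
  (\int[mu]_z ((eucl z < x)%R%:R * `|G z| `^ (- k))%:E <=
   ((2 / (1 - k) + 1) * 4 ^+ N * x `^ (N%:R - k))%:E)%E.
Proof.
move=> k0 k1 x0 mG e1 Ge; set I := (X in (X <= _)%E).
set Ck := 2 / (1 - k) + 1.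
have Ck0 : 0 <= Ck by rewrite addr_ge0// divr_ge0// subr_ge0 ltW.
have I0 : (0 <= I)%E by apply: integral_ge0 => z _; rewrite lee_fin mulr_ge0 ?powR_ge0.
pose J : measurableTypeR R -> R := \1_(`[0%R, x]%classic).
have mJ : measurable_fun setT J by exact: measurable_indic.
have J0 t : 0 <= J t by [].
have IJ : (\int[leb]_t (J t)%:E = x%:E)%E.
  transitivity (leb `[0%R, x]%classic); first by rewrite integral_indic// setIT.
  by rewrite lebesgue_measure_itv/= lte_fin x0 sube0.
pose H (w : Rn R N * measurableTypeR R) : R :=
  (eucl w.1 < 2 * x)%R%:R * (J w.2 * `|G w.1 + w.2| `^ (- k)).
have mG1 : measurable_fun setT (fun w : Rn R N * measurableTypeR R => G w.1).
  exact: (measurableT_comp mG measurable_fst).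
have mJ2 : measurable_fun setT (fun w : Rn R N * measurableTypeR R => J w.2).
  exact: (measurableT_comp mJ measurable_snd).
have mH : measurable_fun setT (EFin \o H).
  by apply/measurable_EFinP; rewrite /H; mfun.
have H0 w : 0 <= H w by rewrite !mulr_ge0 ?powR_ge0.
have H0' w : (0 <= (EFin \o H) w)%E by rewrite lee_fin.
(* Translation by [t e] with [0 <= t <= x] keeps the ball of radius [x] inside the ball of radius
   [2 * x] and turns [G z] into [G z + t]. *)
have step1 t : ((J t)%:E * I <= \int[mu]_z (H (z, t))%:E)%E.
  rewrite /J indicE; case: (boolP (t \in _)) => [|_]; last first.
    by rewrite mul0e; apply: integral_ge0 => z _; rewrite lee_fin.
  rewrite mul1e inE /= in_itv/= => /andP[t0 tx].
  rewrite /I (ge0_integral_translate N0 lmu (t *: e)); last 2 first.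
  - by apply/measurable_EFinP; mfun.
  - by move=> z; rewrite lee_fin mulr_ge0 ?powR_ge0.
  apply: int_le.
  - pose G' (z : Rn R N) : R := G ((z : 'rV[R]_N) + t *: e).
    have mG' : measurable_fun setT G' by apply: (measurableT_comp mG); mfun.
    by rewrite -/(G' _); mfun.
  - apply: (measurableT_comp (f := H) (g := fun z : Rn R N => (z, t) : Rn R N * measurableTypeR R)).
      exact/measurable_EFinP.
    exact: measurable_pair2.
  - by move=> z; rewrite mulr_ge0 ?powR_ge0.
  - move=> z; rewrite /H /= Ge /J indicE mem_set ?mul1r; last by rewrite /= in_itv/= t0.
    have [h|_] := ltP (eucl (z + t *: e)) x; last by rewrite mul0r mulr_ge0 ?powR_ge0.
    suff -> : eucl z < 2 * x by [].
    have := ler_euclD (z + t *: e) (- (t *: e)); rewrite addrK euclN euclZ ger0_norm//.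
    have : t * eucl e <= x by rewrite -[leRHS]mulr1 ler_pM// eucl_ge0.
    lra.
have step2 : (x%:E * I <= \int[leb]_t \int[mu]_z (H (z, t))%:E)%E.
  rewrite -IJ -ge0_integralZr//; last 2 first.
  - exact/measurable_EFinP.
  - by move=> t _; rewrite lee_fin.
  apply: ge0_le_integral => //.
  - by move=> t _; rewrite mule_ge0// lee_fin.
  - by apply: emeasurable_funM => //; exact/measurable_EFinP.
  - exact: (@measurable_fun_fubini_tonelli_G _ _ _ _ _ mu (EFin \o H) mH H0').
have step3 : (\int[leb]_t \int[mu]_z (H (z, t))%:E <= (Ck * x `^ (1 - k))%:E * ((2 * (2 * x)) ^+ N)%:E)%E.
  rewrite -(@fubini_tonelli _ _ _ _ _ mu leb (EFin \o H) mH H0').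
  apply: (@le_trans _ _ ((Ck * x `^ (1 - k))%:E * \int[mu]_z ((eucl z < 2 * x)%R%:R : R)%:E)%E).
    rewrite -int_scale ?mulr_ge0 ?powR_ge0//; last by mfun.
    apply: ge0_le_integral => //.
    - by move=> z _; apply: integral_ge0.
    - exact: (@measurable_fun_fubini_tonelli_F _ _ _ _ _ leb (EFin \o H) mH H0').
    - by apply/measurable_EFinP; mfun.
    - move=> z _; rewrite /= /H/=.
      have [_|_] := ltP (eucl z) (2 * x); last first.
        by under eq_integral do rewrite mul0r; rewrite integral0 lee_fin mulr0.
      under eq_integral do rewrite mul1r.
      by rewrite mulr1; exact: integral_powR_shift.
  rewrite lee_wpmul2l ?lee_fin ?mulr_ge0 ?powR_ge0//.
  by apply: integral_ball_le => //; rewrite mulr_ge0 ?(ltW x0).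
have := le_trans step2 step3.
rewrite -EFinM => h.
rewrite -(@lee_pmul2l _ x%:E) ?lte_fin// -EFinM.
apply: (le_trans h); rewrite lee_fin le_eqVlt; apply/orP; left; apply/eqP.
rewrite mulrA (_ : 2 * 2 = 4); last by ring.
rewrite exprMn -[in LHS](powR_mulrn _ (ltW x0)).
have -> : x * (Ck * 4 ^+ N * x `^ (N%:R - k)) = Ck * 4 ^+ N * (x `^ 1 * x `^ (N%:R - k)).
  by rewrite powRr1 ?ltW//; ring.
have -> : Ck * x `^ (1 - k) * (4 ^+ N * x `^ N%:R) = Ck * 4 ^+ N * (x `^ (1 - k) * x `^ N%:R).
  by ring.
by rewrite -!powR_addp//; congr (_ * _ `^ _); ring.
Qed.

End Slab.

(** * Reduction of integrals of functions of [dotv v z] to the half-line *)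

Section HalfSpace.
Set Implicit Arguments. Unset Strict Implicit.
Context {R : realType} {N : nat}.
Hypothesis N0 : (0 < N)%N.
Context (mu : {sigma_finite_measure set (Rn R N) -> \bar R}) (lmu : is_lebesgue mu).
Local Notation leb := (@lebesgue_measure R).

Lemma scale_halfline (a t : R) (G : R -> R) : 0 < t -> measurable_fun setT G ->
  (forall x, 0 <= G x) ->
  (\int[leb]_x ((0 < x)%R%:R * x `^ (- a - 1) * G (t * x))%:E =
   (t `^ a)%:E * \int[leb]_x ((0 < x)%R%:R * x `^ (- a - 1) * G x)%:E)%E.
Proof.
move=> t0 mG G0.
pose f (x : measurableTypeR R) : \bar R := ((0 < x)%R%:R * x `^ (- a - 1) * G x)%:E.
have mf : measurable_fun setT f by apply/measurable_EFinP; mfun.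
have f0 x : (0 <= f x)%E by rewrite lee_fin !mulr_ge0 ?powR_ge0.
have E := @ge0_integral_affine1 R t 0 f (lt0r_neq0 t0) mf f0.
rewrite -/(f _); rewrite E gtr0_norm// muleA -EFinM.
have mGt : measurable_fun setT (fun x : measurableTypeR R => G (t * x)).
  by apply: (measurableT_comp mG); mfun.
transitivity ((t `^ a * t)%:E * \int[leb]_x (t `^ (- a - 1) * ((0 < x)%R%:R * x `^ (- a - 1) * G (t * x)))%:E)%E; last first.
  congr (_ * _)%E; apply: eq_integral => x _; rewrite /f addr0 pmulr_rgt0//.
  have [x0|x0] := ltP 0 x; last by rewrite !mul0r mulr0.
  by rewrite !mul1r powRM ?(ltW t0) ?(ltW x0)// mulrA.
rewrite (@int_scale _ _ (measurableTypeR R)); last 3 first.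
- exact: powR_ge0.
- by mfun.
- by move=> x; rewrite !mulr_ge0 ?powR_ge0.
have tt : t `^ a * t * t `^ (- a - 1) = 1.
  rewrite -{2}(powRr1 (ltW t0)) -!powR_addp// (_ : _ + _ = 0) ?powRr0//; ring.
by rewrite muleA -EFinM tt mul1e.
Qed.

(** This is the integral of the positive part of [v.theta], to the power [a], over the unit sphere.
    The factor [N + a] undoes the radial integration, so that no surface measure is involved. *)
Definition halfspace_const (v : 'rV[R]_N) (a : R) : \bar R :=
  ((N%:R + a)%:E * \int[mu]_z ((eucl z < 1)%R%:R * ((0 < dotv v z)%R%:R * `|dotv v z| `^ a))%:E)%E.

Lemma halfspace_const_le (v : 'rV[R]_N) (a : R) : 0 < a -> eucl v <= 1 ->
  (0 <= halfspace_const v a <= ((N%:R + a) * 2 ^+ N)%:E)%E.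
Proof.
move=> a0 v1; have Na : 0 <= N%:R + a by rewrite addr_ge0// ltW.
apply/andP; split.
  by rewrite mule_ge0 ?lee_fin//; apply: integral_ge0 => z _; rewrite lee_fin !mulr_ge0 ?powR_ge0.
rewrite EFinM lee_wpmul2l ?lee_fin//.
have h : (\int[mu]_z ((eucl z < 1)%R%:R : R)%:E <= (2 ^+ N)%:E)%E.
  by have := integral_ball_le lmu (@ler01 R); rewrite mulr1.
apply: le_trans h; apply: int_le.
- by mfun.
- by mfun.
- by move=> z; rewrite !mulr_ge0 ?powR_ge0.
- move=> z; have [z1|_] := ltP (eucl z) 1; last by rewrite mul0r.
  rewrite mul1r; case: (0 < dotv v z); rewrite ?mul0r// mul1r.
  have -> : (true%:R : R) = 1 `^ a by rewrite powR1.
  rewrite ge0_ler_powR ?nnegrE ?(ltW a0)//.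
  apply: (le_trans (norm_dotv_le v z)); rewrite -[leRHS]mulr1.
  by rewrite ler_pM ?eucl_ge0// ltW.
Qed.

(** Polar coordinates without a sphere: the layer-cake formula and scaling reduce to [z] in the unit
    ball, and the substitution [x -> |v.z| x] then extracts [|v.z|^a] from the half-line
    integral. *)
Lemma halfspace_integral (v : 'rV[R]_N) (a : R) (G : R -> R) : 0 < a ->
  measurable_fun setT G -> (forall x, 0 <= G x) -> G 0 = 0 ->
  (\int[mu]_z (G (dotv v z) * eucl z `^ (- (N%:R + a)))%:E =
   halfspace_const v a *
     (\int[leb]_x ((0 < x)%R%:R * x `^ (- a - 1) * G x)%:E +
      \int[leb]_x ((0 < x)%R%:R * x `^ (- a - 1) * G (- x))%:E))%E.
Proof.
move=> a0 mG G0 G00; have Na : 0 < N%:R + a by rewrite ltr_wpDl.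
have mGv : measurable_fun setT (fun z : Rn R N => G (dotv v z)).
  by apply: (measurableT_comp mG); mfun.
rewrite (@layer_integral _ _ mu _ (fun z => G (dotv v z)) Na)//; last first.
  by rewrite -(scale0r (0 : 'rV_N)) dotvZr mul0r.
pose H (w : Rn R N * measurableTypeR R) : R :=
  (0 < w.2)%R%:R * w.2 `^ (- a - 1) * ((eucl w.1 < 1)%R%:R * G (w.2 * dotv v w.1)).
have mGw : measurable_fun setT (fun w : Rn R N * measurableTypeR R => G (w.2 * dotv v w.1)).
  by apply: (measurableT_comp mG); mfun.
have mH : measurable_fun setT (EFin \o H).
  by apply/measurable_EFinP; rewrite /H; mfun.
have H0 w : 0 <= H w by rewrite !mulr_ge0 ?powR_ge0.
have H0' w : (0 <= (EFin \o H) w)%E by rewrite lee_fin.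
have step1 (x : measurableTypeR R) : (((0 < x)%R%:R * x `^ (- (N%:R + a) - 1))%:E *
    \int[mu]_z ((eucl z < x)%R%:R * G (dotv v z))%:E = \int[mu]_z (H (z, x))%:E)%E.
  rewrite /H/=; have [x0|x0] := ltP 0 x; last first.
    by rewrite mul0r mul0e; under eq_integral do rewrite !mul0r; rewrite integral0.
  have mGx : measurable_fun setT (fun z : Rn R N => G (x * dotv v z)).
    by apply: (measurableT_comp mG); mfun.
  rewrite int_scale ?mul1r ?powR_ge0//; [|by mfun|by move=> z; rewrite mulr_ge0].
  rewrite (ge0_integral_affine N0 lmu 0 (lt0r_neq0 x0)); last 2 first.
  - by apply/measurable_EFinP; mfun.
  - by move=> z; rewrite lee_fin mulr_ge0.
  rewrite muleA -EFinM; congr (_ * _)%E.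
    rewrite gtr0_norm// -powR_mulrn ?(ltW x0)// -powR_addp//; congr (_ `^ _)%:E; ring.
  apply: eq_integral => z _; rewrite /affine addr0 dotvZr euclZ gtr0_norm//.
  by rewrite -[X in _ < X]mulr1 ltr_pM2l.
under eq_integral do rewrite step1.
rewrite -(@fubini_tonelli _ _ _ _ _ mu leb (EFin \o H) mH H0').
set Ip := (\int[leb]_x ((0 < x)%R%:R * x `^ (- a - 1) * G x)%:E)%E.
set In := (\int[leb]_x ((0 < x)%R%:R * x `^ (- a - 1) * G (- x))%:E)%E.
have Ip0 : (0 <= Ip)%E by apply: integral_ge0 => x _; rewrite lee_fin !mulr_ge0 ?powR_ge0.
have In0 : (0 <= In)%E by apply: integral_ge0 => x _; rewrite lee_fin !mulr_ge0 ?powR_ge0.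
pose P (z : Rn R N) : R := (eucl z < 1)%R%:R * ((0 < dotv v z)%R%:R * `|dotv v z| `^ a).
pose M (z : Rn R N) : R := (eucl z < 1)%R%:R * ((0 < - dotv v z)%R%:R * `|dotv v z| `^ a).
have mP : measurable_fun setT P by rewrite /P; mfun.
have mM : measurable_fun setT M by rewrite /M; mfun.
have P0 z : 0 <= P z by rewrite !mulr_ge0 ?powR_ge0.
have M0 z : 0 <= M z by rewrite !mulr_ge0 ?powR_ge0.
(* For fixed [z] only the half-line on the side given by the sign of [dotv v z] contributes. *)
have step2 (z : Rn R N) : (\int[leb]_x (EFin \o H) (z, x) = (P z)%:E * Ip + (M z)%:E * In)%E.
  rewrite /P /M /= /H/=; have [z1|_] := ltP (eucl z) 1; last first.
    rewrite !mul0r !mul0e adde0; under eq_integral do rewrite mul0r mulr0.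
    by rewrite integral0.
  under eq_integral do rewrite mul1r.
  rewrite !mul1r oppr_gt0; have [t0|t0|t0] := ltrgtP (dotv v z) 0.
  - rewrite mul0r mul0e add0e mul1r ltr0_norm//.
    have mGn : measurable_fun setT (fun x : R => G (- x)).
      by apply: (measurableT_comp mG); mfun.
    have nt0 : 0 < - dotv v z by rewrite oppr_gt0.
    rewrite -(@scale_halfline a (- dotv v z) (fun x => G (- x)) nt0 mGn)//.
    by apply: eq_integral => x _; rewrite mulNr opprK (mulrC (dotv v z)).
  - rewrite mul0r mul0e adde0 mul1r gtr0_norm//.
    rewrite -(@scale_halfline a (dotv v z) G t0 mG)//.
    by apply: eq_integral => x _; rewrite (mulrC x).
  - rewrite t0 !mul0r !mul0e adde0 integral0_eq// => x _.
    by rewrite mulr0 G00 mulr0.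
under eq_integral do rewrite step2.
rewrite ge0_integralD//; last 4 first.
- by move=> z _; rewrite mule_ge0// lee_fin.
- by apply: emeasurable_funM => //; exact/measurable_EFinP.
- by move=> z _; rewrite mule_ge0// lee_fin.
- by apply: emeasurable_funM => //; exact/measurable_EFinP.
rewrite !ge0_integralZr//; last 4 first.
- exact/measurable_EFinP.
- by move=> z _; rewrite lee_fin.
- exact/measurable_EFinP.
- by move=> z _; rewrite lee_fin.
(* The reflection [z -> -z] exchanges the two half-balls, hence one constant serves both sides. *)
have PM : (\int[mu]_z (M z)%:E = \int[mu]_z (P z)%:E)%E.
  have n10 : - 1 != 0 :> R by rewrite oppr_eq0 oner_eq0.
  rewrite (ge0_integral_affine N0 lmu 0 n10); last 2 first.
  - exact/measurable_EFinP.
  - by move=> z; rewrite lee_fin.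
  rewrite normrN1 expr1n mul1e; apply: eq_integral => z _.
  by rewrite /P /M /affine addr0 scaleN1r euclN dotvNr opprK normrN.
by rewrite PM /halfspace_const -/(P _) -ge0_muleDr// muleA.
Qed.

End HalfSpace.

(** * Power inequalities and the regularized nonlinearity *)

Section Powers.
Set Implicit Arguments. Unset Strict Implicit.
Context {R : realType}.
Implicit Types (x y w r k s t q a b : R).

Lemma le0_powR x w r : 0 < x -> x <= w -> r <= 0 -> w `^ r <= x `^ r.
Proof.
move=> x0 xw r0; have w0 : 0 < w := lt_le_trans x0 xw.
rewrite -(opprK r) !(powRN _ (- r)) lef_pV2 ?posrE ?powR_gt0//.
by rewrite ge0_ler_powR ?nnegrE ?oppr_ge0 ?(ltW x0) ?(ltW w0).
Qed.

Lemma powR_split x s : 0 < x -> x `^ s = x * x `^ (s - 1).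
Proof. by move=> x0; rewrite -{2}(powRr1 (ltW x0)) -powR_addp// addrC subrK. Qed.

(** The graph of the concave power [r^t] lies below its tangent at 1. Rescaled, this yields the
    bounds [powR_sub_ge] and [powR_sub_le1] on differences of powers. *)
Lemma powR_young r t : 0 <= r -> 0 <= t <= 1 -> r `^ t <= t * r + (1 - t).
Proof.
move=> r0 /andP[]; rewrite le_eqVlt => /predU1P[<-|t0].
  by rewrite powRr0 mul0r add0r subr0.
rewrite le_eqVlt => /predU1P[->|t1]; first by rewrite powRr1// mul1r subrr addr0.
have t1' : 0 < 1 - t by rewrite subr_gt0.
have := @conjugate_powR R (r `^ t) 1 t^-1 (1 - t)^-1.
rewrite powR_ge0 ler01 !invr_gt0 t0 t1' !invrK addrC subrK.
rewrite -powRrM mulfV ?gt_eqF// powRr1// powR1 mulr1 mul1r (mulrC r).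
by apply.
Qed.

Lemma powR_mul_le x w s : 0 <= x -> x <= w -> 0 < w -> s <= 1 -> 0 < s -> x * w `^ (s - 1) <= x `^ s.
Proof.
move=> x0 xw w0 s1 s0; have [->|xn0] := eqVneq x 0; first by rewrite mul0r powR_ge0.
have {}x0 : 0 < x by rewrite lt_def xn0.
by rewrite (powR_split s x0) ler_pM2l// le0_powR// subr_le0.
Qed.

Lemma powR_subadd x y s : 0 <= x -> 0 <= y -> 0 < s -> s <= 1 -> (x + y) `^ s <= x `^ s + y `^ s.
Proof.
move=> x0 y0 s0 s1; have [xy|xy] := ltP 0 (x + y); last first.
  have -> : x + y = 0 by apply/eqP; rewrite eq_le xy addr_ge0.
  by rewrite powR0 ?gt_eqF// addr_ge0 ?powR_ge0.
by rewrite (powR_split s xy) mulrDl lerD// powR_mul_le// ?lerDl ?lerDr.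
Qed.

Lemma powR_sub_le x y s : 0 <= y -> y <= x -> 0 < x -> 0 < s -> s <= 1 ->
  x `^ s - y `^ s <= x `^ (s - 1) * (x - y).
Proof.
move=> y0 yx x0 s0 s1; rewrite mulrBr (powR_split s x0) mulrC lerB// mulrC.
exact: powR_mul_le.
Qed.

Lemma powR_sub_ge x y s : 0 <= y -> y <= x -> 0 < x -> 0 < s -> s <= 1 ->
  s * x `^ (s - 1) * (x - y) <= x `^ s - y `^ s.
Proof.
move=> y0 yx x0 s0 s1.
have yx0 : 0 <= y / x by rewrite divr_ge0// ltW.
have := @powR_young (y / x) s yx0; rewrite (ltW s0) s1 => /(_ isT).
rewrite -(ler_pM2l (powR_gt0 s x0)) -powRM ?(ltW x0)// mulrCA mulfV ?gt_eqF// mulr1 => h.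
have E : x `^ s * (s * (y / x) + (1 - s)) = x `^ s - s * x `^ (s - 1) * (x - y).
  by rewrite (powR_split s x0); field; rewrite gt_eqF.
by rewrite E in h; lra.
Qed.

Lemma powR_dist_le x y s : 0 <= x -> 0 <= y -> 0 < s -> s <= 1 ->
  `|x `^ s - y `^ s| <= `|x - y| `^ s.
Proof.
move=> x0 y0 s0 s1; wlog yx : x y x0 y0 / y <= x.
  move=> h; have [yx|/ltW xy] := leP y x; first exact: h.
  by rewrite distrC (distrC x) h.
rewrite ger0_norm ?subr_ge0 ?ge0_ler_powR ?nnegrE ?(ltW s0)// (@ger0_norm _ (x - y)) ?subr_ge0//.
rewrite lerBlDr; apply: le_trans (powR_subadd _ _ s0 s1); rewrite ?subr_ge0//.
by rewrite subrK.
Qed.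

(** The factor involves [x] alone, whichever of the two numbers is larger, and [y] may be 0. In the
    estimates on [u] this allows [y] to be the distance of a point outside the domain. *)
Lemma powR_dist_lip x y s : 0 < x -> 0 <= y -> 0 < s -> s <= 1 ->
  `|x `^ s - y `^ s| <= x `^ (s - 1) * `|x - y|.
Proof.
move=> x0 y0 s0 s1; have [yx|xy] := leP y x.
  rewrite ger0_norm ?subr_ge0 ?ge0_ler_powR ?nnegrE ?(ltW s0) ?(ltW x0)//.
  by rewrite ger0_norm ?subr_ge0// powR_sub_le.
have y0' := lt_trans x0 xy.
rewrite distrC ger0_norm ?subr_ge0 ?ge0_ler_powR ?nnegrE ?(ltW s0) ?(ltW x0) ?(ltW xy)//.
rewrite distrC (@ger0_norm _ (y - x)) ?subr_ge0 ?(ltW xy)//.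
apply: (le_trans (powR_sub_le (ltW x0) (ltW xy) y0' s0 s1)).
by rewrite ler_wpM2r ?subr_ge0 ?(ltW xy)// le0_powR ?(ltW xy)// subr_le0.
Qed.

Lemma powR_sub_le1 x y q : 0 <= y -> y <= x -> 0 < x -> 1 <= q ->
  x `^ q - y `^ q <= q * x `^ (q - 1) * (x - y).
Proof.
move=> y0 yx x0 q1; have q0 : 0 < q by lra.
have yx0 : 0 <= y / x by rewrite divr_ge0// ltW.
have qV : 0 <= q^-1 <= 1 by rewrite invr_ge0 (ltW q0) invf_le1.
have := @powR_young ((y / x) `^ q) q^-1 (powR_ge0 _ _) qV.
rewrite -powRrM (mulfV (lt0r_neq0 q0)) powRr1 ?powR_ge0// ?divr_ge0 ?(ltW x0)//.
move=> h0; have h : q * (y / x) <= q * (q^-1 * (y / x) `^ q + (1 - q^-1)) by rewrite ler_pM2l.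
have E3 : q * (q^-1 * (y / x) `^ q + (1 - q^-1)) = (y / x) `^ q + (q - 1).
  by field; rewrite gt_eqF.
rewrite E3 in h.
have xq0 := powR_gt0 q x0.
have E : y `^ q = x `^ q * (y / x) `^ q.
  by rewrite -powRM ?(ltW x0)// mulrCA mulfV ?gt_eqF// mulr1.
have E2 : q * x `^ (q - 1) * (x - y) = x `^ q * (q - q * (y / x)).
  by rewrite (powR_split q x0); field; rewrite gt_eqF.
rewrite E E2 -{1}(mulr1 (x `^ q)) -mulrBr ler_pM2l//.
lra.
Qed.

End Powers.

Section Spow.
Set Implicit Arguments. Unset Strict Implicit.
Context {R : realType}.
Implicit Types (a b q M : R).

Lemma spow_ge0 a q : 0 <= a -> 0 < q -> spow a q = a `^ q.
Proof.
move=> a0 q0; rewrite /spow ger0_norm//; have [->|an0] := eqVneq a 0.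
  by rewrite sgr0 mul0r powR0// gt_eqF.
by rewrite gtr0_sg ?mul1r// lt_def an0.
Qed.

Lemma spowN a q : spow (- a) q = - spow a q.
Proof. by rewrite /spow sgrN normrN mulNr. Qed.

Lemma spow_le0 a q : a <= 0 -> 0 < q -> spow a q = - (- a) `^ q.
Proof. by move=> a0 q0; rewrite -spow_ge0 ?oppr_ge0// spowN opprK. Qed.

Lemma norm_spow a q : 0 < q -> `|spow a q| = `|a| `^ q.
Proof.
move=> q0; have [a0|/ltW a0] := leP 0 a.
  by rewrite spow_ge0// !ger0_norm ?powR_ge0.
by rewrite spow_le0// normrN (ler0_norm a0) ger0_norm ?powR_ge0.
Qed.

Lemma norm_subNN a b : `|- a - - b| = `|a - b|.
Proof. by rewrite opprK addrC distrC. Qed.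

Lemma spow_dist_hoelder a b q : 0 < q -> q <= 1 ->
  `|spow a q - spow b q| <= 2 * `|a - b| `^ q.
Proof.
move=> q0 q1; wlog a0 : a b / 0 <= a.
  move=> h; have [|/ltW a0] := leP 0 a; first exact: h.
  have := h (- a) (- b); rewrite oppr_ge0 => /(_ a0).
  by rewrite !spowN !norm_subNN.
rewrite (spow_ge0 a0 q0); have [b0|/ltW b0] := leP 0 b.
  rewrite spow_ge0//; apply: (le_trans (powR_dist_le a0 b0 q0 q1)).
  by rewrite ler_peMl ?powR_ge0// ler1n.
rewrite spow_le0// opprK ger0_norm ?addr_ge0 ?powR_ge0//.
have nb0 : 0 <= - b by rewrite oppr_ge0.
rewrite (@ger0_norm _ (a - b)) ?addr_ge0// mulr_natl mulr2n lerD//;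
  by rewrite ge0_ler_powR ?nnegrE ?(ltW q0) ?addr_ge0// ?lerDl ?lerDr.
Qed.

(** For [q <= 1] the slope is unbounded near 0, so the weight is placed at one argument only. In use
    [b] is the difference with the explicit half-space profile, which can be bounded below, and [a]
    is arbitrary. *)
Lemma spow_dist_sublinear a b q : 0 < q -> q <= 1 -> b != 0 ->
  `|spow a q - spow b q| <= 2 * `|b| `^ (q - 1) * `|a - b|.
Proof.
move=> q0 q1 bn0; wlog b0 : a b bn0 / 0 <= b.
  move=> h; have [|/ltW b0] := leP 0 b; first exact: h.
  have := h (- a) (- b); rewrite oppr_eq0 bn0 oppr_ge0 => /(_ isT b0).
  by rewrite normrN !spowN !norm_subNN.
have {bn0}bp : 0 < b by rewrite lt_def bn0.
rewrite (spow_ge0 b0 q0) (ger0_norm b0); have [a0|/ltW a0] := leP 0 a.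
  rewrite spow_ge0// distrC (distrC a); apply: (le_trans (powR_dist_lip bp a0 q0 q1)).
  by rewrite ler_wpM2r// ler_peMl ?powR_ge0// ler1n.
rewrite spow_le0//; have na0 : 0 <= - a by rewrite oppr_ge0.
have ab : 0 < b - a by rewrite ltr_wpDr.
rewrite -opprD normrN ger0_norm ?addr_ge0 ?powR_ge0// distrC (gtr0_norm ab).
have bb : (b - a) * (b - a) `^ (q - 1) <= (b - a) * b `^ (q - 1).
  by rewrite ler_pM2l// le0_powR ?subr_le0// lerDl.
rewrite -(powR_split q ab) in bb.
have h1 : (- a) `^ q <= (b - a) `^ q.
  by rewrite ge0_ler_powR ?nnegrE ?(ltW q0) ?(ltW ab)// lerDr.
have h2 : b `^ q <= (b - a) `^ q.
  by rewrite ge0_ler_powR ?nnegrE ?(ltW q0) ?(ltW ab)// lerDl.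
by rewrite -mulrA mulr_natl mulr2n (mulrC (b `^ _)); lra.
Qed.

Lemma spow_dist_lip a b q M : 1 <= q -> `|a| <= M -> `|b| <= M ->
  `|spow a q - spow b q| <= q * M `^ (q - 1) * `|a - b|.
Proof.
move=> q1 aM bM; have q0 : 0 < q by lra.
wlog a0 : a b aM bM / 0 <= a.
  move=> h; have [|/ltW a0] := leP 0 a; first exact: h.
  have := h (- a) (- b); rewrite !normrN oppr_ge0 => /(_ aM bM a0).
  by rewrite !spowN !norm_subNN.
have M0 : 0 <= M := le_trans (normr_ge0 _) aM.
have mono x : 0 <= x -> x <= M -> x `^ (q - 1) <= M `^ (q - 1).
  by move=> x0 xM; rewrite ge0_ler_powR ?nnegrE ?subr_ge0.
have key x y : 0 <= y -> y <= x -> x <= M ->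
    x `^ q - y `^ q <= q * M `^ (q - 1) * (x - y).
  move=> y0 yx xM; have [x0|x0] := ltP 0 x; last first.
    have -> : y = 0 by lra.
    have -> : x = 0 by lra.
    by rewrite !subrr mulr0.
  apply: (le_trans (powR_sub_le1 y0 yx x0 q1)).
  by rewrite ler_wpM2r ?subr_ge0// ler_wpM2l ?(ltW q0)// mono// ltW.
rewrite (spow_ge0 a0 q0); have [b0|/ltW b0] := leP 0 b.
  rewrite spow_ge0//; rewrite ger0_norm// in aM; rewrite ger0_norm// in bM.
  have [ba|/ltW ab] := leP b a.
    rewrite !ger0_norm ?subr_ge0 ?ge0_ler_powR ?nnegrE ?(ltW q0)//; exact: key.
  rewrite distrC (distrC a) !ger0_norm ?subr_ge0 ?ge0_ler_powR ?nnegrE ?(ltW q0)//; exact: key.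
rewrite spow_le0// opprK ger0_norm ?addr_ge0 ?powR_ge0//.
have nb0 : 0 <= - b by rewrite oppr_ge0.
rewrite (@ger0_norm _ (a - b)) ?addr_ge0//.
rewrite ger0_norm// in aM; rewrite ler0_norm// in bM.
have key' x : 0 <= x -> x <= M -> x `^ q <= q * M `^ (q - 1) * x.
  move=> x0 xM; have := key x 0 (lexx _) x0 xM; rewrite powR0 ?gt_eqF//.
  by rewrite !subr0.
rewrite mulrDr; apply: lerD; exact: key'.
Qed.

End Spow.

Section Regularization.
Set Implicit Arguments. Unset Strict Implicit.
Context {R : realType}.
Implicit Types (A B h q : R).

(* Homogeneous of degree [0], so that [jreg] keeps the homogeneity of [spow (A - B) q]; it is [0] at [A = B], where the quotient may be [0 / 0]. *)
Definition wreg h A B : R := `|A - B| / (`|A - B| + h * (A + B)).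
Definition jreg q h A B : R := spow (A - B) q * wreg h A B.

Lemma wreg_ge0 h A B : 0 <= A -> 0 <= B -> 0 < h -> 0 <= wreg h A B.
Proof. by move=> A0 B0 h0; rewrite divr_ge0// addr_ge0// mulr_ge0 ?addr_ge0 ?(ltW h0). Qed.

Lemma wreg_le1 h A B : 0 <= A -> 0 <= B -> 0 < h -> wreg h A B <= 1.
Proof.
move=> A0 B0 h0; have hAB : 0 <= h * (A + B) by rewrite mulr_ge0 ?addr_ge0 ?(ltW h0).
have [D0|D0] := ltP 0 (`|A - B| + h * (A + B)).
  by rewrite /wreg ler_pdivrMr// mul1r lerDl.
have -> : wreg h A B = 0 by rewrite /wreg (_ : `|A - B| = 0) ?mul0r//; have := normr_ge0 (A - B); lra.
exact: ler01.
Qed.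

Lemma wregC h A B : wreg h A B = wreg h B A.
Proof. by rewrite /wreg distrC (addrC A). Qed.

Lemma jregC q h A B : jreg q h A B = - jreg q h B A.
Proof. by rewrite /jreg wregC -mulNr -spowN opprB. Qed.

(** The weight is homogeneous of degree 0, so a change of [B] costs at most a relative distance,
    uniformly in [h]. *)
Lemma wreg_dist h A B B' : 0 <= A -> 0 <= B -> 0 <= B' -> 0 < h -> A != B' ->
  `|wreg h A B - wreg h A B'| <= 2 * `|B - B'| / `|A - B'|.
Proof.
move=> A0 B0 B'0 h0 AB'.
have x'0 : 0 < `|A - B'| by rewrite normr_gt0 subr_eq0.
(* A vanishing denominator forces [A = B = 0]; the quotient is then 0 by convention, and that both
   weights lie in [0,1] suffices. *)
have [D0|D0] := ltP 0 (`|A - B| + h * (A + B)); last first.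
  have hAB : 0 <= h * (A + B) by rewrite mulr_ge0 ?addr_ge0 ?(ltW h0).
  have AB0 : h * (A + B) = 0 by have := normr_ge0 (A - B); lra.
  move/eqP: AB0; rewrite mulf_eq0 gt_eqF//= => /eqP AB0.
  have -> : B = 0 by lra.
  have A00 : A = 0 by lra.
  have x'n : `|0 - B'| != 0 by move: x'0; rewrite A00 => x'0; rewrite gt_eqF.
  rewrite A00 -mulrA mulfV// mulr1; apply: (@le_trans _ _ 1); last by rewrite ler1n.
  rewrite ler_norml; have := wreg_le1 (lexx 0) B'0 h0; have := wreg_ge0 (lexx 0) B'0 h0.
  have := wreg_le1 (lexx 0) (lexx 0) h0; have := wreg_ge0 (lexx 0) (lexx 0) h0 => *.
  by apply/andP; split; lra.
set x := `|A - B| in D0 *; set x' := `|A - B'| in x'0 *.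
set b := `|B - B'|; set S := A + B; set S' := A + B'.
have S0 : 0 <= S by rewrite addr_ge0.
have S'0 : 0 <= S' by rewrite addr_ge0.
have D'0 : 0 < x' + h * S' by rewrite ltr_wpDr// mulr_ge0// ltW.
have b0 : 0 <= b by exact: normr_ge0.
have xS : x <= S by rewrite /x /S ler_norml; apply/andP; split; lra.
have xx' : `|x - x'| <= b.
  apply: (le_trans (ler_dist_dist _ _)).
  by rewrite (_ : A - B - (A - B') = - (B - B')) ?normrN//; ring.
have SS' : `|S' - S| = b by rewrite /S /S' opprD addrACA subrr add0r distrC.
have x0 : 0 <= x by exact: normr_ge0.
have num : `|x * S' - x' * S| <= 2 * S * b.
  have -> : x * S' - x' * S = x * (S' - S) + S * (x - x') by ring.
  apply: (le_trans (ler_normD _ _)); rewrite !normrM SS' (ger0_norm x0) (ger0_norm S0).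
  have h1 : x * b <= S * b by rewrite ler_wpM2r.
  have h2 : S * `|x - x'| <= S * b by rewrite ler_wpM2l.
  lra.
(* Over a common denominator the products [x x'] cancel and a factor [h] appears; it is compensated
   by the [h * S] in the denominator, which removes [h] from the bound. *)
have -> : wreg h A B - wreg h A B' = h * (x * S' - x' * S) / ((x + h * S) * (x' + h * S')).
  by rewrite /wreg -/x -/x' -/S -/S'; field; rewrite !gt_eqF.
have DD : 0 < (x + h * S) * (x' + h * S') by rewrite mulr_gt0.
rewrite normrM normfV (gtr0_norm DD) ler_pdivrMr//.
rewrite normrM (gtr0_norm h0).
apply: (@le_trans _ _ (h * (2 * S * b))); first by rewrite ler_pM2l.
have E : 2 * b / x' * ((x + h * S) * (x' + h * S')) = 2 * b * (x + h * S) * (1 + h * S' / x').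
  by field; rewrite gt_eqF.
rewrite E; apply: (@le_trans _ _ (2 * b * (x + h * S) * 1)).
  rewrite mulr1; have : 0 <= b * x by rewrite mulr_ge0.
  lra.
by rewrite ler_wpM2l ?mulr_ge0 ?(ltW D0)// lerDl divr_ge0 ?mulr_ge0 ?(ltW h0) ?(ltW x'0).
Qed.

Lemma jreg_le q h A B : 0 <= A -> 0 <= B -> 0 < h -> 0 < q -> `|jreg q h A B| <= `|A - B| `^ q.
Proof.
move=> A0 B0 h0 q0; rewrite /jreg normrM norm_spow// (ger0_norm (wreg_ge0 A0 B0 h0)).
by rewrite ler_piMr ?powR_ge0// wreg_le1.
Qed.

(** The gain of one power of [|A - B|] makes the kernel integral converge absolutely at the
    diagonal, at the price of [1 / h]. *)
Lemma jreg_le_reg q h A B : 0 < A -> 0 <= B -> 0 < h -> 0 < q ->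
  `|jreg q h A B| <= `|A - B| `^ (q + 1) / (h * A).
Proof.
move=> A0 B0 h0 q0; rewrite /jreg normrM norm_spow// (ger0_norm (wreg_ge0 (ltW A0) B0 h0)).
have hA : 0 < h * A by rewrite mulr_gt0.
have [->|AB] := eqVneq (A - B) 0.
  by rewrite normr0 powR0 ?gt_eqF// mul0r mulr_ge0 ?powR_ge0// invr_ge0 ltW.
have AB0 : 0 < `|A - B| by rewrite normr_gt0.
rewrite powR_addp// powRr1 ?(ltW AB0)// -mulrA ler_wpM2l ?powR_ge0// /wreg.
rewrite ler_wpM2l ?(ltW AB0)// lef_pV2 ?posrE//; last first.
  by rewrite ltr_wpDr// mulr_ge0 ?addr_ge0 ?(ltW h0) ?(ltW A0).
by rewrite ler_wpDl// ler_wpM2l ?(ltW h0)// lerDl.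
Qed.

(** The variation of the weight is singular like [1 / |A - B'|], but it is multiplied by a power
    [q >= 1] of the same quantity. This serves for [p >= 2], where [q = p - 1]. *)
Lemma jreg_dist_lip q h A B B' M : 0 <= A -> 0 <= B -> 0 <= B' -> 0 < h -> 1 <= q ->
  `|A - B| <= M -> `|A - B'| <= M ->
  `|jreg q h A B - jreg q h A B'| <= (q + 2) * M `^ (q - 1) * `|B - B'|.
Proof.
move=> A0 B0 B'0 h0 q1 aM a'M; have q0 : 0 < q by lra.
have -> : jreg q h A B - jreg q h A B' =
   (spow (A - B) q - spow (A - B') q) * wreg h A B + spow (A - B') q * (wreg h A B - wreg h A B').
  by rewrite /jreg; ring.
apply: (le_trans (ler_normD _ _)).
have -> : (q + 2) * M `^ (q - 1) * `|B - B'| = q * M `^ (q - 1) * `|B - B'| + 2 * M `^ (q - 1) * `|B - B'| by ring.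
apply: lerD.
  rewrite normrM (ger0_norm (wreg_ge0 A0 B0 h0)).
  apply: (@le_trans _ _ (`|spow (A - B) q - spow (A - B') q|)); first by rewrite ler_piMr// wreg_le1.
  apply: (le_trans (spow_dist_lip q1 aM a'M)).
  by rewrite (_ : A - B - (A - B') = - (B - B')) ?normrN//; ring.
have [AB'|AB'] := eqVneq A B'.
  by rewrite AB' subrr /spow sgr0 !mul0r normr0 !mulr_ge0 ?powR_ge0.
have x'0 : 0 < `|A - B'| by rewrite normr_gt0 subr_eq0.
rewrite normrM norm_spow//; apply: (le_trans (ler_wpM2l (powR_ge0 _ _) (wreg_dist A0 B0 B'0 h0 AB'))).
rewrite (powR_split q x'0).
rewrite (_ : _ * (2 * `|B - B'| / `|A - B'|) = 2 * `|A - B'| `^ (q - 1) * `|B - B'|); last first.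
  by field; rewrite gt_eqF.
rewrite ler_wpM2r// ler_wpM2l// ge0_ler_powR ?nnegrE ?subr_ge0//.
exact: le_trans a'M.
Qed.

Lemma jreg_dist_sublinear q h A B B' : 0 <= A -> 0 <= B -> 0 <= B' -> 0 < h -> 0 < q -> q <= 1 ->
  A != B' -> `|jreg q h A B - jreg q h A B'| <= 4 * `|A - B'| `^ (q - 1) * `|B - B'|.
Proof.
move=> A0 B0 B'0 h0 q0 q1 AB'.
have -> : jreg q h A B - jreg q h A B' =
   (spow (A - B) q - spow (A - B') q) * wreg h A B + spow (A - B') q * (wreg h A B - wreg h A B').
  by rewrite /jreg; ring.
have x'0 : 0 < `|A - B'| by rewrite normr_gt0 subr_eq0.
apply: (le_trans (ler_normD _ _)).
have four (x : R) : 2 * x + 2 * x = 4 * x by ring.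
rewrite -mulrA -four; apply: lerD; rewrite mulrA.
  rewrite normrM (ger0_norm (wreg_ge0 A0 B0 h0)).
  apply: (@le_trans _ _ (`|spow (A - B) q - spow (A - B') q|)); first by rewrite ler_piMr// wreg_le1.
  have := @spow_dist_sublinear _ (A - B) (A - B') q q0 q1; rewrite subr_eq0 => /(_ AB').
  by rewrite (_ : A - B - (A - B') = - (B - B')) ?normrN//; ring.
rewrite normrM norm_spow//; apply: (le_trans (ler_wpM2l (powR_ge0 _ _) (wreg_dist A0 B0 B'0 h0 AB'))).
rewrite (powR_split q x'0) le_eqVlt; apply/orP; left; apply/eqP; field.
by rewrite gt_eqF.
Qed.

(** Unlike [jreg_dist_sublinear] this contains no negative power of [|A - B'|]; for [p < 2] it is
    used where the half-space profile vanishes. *)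
Lemma jreg_dist_hoelder q h A B B' : 0 <= A -> 0 <= B -> 0 <= B' -> 0 < h -> 0 < q -> q <= 1 ->
  `|jreg q h A B - jreg q h A B'| <= 4 * `|B - B'| `^ q.
Proof.
move=> A0 B0 B'0 h0 q0 q1.
have -> : jreg q h A B - jreg q h A B' =
   (spow (A - B) q - spow (A - B') q) * wreg h A B + spow (A - B') q * (wreg h A B - wreg h A B').
  by rewrite /jreg; ring.
apply: (le_trans (ler_normD _ _)).
have four (x : R) : 2 * x + 2 * x = 4 * x by ring.
rewrite -four; apply: lerD.
  rewrite normrM (ger0_norm (wreg_ge0 A0 B0 h0)).
  apply: (@le_trans _ _ (`|spow (A - B) q - spow (A - B') q|)); first by rewrite ler_piMr// wreg_le1.
  apply: (le_trans (spow_dist_hoelder _ _ q0 q1)).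
  by rewrite (_ : A - B - (A - B') = - (B - B')) ?normrN//; ring.
have [AB'|AB'] := eqVneq A B'.
  by rewrite AB' subrr /spow sgr0 !mul0r normr0 !mulr_ge0 ?powR_ge0.
have x'0 : 0 < `|A - B'| by rewrite normr_gt0 subr_eq0.
rewrite normrM norm_spow//.
(* If [|A - B'|] is the smaller distance, the trivial bound on the weights suffices; otherwise its
   negative power in [wreg_dist] can be exchanged for one of [|B - B'|]. *)
have [le|gt] := leP `|A - B'| `|B - B'|.
  have w1 : `|wreg h A B - wreg h A B'| <= 2.
    rewrite ler_norml; have := wreg_le1 A0 B'0 h0; have := wreg_ge0 A0 B'0 h0.
    have := wreg_le1 A0 B0 h0; have := wreg_ge0 A0 B0 h0 => *.
    by apply/andP; split; lra.
  by rewrite mulrC ler_pM ?powR_ge0// ge0_ler_powR ?nnegrE// ltW.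
apply: (le_trans (ler_wpM2l (powR_ge0 _ _) (wreg_dist A0 B0 B'0 h0 AB'))).
have := powR_mul_le (normr_ge0 (B - B')) (ltW gt) x'0 q1 q0 => k.
rewrite (powR_split q x'0).
rewrite (_ : _ * _ * (2 * _ / _) = 2 * (`|B - B'| * `|A - B'| `^ (q - 1))); last first.
  by field; rewrite gt_eqF.
by rewrite ler_pM2l.
Qed.

Lemma jreg_homog q h A B l : 0 < l -> 0 < q -> jreg q h (l * A) (l * B) = l `^ q * jreg q h A B.
Proof.
move=> l0 q0; rewrite /jreg /wreg -mulrBr /spow sgrM gtr0_sg// mul1r !normrM (gtr0_norm l0).
rewrite powRM ?(ltW l0)// -mulrDr (mulrCA h) -mulrDr invfM mulrA -(mulrA l) mulrA.
have -> : l * `|A - B| * (l^-1 / (`|A - B| + h * (A + B))) = `|A - B| / (`|A - B| + h * (A + B)).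
  by rewrite mulrACA mulfV ?gt_eqF// mul1r.
by rewrite (mulrCA _ (l `^ q)) -mulrA.
Qed.

Lemma cvg_wreg A B : A != B -> wreg (k.+1%:R^-1) A B @[k --> \oo] --> (1 : R).
Proof.
move=> AB; have x0 : `|A - B| != 0 by rewrite normr_eq0 subr_eq0.
rewrite /wreg -[X in _ --> X](mulfV x0); apply: cvgM; first exact: cvg_cst.
apply: cvgV => //; rewrite -[X in _ --> X]addr0; apply: cvgD; first exact: cvg_cst.
rewrite -(mul0r (A + B)); apply: cvgM; last exact: cvg_cst.
exact: cvg_harmonic.
Qed.

Lemma cvg_jreg q A B : jreg q (k.+1%:R^-1) A B @[k --> \oo] --> spow (A - B) q.
Proof.
have [->|AB] := eqVneq A B.
  by rewrite /jreg subrr /spow sgr0 !mul0r; under eq_fun do rewrite mul0r; exact: cvg_cst.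
rewrite -[X in _ --> X]mulr1; apply: cvgM; first exact: cvg_cst.
exact: cvg_wreg.
Qed.

End Regularization.

(** * Pointwise comparison with the half-space profile *)

Section PointwiseError.
Set Implicit Arguments. Unset Strict Implicit.
Context {R : realType}.
Implicit Types (s p c d t r del h nu : R).

(** For [t > 0] this is the Lipschitz bound at [t]. For [t < 0] the left side is nonzero only if
    [|t| < c r^2], and then [(c r^2)^s] is again at most [c r^2 |t|^(s-1)]. *)
Lemma profile_dist s c t r del : 0 < s -> s < 1 -> 0 <= c -> 0 < r -> 0 <= del -> t != 0 ->
  del <= Num.max 0 (t + c * r ^+ 2) -> t - c * r ^+ 2 <= del ->
  `|del `^ s - Num.max 0 t `^ s| <= c * r ^+ 2 * `|t| `^ (s - 1).
Proof.
move=> s0 s1 c0 r0 del0 tn0 h1 h2; have cr0 : 0 <= c * r ^+ 2 by rewrite mulr_ge0 ?sqr_ge0.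
have [t0|t0|t0] := ltrgtP t 0; last by rewrite t0 eqxx in tn0.
- rewrite powR0 ?gt_eqF// subr0 ger0_norm ?powR_ge0// ltr0_norm//.
  have [->|deln0] := eqVneq del 0; first by rewrite powR0 ?gt_eqF// mulr_ge0 ?powR_ge0.
  have {deln0}delp : 0 < del by rewrite lt_def deln0.
  move: h1; rewrite le_max leNgt delp/= => h1.
  have nt0 : 0 < - t by rewrite oppr_gt0.
  have crp : 0 < c * r ^+ 2 by lra.
  apply: (@le_trans _ _ ((c * r ^+ 2) `^ s)).
    by rewrite ge0_ler_powR ?nnegrE ?(ltW s0)//; lra.
  rewrite (powR_split s crp) ler_pM2l// le0_powR//; [lra|].
  by rewrite subr_le0 ltW.
- rewrite (gtr0_norm t0) distrC.
  apply: (le_trans (powR_dist_lip t0 del0 s0 (ltW s1))).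
  rewrite mulrC ler_wpM2r ?powR_ge0// ler_norml.
  move: h1; rewrite max_r; last by rewrite addr_ge0 ?(ltW t0).
  by move=> h1; apply/andP; split; lra.
Qed.

Lemma max0_dist d t tau : 0 < d -> t = d + tau -> `|d - Num.max 0 t| <= `|tau|.
Proof.
move=> d0 ->; have [h|h] := leP (d + tau) 0.
  rewrite subr0 gtr0_norm// ler0_norm; lra.
by rewrite opprD addrA subrr sub0r normrN.
Qed.

Lemma jreg_error_far s p d A h del r : 0 < s -> s < 1 -> 1 < p -> 0 < h -> 0 < d -> 0 <= del ->
  `|d - del| <= r -> A = d `^ s -> `|jreg (p - 1) h A (del `^ s)| <= r `^ (s * (p - 1)).
Proof.
move=> s0 s1 p1 h0 d0 del0 dr ->; have q0 : 0 < p - 1 by lra.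
apply: (le_trans (jreg_le (powR_ge0 _ _) (powR_ge0 _ _) h0 q0)).
have r0 : 0 <= r := le_trans (normr_ge0 _) dr.
rewrite powRrM ge0_ler_powR ?nnegrE ?powR_ge0 ?(ltW q0)//.
apply: (le_trans (powR_dist_le (ltW d0) del0 s0 (ltW s1))).
by rewrite ge0_ler_powR ?nnegrE ?(ltW s0).
Qed.

Lemma jreg_error_near s p d h del r : 0 < s -> s < 1 -> 1 < p -> 0 < h -> 0 < d -> 0 <= del ->
  `|d - del| <= r ->
  `|jreg (p - 1) h (d `^ s) (del `^ s)| <= h^-1 * d `^ ((s - 1) * p - s) * r `^ p.
Proof.
move=> s0 s1 p1 h0 d0 del0 dr; have q0 : 0 < p - 1 by lra.
apply: (le_trans (jreg_le_reg (powR_gt0 _ d0) (powR_ge0 _ _) h0 q0)); rewrite subrK.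
have r0 : 0 <= r := le_trans (normr_ge0 _) dr.
have E : h^-1 * d `^ ((s - 1) * p - s) * r `^ p = (d `^ (s - 1) * r) `^ p / (h * d `^ s).
  rewrite powRM ?powR_ge0// -powRrM invfM -powRN powR_addp//; ring.
rewrite E ler_wpM2r ?invr_ge0 ?mulr_ge0 ?powR_ge0 ?(ltW h0)//.
rewrite ge0_ler_powR ?nnegrE ?mulr_ge0 ?powR_ge0//; first by lra.
apply: (le_trans (powR_dist_lip d0 del0 s0 (ltW s1))).
by rewrite ler_wpM2l ?powR_ge0.
Qed.

(** The left side is a product of factors singular at [tau = 0] and at [t = 0], of total degree
    [s q - 1]. By [powR_sub_ge] the difference of powers is at least [s (t + |tau|)^(s-1) |tau|].
    Comparing [t] with [|tau|] then lets the smaller of the two carry the whole singularity, so the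
    factors never multiply. *)
Lemma two_power_bound s q tau t d : 0 < s -> s < 1 -> 0 < q -> q <= 1 -> 0 < d -> 0 < t ->
  t = d + tau -> tau != 0 ->
  `|d `^ s - t `^ s| `^ (q - 1) * t `^ (s - 1) <=
  (s `^ (q - 1) * 2 `^ ((1 - s) * (1 - q))) * (`|t| `^ (- (1 - s * q)) + `|tau| `^ (- (1 - s * q))).
Proof.
move=> s0 s1 q0 q1 d0 t0 tE tau0; rewrite (gtr0_norm t0).
set k := (1 - s) * (1 - q); have k0 : 0 <= k by rewrite mulr_ge0 ?subr_ge0 ?(ltW s1).
have x0 : 0 < `|tau| by rewrite normr_gt0.
have w0 : 0 < t + `|tau| by rewrite ltr_wpDr.
have dw : d <= t + `|tau| by have := ler_norm (- tau); rewrite normrN; lra.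
have low : s * (t + `|tau|) `^ (s - 1) * `|tau| <= `|d `^ s - t `^ s|.
  have aux x y : 0 < x -> 0 < y -> x <= t + `|tau| -> y <= x -> `|tau| = x - y ->
      s * (t + `|tau|) `^ (s - 1) * `|tau| <= x `^ s - y `^ s.
    move=> xp yp xw yx E; apply: le_trans (powR_sub_ge (ltW yp) yx xp s0 (ltW s1)).
    rewrite -E ler_wpM2r// ler_wpM2l ?(ltW s0)// le0_powR// subr_le0 ltW//.
  have [td|dt] := leP t d.
    rewrite (@ger0_norm _ (d `^ s - _)) ?subr_ge0 ?ge0_ler_powR ?nnegrE ?(ltW s0) ?(ltW t0) ?(ltW d0)//.
    have E : `|tau| = d - t by rewrite ler0_norm; lra.
    exact: aux.
  rewrite distrC (@ger0_norm _ (t `^ s - _)) ?subr_ge0 ?ge0_ler_powR ?nnegrE ?(ltW s0) ?(ltW t0) ?(ltW d0) ?(ltW dt)//.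
  have E : `|tau| = t - d by rewrite gtr0_norm; lra.
  by apply: aux; rewrite ?lerDl ?(ltW dt).
have lowp : 0 < s * (t + `|tau|) `^ (s - 1) * `|tau| by rewrite !mulr_gt0 ?powR_gt0.
have q10 : q - 1 <= 0 by rewrite subr_le0.
have step : `|d `^ s - t `^ s| `^ (q - 1) <= s `^ (q - 1) * ((t + `|tau|) `^ k * `|tau| `^ (q - 1)).
  apply: (le_trans (le0_powR lowp low q10)).
  rewrite !powRM ?mulr_ge0 ?powR_ge0 ?(ltW s0)// -powRrM -mulrA.
  by rewrite (_ : (s - 1) * (q - 1) = k)// /k; ring.
apply: (le_trans (ler_wpM2r (powR_ge0 _ _) step)).
rewrite -!mulrA ler_wpM2l ?powR_ge0//.
have [tx|xt] := leP t `|tau|.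
  apply: (@le_trans _ _ (2 `^ k * (`|tau| `^ k * `|tau| `^ (q - 1) * t `^ (s - 1)))).
    rewrite !mulrA -powRM// !ler_wpM2r ?powR_ge0// ge0_ler_powR ?nnegrE ?mulr_ge0 ?(ltW w0)//; lra.
  rewrite ler_wpM2l ?powR_ge0// -powR_addp//.
  apply: (@le_trans _ _ (t `^ (k + (q - 1)) * t `^ (s - 1))).
    rewrite ler_wpM2r ?powR_ge0// le0_powR// (_ : k + (q - 1) = - (s * (1 - q))); last by rewrite /k; ring.
    by rewrite oppr_le0 mulr_ge0 ?subr_ge0 ?(ltW s0).
  rewrite -powR_addp// ler_wpDr ?powR_ge0//.
  by rewrite (_ : k + (q - 1) + (s - 1) = - (1 - s * q))// /k; ring.
apply: (@le_trans _ _ (2 `^ k * (t `^ k * t `^ (s - 1) * `|tau| `^ (q - 1)))).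
  rewrite (mulrA _ (`|tau| `^ _)) (mulrAC _ (`|tau| `^ _)) !mulrA -powRM ?(ltW t0)// !ler_wpM2r ?powR_ge0//.
  by rewrite ge0_ler_powR ?nnegrE ?mulr_ge0 ?(ltW w0) ?(ltW t0)//; lra.
rewrite ler_wpM2l ?powR_ge0// -powR_addp//.
apply: (@le_trans _ _ (`|tau| `^ (k + (s - 1)) * `|tau| `^ (q - 1))).
  rewrite ler_wpM2r ?powR_ge0// le0_powR ?(ltW xt)// (_ : k + (s - 1) = - ((1 - s) * q)); last by rewrite /k; ring.
  by rewrite oppr_le0 mulr_ge0 ?subr_ge0 ?(ltW s1) ?(ltW q0).
rewrite -powR_addp// ler_wpDl ?powR_ge0//.
by rewrite (_ : k + (s - 1) + (q - 1) = - (1 - s * q))// /k; ring.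
Qed.

(* Exponents of the terms [|t|^(-b) r^(c-N)] of the error bound; [exps_ok] makes each of them integrable near [0], uniformly in the hyperplane [t = 0]. *)
Record exps : Type := Exps { eb1 : R; ec1 : R; eb2 : R; ec2 : R; eb3 : R; ec3 : R }.
Definition exps_ok (e : exps) : Prop :=
  [/\ 0 <= eb1 e < 1, 0 <= eb2 e < 1, 0 <= eb3 e < 1 & [/\ eb1 e < ec1 e, eb2 e < ec2 e & eb3 e < ec3 e]].

(** Here [nu] stands for the dimension and [r] for [|z|]. The constant and the exponents do not
    depend on [h] or [d], which makes the integrated error uniform. *)
Lemma jreg_error s p c : 0 < s -> s < 1 -> 1 < p -> 0 <= c ->
  exists (C : R) (e : exps), [/\ 0 <= C, exps_ok e &
   forall nu d tau t r del h, 0 < h -> 0 < d -> t = d + tau -> t != 0 -> tau != 0 ->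
    `|tau| <= r -> 0 <= del -> `|d - del| <= r ->
    del <= Num.max 0 (t + c * r ^+ 2) -> t - c * r ^+ 2 <= del ->
    `|jreg (p - 1) h (d `^ s) (del `^ s) - jreg (p - 1) h (d `^ s) (Num.max 0 t `^ s)| * r `^ (- (nu + p * s))
    <= C * (`|t| `^ (- eb1 e) * r `^ (ec1 e - nu) + `|tau| `^ (- eb2 e) * r `^ (ec2 e - nu) +
            `|t| `^ (- eb3 e) * r `^ (ec3 e - nu))].
Proof.
move=> s0 s1 p1 c0; have q0 : 0 < p - 1 by lra.
have [p2|p2] := leP 2 p.
  (* The exponent [2 - 2 s] is [s (p - 2) + 2 - p s]: Lipschitz slope, quadratic error and kernel. A
     single term occurs, and the other slots repeat it. *)
  exists ((p - 1 + 2) * c), (Exps (1 - s) (2 - 2 * s) (1 - s) (2 - 2 * s) (1 - s) (2 - 2 * s)).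
  split; first by rewrite mulr_ge0//; lra.
    by split=> /=; [lra|lra|lra|split; lra].
  move=> nu d tau t r del h h0 d0 tE tn0 taun0 taur del0 dr h1 h2 /=.
  have r0 : 0 < r by rewrite (lt_le_trans _ taur)// normr_gt0.
  have m0 : 0 <= Num.max 0 t by rewrite le_max lexx.
  have dm := le_trans (max0_dist d0 tE) taur.
  have q1 : 1 <= p - 1 by lra.
  have aM x : 0 <= x -> `|d - x| <= r -> `|d `^ s - x `^ s| <= r `^ s.
    move=> x0 xr; apply: (le_trans (powR_dist_le (ltW d0) x0 s0 (ltW s1))).
    by rewrite ge0_ler_powR ?nnegrE ?(ltW s0) ?(ltW r0).
  have E := jreg_dist_lip (powR_ge0 d s) (powR_ge0 del s) (powR_ge0 (Num.max 0 t) s) h0 q1 (aM _ del0 dr) (aM _ m0 dm).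
  have U := profile_dist s0 s1 c0 r0 del0 tn0 h1 h2.
  apply: (@le_trans _ _ ((p - 1 + 2) * c * (`|t| `^ (- (1 - s)) * r `^ (2 - 2 * s - nu)))); last first.
    rewrite ler_wpM2l ?mulr_ge0//; first by lra.
    have X0 : 0 <= `|t| `^ (- (1 - s)) * r `^ (2 - 2 * s - nu) by rewrite mulr_ge0 ?powR_ge0.
    have Y0 : 0 <= `|tau| `^ (- (1 - s)) * r `^ (2 - 2 * s - nu) by rewrite mulr_ge0 ?powR_ge0.
    lra.
  apply: (le_trans (ler_wpM2r (powR_ge0 _ _) E)).
  have q20 : 0 <= (p - 1 + 2) * r `^ s `^ (p - 1 - 1) by rewrite mulr_ge0 ?powR_ge0//; lra.
  apply: (le_trans (ler_wpM2r (powR_ge0 _ _) (ler_wpM2l q20 U))).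
  rewrite le_eqVlt; apply/orP; left; apply/eqP.
  rewrite -powR_mulrn ?(ltW r0)// -powRrM opprB.
  have -> : r `^ (2 - 2 * s - nu) = r `^ (s * (p - 1 - 1)) * r `^ 2%:R * r `^ (- (nu + p * s)).
    by rewrite -!powR_addp//; congr (_ `^ _); ring.
  ring.
have q1 : p - 1 <= 1 by lra.
set b0 := 1 - s * (p - 1).
have sq : s * (p - 1) < 1.
  by rewrite -[ltRHS]mulr1; apply: ltr_pM => //; lra.
have b00 : 0 <= b0 < 1.
  have : 0 < s * (p - 1) by rewrite mulr_gt0.
  rewrite /b0; lra.
have b02 : b0 < 2 - p * s by rewrite /b0 mulrBr mulr1 (mulrC p); lra.
have sp : s < p * s by rewrite ltr_pMl.
set K := s `^ (p - 1 - 1) * 2 `^ ((1 - s) * (1 - (p - 1))).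
have K0 : 0 <= K by rewrite mulr_ge0 ?powR_ge0.
(* The first two pairs come from [two_power_bound] on [t > 0], the third from the region [t < 0],
   where the profile is 0. *)
exists (4 * c * K + 4 * c `^ (s * p)), (Exps b0 (2 - p * s) b0 (2 - p * s) s (p * s)).
split; first by rewrite addr_ge0// ?mulr_ge0 ?powR_ge0.
  by split=> //=; lra.
move=> nu d tau t r del h h0 d0 tE tn0 taun0 taur del0 dr h1 h2 /=.
have r0 : 0 < r by rewrite (lt_le_trans _ taur)// normr_gt0.
have m0 : 0 <= Num.max 0 t by rewrite le_max lexx.
have T1 : 0 <= `|t| `^ (- b0) * r `^ (2 - p * s - nu) by rewrite mulr_ge0 ?powR_ge0.
have T2 : 0 <= `|tau| `^ (- b0) * r `^ (2 - p * s - nu) by rewrite mulr_ge0 ?powR_ge0.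
have T3 : 0 <= `|t| `^ (- s) * r `^ (p * s - nu) by rewrite mulr_ge0 ?powR_ge0.
have cK : 0 <= 4 * c * K by apply: mulr_ge0 => //; apply: mulr_ge0.
have cK' : 0 <= 4 * c `^ (s * p) by rewrite mulr_ge0 ?powR_ge0.
set m := Num.max 0 t; have mE : m = Num.max 0 t by []; clearbody m.
have [t0|t0|t0] := ltrgtP t 0; last by rewrite t0 eqxx in tn0.
  rewrite mE.
  apply: (@le_trans _ _ (4 * c `^ (s * p) * (`|t| `^ (- s) * r `^ (p * s - nu)))); last first.
    by apply: ler_pM => //; [rewrite lerDr|rewrite lerDr addr_ge0].
  have E := jreg_dist_hoelder (powR_ge0 d s) (powR_ge0 del s) (powR_ge0 (Num.max 0 t) s) h0 q0 q1.
  apply: (le_trans (ler_wpM2r (powR_ge0 _ _) E)).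
  rewrite ?max_l ?(ltW t0)// powR0 ?gt_eqF// subr0 ger0_norm ?powR_ge0//.
  have [->|deln0] := eqVneq del 0.
    by rewrite powR0 ?gt_eqF// powR0 ?gt_eqF// mulr0 mul0r mulr_ge0.
  have {deln0}delp : 0 < del by rewrite lt_def deln0.
  move: h1; rewrite le_max leNgt delp/= => h1.
  have nt0 : 0 < - t by rewrite oppr_gt0.
  have crp : 0 < c * r ^+ 2 by lra.
  have D1 : (del `^ s) `^ (p - 1) <= (c * r ^+ 2) `^ (s * (p - 1)).
    by rewrite -powRrM ge0_ler_powR ?nnegrE ?mulr_ge0 ?(ltW s0) ?(ltW q0) ?(ltW crp)//; lra.
  (* The Hoelder bound alone leaves [r^(s(p-2))] against [r^(-nu)], not integrable for [p < 2]. As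
     [|t| < c r^2], this factor, at least 1, buys [r^(2s)] for the admissible singularity
     [|t|^(-s)]. *)
  have D2 : 1 <= (c * r ^+ 2) `^ s * `|t| `^ (- s).
    rewrite powRN ltr0_norm// ler_pdivlMr ?powR_gt0// mul1r ge0_ler_powR ?nnegrE ?(ltW s0) ?(ltW nt0) ?(ltW crp)//; lra.
  have D3 : (del `^ s) `^ (p - 1) <= c `^ (s * p) * (`|t| `^ (- s) * r `^ (2 * (s * p))).
    apply: (@le_trans _ _ ((c * r ^+ 2) `^ (s * (p - 1)) * ((c * r ^+ 2) `^ s * `|t| `^ (- s)))).
      by rewrite -[leLHS]mulr1 ler_pM ?powR_ge0.
    rewrite mulrA -powR_addp// (_ : s * (p - 1) + s = s * p); last by ring.
    rewrite powRM// ?sqr_ge0// -(powR_mulrn 2 (ltW r0)) -powRrM; rewrite le_eqVlt; apply/orP; left; apply/eqP; ring.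
  rewrite -!mulrA ler_wpM2l//; apply: (le_trans (ler_wpM2r (powR_ge0 _ _) D3)).
  rewrite -!mulrA !ler_wpM2l ?powR_ge0// -powR_addp// le_eqVlt; apply/orP; left; apply/eqP.
  congr (_ `^ _); ring.
rewrite mE.
apply: (@le_trans _ _ (4 * c * K * (`|t| `^ (- b0) * r `^ (2 - p * s - nu) + `|tau| `^ (- b0) * r `^ (2 - p * s - nu)))); last first.
  by apply: ler_pM; rewrite ?addr_ge0// lerDl.
have dt : d `^ s != (Num.max 0 t) `^ s.
  rewrite max_r ?(ltW t0)//; apply/eqP => /(powR_injective s0).
  rewrite !nnegrE => /(_ (ltW d0) (ltW t0)) dt; move/eqP: taun0; apply; lra.
have E := jreg_dist_sublinear (powR_ge0 d s) (powR_ge0 del s) (powR_ge0 (Num.max 0 t) s) h0 q0 q1 dt.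
have U := profile_dist s0 s1 c0 r0 del0 tn0 h1 h2.
apply: (le_trans (ler_wpM2r (powR_ge0 _ _) E)).
have q20 : 0 <= 4 * `|d `^ s - Num.max 0 t `^ s| `^ (p - 1 - 1) by rewrite mulr_ge0 ?powR_ge0.
apply: (le_trans (ler_wpM2r (powR_ge0 _ _) (ler_wpM2l q20 U))).
rewrite max_r ?(ltW t0)//.
have W := two_power_bound s0 s1 q0 q1 d0 t0 tE taun0.
rewrite -/b0 -/K in W.
have -> : 4 * `|d `^ s - t `^ s| `^ (p - 1 - 1) * (c * r ^+ 2 * `|t| `^ (s - 1)) * r `^ (- (nu + p * s)) =
  4 * c * (`|d `^ s - t `^ s| `^ (p - 1 - 1) * t `^ (s - 1)) * (r ^+ 2 * r `^ (- (nu + p * s))).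
  by rewrite (gtr0_norm t0); ring.
have -> : r ^+ 2 * r `^ (- (nu + p * s)) = r `^ (2 - p * s - nu).
  rewrite -(powR_mulrn 2 (ltW r0)) -powR_addp//; congr (_ `^ _); ring.
rewrite -(mulrDl (`|t| `^ (- b0))) [leRHS]mulrA ler_wpM2r ?powR_ge0//.
by rewrite -(mulrA (4 * c) K) ler_wpM2l ?mulr_ge0.
Qed.

End PointwiseError.

(** * Distance to the complement and tangent balls *)

Section Distance.
Set Implicit Arguments. Unset Strict Implicit.
Context {R : realType} {N : nat}.
Context (O : set 'rV[R]_N) (oO : open O) (neO : (~` O) !=set0).
Implicit Types x y z : 'rV[R]_N.

Lemma distc_le x y : ~ O y -> distc O x <= eucl (x - y).
Proof.
move=> Oy; apply: ge_inf; last by exists y.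
by exists 0 => _ [z _ <-]; exact: eucl_ge0.
Qed.

Lemma distc_ge x c : (forall y, ~ O y -> c <= eucl (x - y)) -> c <= distc O x.
Proof.
move=> h; apply: lb_le_inf; first by have [y Oy] := neO; exists (eucl (x - y)), y.
by move=> _ [y Oy <-]; exact: h.
Qed.

Lemma distc_ge0 x : 0 <= distc O x.
Proof. by apply: distc_ge => y _; exact: eucl_ge0. Qed.

Lemma distc_notin x : ~ O x -> distc O x = 0.
Proof.
move=> Ox; apply/eqP; rewrite eq_le distc_ge0 andbT.
by apply: le_trans (distc_le _ Ox) _; rewrite subrr eucl0.
Qed.

Lemma distc_gt0 x : O x -> 0 < distc O x.
Proof.
move=> Ox; have [e e0 xe] := (open_euclP O).1 oO x Ox.
apply: (lt_le_trans e0); apply: distc_ge => y Oy; rewrite leNgt; apply/negP => ye.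
by apply/Oy/xe; rewrite /= euclB.
Qed.

Lemma distc_lip x y : `|distc O x - distc O y| <= eucl (x - y).
Proof.
have h a b : distc O a - distc O b <= eucl (a - b).
  rewrite lerBlDr addrC -lerBlDr; apply: distc_ge => z Oz.
  rewrite lerBlDr addrC; apply: le_trans (distc_le _ Oz) _; exact: ler_eucl_dist.
by rewrite ler_norml h andbT lerNl opprB euclB h.
Qed.

Lemma distc_nearest x : exists2 y, ~ O y & distc O x = eucl (x - y).
Proof.
have [y0 Oy0] := neO.
(* Points farther from [x] than [y0] cannot be nearest; without them the closed complement becomes
   compact. *)
pose A : set 'rV[R]_N := ~` O `&` [set y | eucl (x - y) <= eucl (x - y0)].
have ceu : continuous (fun y => eucl (x - y)).
  apply: (@continuous_lipeucl _ _ _ 1) => a b; rewrite mul1r.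
  by apply: le_trans (ler_dist_eucl _ _) _; rewrite opprB addrC subrKA euclB.
have cA : compact A.
  apply: bounded_closed_compact; last first.
    apply: closedI; first exact: open_closedC.
    rewrite (_ : [set y | _] = (fun y => eucl (x - y)) @^-1` [set t | t <= eucl (x - y0)])//.
    by apply: closed_comp => //; exact: closed_le.
  exists (eucl x + eucl (x - y0)); split; first exact: num_real.
  move=> M xM y [_ /= yx]; apply: le_trans (ltW xM); apply: (le_trans (norm_le_eucl y)).
  have := ler_euclD (y - x) x; rewrite subrK (euclB y); lra.
have A0 : A !=set0 by exists y0; split => //=.
have [y /set_mem[Oy _] ymin] := @EVT_min_rV R N (fun y => eucl (x - y)) A A0 cA (continuous_subspaceT ceu).
exists y => //; apply/eqP; rewrite eq_le distc_le//=; apply: distc_ge => z Oz.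
have [zy|yz] := leP (eucl (x - z)) (eucl (x - y0)); first by apply: ymin; rewrite inE; split.
by apply: le_trans (ltW yz); apply: ymin; rewrite inE; split => /=.
Qed.

End Distance.

Section TangentBalls.
Set Implicit Arguments. Unset Strict Implicit.
Context {R : realType} {N : nat}.
Context (O : set 'rV[R]_N) (neO : (~` O) !=set0).
Implicit Types x y z v : 'rV[R]_N.

(** This is [sqrt(A^2 + B) <= A + B/(2A)]. It makes the distance to a tangent ball of radius near
    [A] affine up to a quadratic error. *)
Lemma eucl_le_tangent (A : R) z v : 0 < A -> eucl v = 1 ->
  eucl (z + A *: v) <= A + dotv v z + eucl z ^+ 2 / (2 * A).
Proof.
move=> A0 v1; set B := 2 * A * dotv v z + eucl z ^+ 2.
have E : eucl (z + A *: v) ^+ 2 = A ^+ 2 + B.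
  rewrite sqr_eucl !(dotvDl,dotvDr,dotvZl,dotvZr) -!sqr_eucl v1 (dotvC z) /B; ring.
have AB0 : 0 <= A ^+ 2 + B by rewrite -E sqr_ge0.
have -> : A + dotv v z + eucl z ^+ 2 / (2 * A) = A + B / (2 * A).
  by rewrite /B; field; rewrite gt_eqF.
have A20 : 0 < 2 * A by rewrite mulr_gt0.
have h0 : 0 <= A + B / (2 * A).
  have E2 : 2 * A * (A + B / (2 * A)) = A ^+ 2 + (A ^+ 2 + B) by field; rewrite gt_eqF.
  rewrite -(pmulr_rge0 _ A20) E2.
  by rewrite addr_ge0// sqr_ge0.
rewrite -(@ler_pXn2r _ 2)// ?nnegrE ?eucl_ge0// E.
rewrite (_ : (A + B / (2 * A)) ^+ 2 = A ^+ 2 + B + (B / (2 * A)) ^+ 2); last by field; rewrite gt_eqF.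
by rewrite lerDl sqr_ge0.
Qed.

Lemma distc_ball_ge x p r : (forall y, eucl (y - p) < r -> O y) -> r - eucl (x - p) <= distc O x.
Proof.
move=> h; apply: distc_ge => // y Oy.
have yp : r <= eucl (y - p) by rewrite leNgt; apply/negP => yp; exact/Oy/h.
by have := ler_eucl_dist y x p; rewrite (euclB y x); lra.
Qed.

Lemma distc_ball_le x p r : 0 < r -> (forall y, eucl (y - p) < r -> ~ O y) -> O x ->
  distc O x <= eucl (x - p) - r.
Proof.
move=> r0 h Ox; have xp : r <= eucl (x - p) by rewrite leNgt; apply/negP => /h; apply.
have xp0 : 0 < eucl (x - p) := lt_le_trans r0 xp.
(* The ball is open, so the competitor [y] is taken on the segment from [p] to [x], at depth [e']
   below the sphere. *)
apply/ler_addgt0Pr => e e0; pose e' := Num.min e r.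
have e'0 : 0 < e' by rewrite lt_min e0 r0.
have e'r : e' <= r by rewrite ge_min lexx orbT.
pose t := (r - e') / eucl (x - p).
have t0 : 0 <= t by rewrite divr_ge0 ?subr_ge0// ltW.
pose y := p + t *: (x - p).
have yO : ~ O y.
  apply: h; rewrite /y addrAC subrr add0r euclZ ger0_norm// /t divfK ?gt_eqF//; lra.
apply: (le_trans (distc_le x yO)).
have t1 : t <= 1 by rewrite /t ler_pdivrMr// mul1r; lra.
rewrite (_ : x - y = (1 - t) *: (x - p)); last first.
  by rewrite scalerBl scale1r /y opprD addrA.
rewrite euclZ ger0_norm ?subr_ge0// mulrBl mul1r /t divfK ?gt_eqF//.
have : e' <= e by rewrite ge_min lexx.
lra.
Qed.

End TangentBalls.

(** * Taylor and Lipschitz bounds for [C11fun] *)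

Section C11.
Set Implicit Arguments. Unset Strict Implicit.
Context {R : realType}.

Lemma mxE_sum_delta n (w : 'rV[R]_n) : w = \sum_(i < n) w ord0 i *: delta_mx 0 i.
Proof. by rewrite {1}(row_sum_delta w). Qed.

Lemma derive_line n (g : 'rV[R]_n -> R) (y w : 'rV[R]_n) (t : R) : differentiable g (y + t *: w) ->
  is_derive t 1 (fun u : R => g (y + u *: w)) (\sum_(i < n) w ord0 i * 'D_(delta_mx 0 i) g (y + t *: w)).
Proof.
move=> dg; set a := y + t *: w.
have -> : \sum_(i < n) w ord0 i * 'D_(delta_mx 0 i) g a = 'D_w g a.
  rewrite deriveE// [in RHS](mxE_sum_delta w) linear_sum; apply: eq_bigr => i _.
  by rewrite linearZ/= deriveE.
have E : (fun h : R => h^-1 *: (g (y + (h *: 1 + t) *: w) - g (y + t *: w))) =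
         (fun h : R => h^-1 *: (g (h *: w + a) - g a)).
  apply/funext => h; congr (_ *: (g _ - _)).
  by rewrite /a scalerDl addrCA /GRing.scale/= mulr1.
have cv : cvg ((fun h : R => h^-1 *: (g (h *: w + a) - g a)) @ 0^').
  exact: diff_derivable.
apply: DeriveDef.
  by rewrite /derivable/= E.
by rewrite /derive/= E.
Qed.

(** The mean value theorem on the segment replaces the increment by the derivative at one
    intermediate point, which the Lipschitz bound on the partial derivatives compares with the
    derivative at [y]. *)
Lemma C11_taylor n (g : 'rV[R]_n -> R) : C11fun g -> exists2 K : R, 0 <= K &
  forall y z : 'rV[R]_n,
   `|g z - g y - \sum_(i < n) (z - y) ord0 i * 'D_(delta_mx 0 i) g y| <= K * eucl (z - y) ^+ 2.
Proof.
move=> [dg [L gL]]; exists (n%:R * `|L|); first by rewrite mulr_ge0.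
move=> y z; set w := z - y.
pose h (t : R) := g (y + t *: w).
pose h' (t : R) := \sum_(i < n) w ord0 i * 'D_(delta_mx 0 i) g (y + t *: w).
have dh (t : R) : is_derive t 1 h (h' t) by exact: derive_line.
have ch : {within `[0, 1], continuous h}.
  apply: continuous_subspaceT => t; apply: differentiable_continuous.
  by apply/derivable1_diffP; apply: (@ex_derive _ _ _ _ _ _ (h' t)).
have [t t01 ht] := @MVT R h h' 0 1 (@ltr01 R) (fun x _ => dh x) ch.
have -> : g z - g y = h' t.
  move: ht; rewrite /h scale1r scale0r addr0 subr0 mulr1 => <-.
  by congr (g _ - _); rewrite /w addrC subrK.
rewrite /h' -sumrB; apply: (le_trans (ler_norm_sum _ _ _)).
apply: (@le_trans _ _ (\sum_(i < n) `|L| * eucl w ^+ 2)).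
  apply: ler_sum => i _; rewrite -mulrBr normrM expr2 mulrCA.
  apply: ler_pM => //; first exact: coord_le_eucl.
  apply: (le_trans (gL _ _ _)); rewrite addrAC subrr add0r euclZ.
  apply: (@le_trans _ _ (`|L| * (`|t| * eucl w))).
    by rewrite ler_wpM2r ?ler_norm// mulr_ge0 ?eucl_ge0.
  rewrite ler_wpM2l// ler_piMl ?eucl_ge0//.
  by move: t01; rewrite in_itv/= => /andP[t0 t1]; rewrite ger0_norm ltW.
by rewrite sumr_const card_ord -[leRHS]mulrA mulr_natl.
Qed.

Lemma C11_lip n (g : 'rV[R]_n -> R) (r : R) : C11fun g -> 0 <= r -> exists2 A : R, 0 <= A &
  forall y z : 'rV[R]_n, eucl y <= r -> eucl z <= r -> `|g z - g y| <= A * eucl (z - y).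
Proof.
move=> gC r0; have [K K0 gK] := C11_taylor gC; have [dg [L gL]] := gC.
pose D := \sum_(i < n) (`|'D_(delta_mx 0 i) g 0| + `|L| * r).
have D0 : 0 <= D by apply: sumr_ge0 => i _; rewrite addr_ge0// mulr_ge0.
exists (D + K * (2 * r)); first by rewrite addr_ge0// !mulr_ge0.
move=> y z yr zr; have := gK y z; set S := \sum_(i < n) _ => h.
have zy : eucl (z - y) <= 2 * r.
  by have := ler_euclD z (- y); rewrite euclN; lra.
have e0 := eucl_ge0 (z - y).
have SD : `|S| <= D * eucl (z - y).
  apply: (le_trans (ler_norm_sum _ _ _)); rewrite mulr_suml; apply: ler_sum => i _.
  rewrite normrM mulrC; apply: ler_pM => //; last exact: coord_le_eucl.
  have := gL i y 0; rewrite subr0 => h1.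
  have h2 : L * eucl y <= `|L| * r.
    by apply: (le_trans (ler_wpM2r (eucl_ge0 _) (ler_norm L))); rewrite ler_wpM2l.
  have := ler_normD ('D_(delta_mx 0 i) g y - 'D_(delta_mx 0 i) g 0) ('D_(delta_mx 0 i) g 0).
  rewrite subrK; lra.
have h2 : K * eucl (z - y) ^+ 2 <= K * (2 * r) * eucl (z - y).
  by rewrite expr2 mulrA ler_wpM2r// ler_wpM2l.
have := ler_normD (g z - g y - S) S; rewrite subrK; lra.
Qed.

End C11.

(** * From local graphs to uniform interior and exterior tangent balls *)

Section Graph.
Set Implicit Arguments. Unset Strict Implicit.
Context {R : realType} {n : nat}.
Implicit Types x y z : 'rV[R]_n.+1.

Lemma rfirstB x y : rfirst (x - y) = rfirst x - rfirst y :> 'rV[R]_n.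
Proof. by apply/rowP => i; rewrite !mxE. Qed.

Lemma rlastB x y : rlast (x - y) = rlast x - rlast y :> R.
Proof. by rewrite /rlast !mxE. Qed.

Lemma eucl_rfirst x : eucl (rfirst x : 'rV[R]_n) <= eucl x.
Proof.
rewrite /eucl ler_wsqrtr// big_ord_recr /= -[leLHS]addr0 lerD ?sqr_ge0//.
rewrite le_eqVlt; apply/orP; left; apply/eqP; apply: eq_bigr => i _; rewrite mxE.
by congr ((x ord0 _) ^+ 2); apply: val_inj.
Qed.

Lemma norm_rlast x : `|rlast x| <= eucl x.
Proof. exact: coord_le_eucl. Qed.

(** With [a] the gradient of [g], this is the upward normal (-grad g, 1) to the graph, not
    normalized. The last index is the only one on which [insub] fails. *)
Definition flat_normal (a : 'I_n -> R) : 'rV[R]_n.+1 :=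
  \row_(i < n.+1) if insub (val i) is Some j then - a j else 1.

Lemma dotv_flat_normal (a : 'I_n -> R) z :
  dotv (flat_normal a) z = rlast z - \sum_(i < n) (rfirst z) ord0 i * a i.
Proof.
rewrite /dotv big_ord_recr /= !mxE /= insubN ?ltnn// mul1r addrC; congr (_ + _).
rewrite -sumrN; apply: eq_bigr => i _; rewrite !mxE /= insubT//= => ?.
rewrite mulrC mulrN; congr (- (z ord0 _ * a _)); exact: val_inj.
Qed.

Lemma flat_normal_ge1 (a : 'I_n -> R) : 1 <= eucl (flat_normal a).
Proof.
have := coord_le_eucl (flat_normal a) ord_max.
by rewrite !mxE /= insubN ?ltnn// normr1.
Qed.

Lemma sqr_eucl_subZ (e : R) (w z : 'rV[R]_n.+1) : eucl w = 1 ->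
  eucl (z - e *: w) ^+ 2 = eucl z ^+ 2 - 2 * e * dotv w z + e ^+ 2.
Proof.
move=> w1; rewrite sqr_eucl !(dotvBl,dotvBr,dotvZl,dotvZr) -!sqr_eucl w1 (dotvC z); ring.
Qed.

Context (O : set 'rV[R]_n.+1).

Definition bdry : set 'rV[R]_n.+1 := closure O `&` ~` O.

Definition two_balls (r : R) (x : 'rV[R]_n.+1) := exists v : 'rV[R]_n.+1,
  [/\ eucl v = 1, forall y, eucl (y - (x + r *: v)) < r -> O y &
      forall y, eucl (y - (x - r *: v)) < r -> ~ O y].

Lemma closure_euclP x : closure O x -> forall e : R, 0 < e -> exists2 y, O y & eucl (y - x) < e.
Proof.
move=> cx e e0; have [y [Oy ye]] : (O `&` [set y | eucl (y - x) < e]) !=set0.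
  by apply: cx; apply/nbhs_euclP; exists e.
by exists y.
Qed.

(** A point strictly below the graph cannot be a limit of points of [O]: these are above the graph,
    and [g] is Lipschitz on bounded sets. *)
Lemma graph_bdry (x0 : 'rV[R]_n.+1) (r : R) (Q : 'M[R]_n.+1) (g : 'rV[R]_n -> R) :
  Q *m Q^T = 1%:M -> C11fun g ->
  (forall x, eucl (x - x0) < r -> (O x <-> g (rfirst ((x - x0) *m Q)) < rlast ((x - x0) *m Q))) ->
  forall x, bdry x -> eucl (x - x0) < r -> rlast ((x - x0) *m Q) = g (rfirst ((x - x0) *m Q)).
Proof.
move=> QQ gC Og x [cx Ox] xr; set xi := (x - x0) *m Q.
have le1 : rlast xi <= g (rfirst xi).
  by rewrite leNgt; apply/negP => h; apply: Ox; apply/Og.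
apply/eqP; rewrite eq_le le1/= leNgt; apply/negP => lt1.
have r0 : 0 <= r by apply: le_trans (ltW xr); exact: eucl_ge0.
have [A A0 gA] := C11_lip gC r0.
pose gap := g (rfirst xi) - rlast xi.
have gap0 : 0 < gap by rewrite subr_gt0.
(* A move of length below [e] changes the height above the graph by at most [(A + 1) e], which does
   not exceed [gap]. *)
pose e := Num.min (r - eucl (x - x0)) (gap / (A + 1)).
have A1 : 0 < A + 1 by rewrite ltr_wpDl.
have e0 : 0 < e by rewrite lt_min subr_gt0 xr divr_gt0.
have [y Oy ye] := closure_euclP cx e0.
move: ye; rewrite lt_min => /andP[ye1 ye2].
have yr : eucl (y - x0) < r by have := ler_eucl_dist y x x0; lra.
have := (Og _ yr).1 Oy; set eta := (y - x0) *m Q.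
have E : eucl (eta - xi) = eucl (y - x).
  by rewrite /eta /xi -mulmxBl eucl_orth// opprB addrA subrK.
have exi : eucl (rfirst xi) <= r by rewrite (le_trans (eucl_rfirst _))// eucl_orth// ltW.
have eeta : eucl (rfirst eta) <= r by rewrite (le_trans (eucl_rfirst _))// eucl_orth// ltW.
have h1 := gA _ _ exi eeta.
have h2 := eucl_rfirst (eta - xi); rewrite rfirstB E in h2.
have h3 := norm_rlast (eta - xi); rewrite rlastB E in h3.
rewrite ltr_pdivlMr// in ye2.
have h4 : A * eucl (rfirst eta - rfirst xi) <= A * eucl (y - x) by rewrite ler_wpM2l.
move: h1 h3; rewrite !ler_norml => /andP[h11 h12] /andP[h31 h32].
have : gap = g (rfirst xi) - rlast xi by [].
lra.
Qed.

(** In a ball of radius [e] touching [x] in the direction [w], [|y - x|^2 < 2 e w.(y - x)]. The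
    Taylor error [K |y - x|^2] is then smaller than the linear term as soon as [2 e K < 1], so the
    sign of the linear term decides on which side of the graph [y] lies. *)
Lemma graph_two_balls (x0 : 'rV[R]_n.+1) (r : R) (Q : 'M[R]_n.+1) (g : 'rV[R]_n -> R) : 0 < r ->
  Q *m Q^T = 1%:M -> C11fun g ->
  (forall x, eucl (x - x0) < r -> (O x <-> g (rfirst ((x - x0) *m Q)) < rlast ((x - x0) *m Q))) ->
  exists2 r1, 0 < r1 & forall x, bdry x -> eucl (x - x0) < r / 2 ->
    forall e, 0 < e <= r1 -> two_balls e x.
Proof.
move=> r0 QQ gC Og; have [K K0 gK] := C11_taylor gC.
have K1 : 0 < 2 * K + 1 by rewrite ltr_wpDl// mulr_ge0.
(* Points of the tangent balls are within [2 e <= r / 2] of [x], hence still in the chart;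
   [e (2 K + 1) <= 1] gives the strict inequality [2 e K < 1], also for [K = 0]. *)
exists (Num.min (r / 4) (2 * K + 1)^-1); first by rewrite lt_min divr_gt0// invr_gt0.
move=> x bx xr e /andP[e0]; rewrite le_min => /andP[er eK].
have xr' : eucl (x - x0) < r by lra.
have onG := graph_bdry QQ gC Og bx xr'.
set xi := (x - x0) *m Q in onG.
pose a i := 'D_(delta_mx 0 i) g (rfirst xi).
pose m := flat_normal a; have m1 : 1 <= eucl m := flat_normal_ge1 a.
have m0 : 0 < eucl m by rewrite (lt_le_trans ltr01).
have QQ' : Q^T *m Q = 1%:M by exact: mulmx1C.
pose v := (eucl m)^-1 *: (m *m Q^T).
have v1 : eucl v = 1.
  rewrite /v euclZ eucl_orth ?trmxK// ger0_norm ?invr_ge0 ?(ltW m0)//.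
  by rewrite mulVf ?gt_eqF.
have key y : eucl (y - x0) < r ->
    `|rlast ((y - x0) *m Q) - g (rfirst ((y - x0) *m Q)) - eucl m * dotv v (y - x)|
      <= K * eucl (y - x) ^+ 2.
  move=> yr; set eta := (y - x0) *m Q.
  have EB : eta - xi = (y - x) *m Q by rewrite /eta /xi -mulmxBl opprB addrA subrK.
  have E : eucl (eta - xi) = eucl (y - x) by rewrite EB eucl_orth.
  have D : eucl m * dotv v (y - x) = dotv m (eta - xi).
    rewrite /v dotvZl mulrA mulfV ?gt_eqF// mul1r EB.
    by rewrite -[in RHS](dotv_orth (Q := Q^T)) ?trmxK// -mulmxA QQ mulmx1.
  rewrite D dotv_flat_normal rlastB rfirstB onG.
  have h := gK (rfirst xi) (rfirst eta).
  have h2 := eucl_rfirst (eta - xi); rewrite rfirstB E in h2.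
  have h3 : K * eucl (rfirst eta - rfirst xi) ^+ 2 <= K * eucl (y - x) ^+ 2.
    by rewrite ler_wpM2l// lerXn2r ?nnegrE ?eucl_ge0.
  apply: le_trans h3; apply: le_trans h; rewrite -normrN le_eqVlt; apply/orP; left; apply/eqP.
  congr (`|_|); rewrite /a; ring.
have eK2 : 2 * e * K < 1.
  have : e * (2 * K + 1) <= 1.
    by rewrite -ler_pdivlMr// div1r.
  lra.
(* The quadratic inequality is [|y - x - e w|^2 < e^2] expanded; it is used for [w = v] and for
   [w = - v]. *)
have near w y : eucl w = 1 -> eucl (y - (x + e *: w)) < e ->
    eucl (y - x0) < r /\ eucl (y - x) ^+ 2 < 2 * e * dotv w (y - x).
  move=> w1 ye.
  have yx : y - (x + e *: w) = y - x - e *: w by rewrite opprD addrA.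
  rewrite yx in ye; split.
    have := ler_eucl_dist y x x0.
    have := ler_euclD (y - x - e *: w) (e *: w); rewrite subrK euclZ w1 mulr1 gtr0_norm//; lra.
  have : eucl (y - x - e *: w) ^+ 2 < e ^+ 2 by rewrite ltrXn2r ?nnegrE ?eucl_ge0// ltW.
  rewrite sqr_eucl_subZ//; lra.
have e20 : 0 < 2 * e by rewrite mulr_gt0.
exists v; split => // y ye.
  have [yr yd] := near v y v1 ye; apply/(Og _ yr).
  have := key y yr; rewrite ler_norml => /andP[k1 _].
  have d0 : 0 < dotv v (y - x).
    by rewrite -(pmulr_rgt0 _ e20); apply: le_lt_trans yd; exact: sqr_ge0.
  have h1 : dotv v (y - x) <= eucl m * dotv v (y - x) by rewrite ler_peMl// ltW.
  have h2 : K * eucl (y - x) ^+ 2 <= K * (2 * e * dotv v (y - x)) by rewrite ler_wpM2l// ltW.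
  have h3 : 2 * e * K * dotv v (y - x) < 1 * dotv v (y - x) by rewrite ltr_pM2r.
  lra.
have nv1 : eucl (- v) = 1 by rewrite euclN.
have ye' : eucl (y - (x + e *: (- v))) < e by rewrite scalerN.
have [yr yd] := near (- v) y nv1 ye'; rewrite dotvNl in yd.
move=> /(Og _ yr) Oy; have := key y yr; rewrite ler_norml => /andP[_ k1].
set d := dotv v (y - x) in yd k1.
have d0 : 0 < - d.
  by rewrite -(pmulr_rgt0 _ e20) mulrN -mulrN; apply: le_lt_trans yd; exact: sqr_ge0.
have h1 : - d <= eucl m * - d by rewrite ler_peMl// ltW.
have h2 : K * eucl (y - x) ^+ 2 <= K * (2 * e * - d) by rewrite ler_wpM2l// ltW.
have h3 : 2 * e * K * - d < 1 * - d by rewrite ltr_pM2r.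
lra.
Qed.

Lemma eucl_finite_cover (B : set 'rV[R]_n.+1) (P : 'rV[R]_n.+1 -> R -> Prop) : compact B ->
  (forall x, B x -> exists r, 0 < r /\ P x r) ->
  exists s : seq ('rV[R]_n.+1 * R), (forall c, c \in s -> 0 < c.2 /\ P c.1 c.2) /\
    forall x, B x -> exists2 c, c \in s & eucl (x - c.1) < c.2.
Proof.
move=> cB hB.
have /choice[f hf] (x : 'rV[R]_n.+1) : exists r, B x -> 0 < r /\ P x r.
  by have [/hB[r hr]|nB] := pselect (B x); [exists r|exists 0].
move: cB; rewrite compact_cover => /(_ _ B (fun x => [set y | eucl (y - x) < f x])).
case.
- move=> x Bx; apply/open_euclP => y /= yx; exists (f x - eucl (y - x)); first by rewrite subr_gt0.
  by move=> z /= zy; have := ler_eucl_dist z y x; lra.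
- by move=> x Bx; exists x => //=; rewrite subrr eucl0; have [] := hf x Bx.
move=> D DB cov; exists [seq (x, f x) | x <- finmap.enum_fset D]; split.
  move=> _ /mapP[x xD ->] /=; apply: hf; have := DB x xD; by rewrite inE.
move=> x /cov[y yD /= yx]; exists (y, f y) => //; by apply/mapP; exists y.
Qed.

Lemma compact_bdry : open O -> boundedset O -> compact bdry.
Proof.
move=> oO [M OM]; apply: bounded_closed_compact; last first.
  by apply: closedI; [exact: closed_closure|exact: open_closedC].
exists (M + 1); split; first exact: num_real.
move=> M' MM' x [cx _]; have [y Oy yx] := closure_euclP cx ltr01.
apply: (le_trans (norm_le_eucl x)); have := ler_euclD (x - y) y; rewrite subrK euclB.
have := OM y Oy; lra.
Qed.

(** Each chart provides the balls for every radius up to its own bound, so the minimum over a finite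
    cover is a common radius. *)
Lemma uniform_two_balls : open O -> boundedset O -> C11_boundary O ->
  exists2 r0, 0 < r0 & forall x, bdry x -> two_balls r0 x.
Proof.
move=> oO bO Ob.
pose P (x0 : 'rV[R]_n.+1) (r : R) := exists2 r1, 0 < r1 & forall x, bdry x -> eucl (x - x0) < r ->
    forall e, 0 < e <= r1 -> two_balls e x.
have [] := @eucl_finite_cover bdry P (compact_bdry oO bO).
  move=> x0 [cx Ox]; have [r [r0 [Q [QQ [g [gC Og]]]]]] := Ob x0 cx Ox.
  exists (r / 2); split; first by rewrite divr_gt0.
  exact: graph_two_balls Og.
move=> s [sP cov].
suff [r0 r00 hr0] : exists2 r0, 0 < r0 & forall c, c \in s -> forall x, bdry x -> eucl (x - c.1) < c.2 ->
    forall e, 0 < e <= r0 -> two_balls e x.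
  exists r0 => // x bx; have [c cs xc] := cov x bx.
  by apply: (hr0 c cs x bx xc); rewrite r00 lexx.
elim: s sP {cov} => [_|c s IH sP]; first by exists 1.
have [c' c's|r0 r00 hr0] := IH; first by apply: sP; rewrite in_cons c's orbT.
have [c20 [r1 r10 hr1]] := sP c (mem_head _ _).
exists (Num.min r0 r1); first by rewrite lt_min r00.
move=> c'; rewrite in_cons => /predU1P[->|c's] x bx xc e; rewrite le_min => /andP[e0 /andP[er0 er1]].
  by apply: (hr1 x bx xc); rewrite e0.
by apply: (hr0 c' c's x bx xc); rewrite e0.
Qed.

(** A point of the segment from [y] towards [x], other than [y], is closer to [x] than [distc O x],
    hence lies in [O]. *)
Lemma bdry_nearest x y : O x -> ~ O y -> distc O x = eucl (x - y) -> bdry y.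
Proof.
move=> Ox Oy E; split => // A /nbhs_euclP[e e0 yA].
have xy0 : 0 < eucl (x - y).
  rewrite eucl_gt0 subr_eq0; apply/eqP => xy; by apply: Oy; rewrite -xy.
pose t := Num.min 1 (e / (2 * eucl (x - y))).
have t0 : 0 < t by rewrite lt_min ltr01 divr_gt0// mulr_gt0.
have t1 : t <= 1 by rewrite ge_min lexx.
exists (y + t *: (x - y)); split.
  apply: contrapT => Oz; have := distc_le x Oz; rewrite E.
  rewrite (_ : x - (y + t *: (x - y)) = (1 - t) *: (x - y)); last first.
    by rewrite scalerBl scale1r opprD addrA.
  rewrite euclZ ger0_norm ?subr_ge0// mulrBl mul1r.
  have : 0 < t * eucl (x - y) by rewrite mulr_gt0.
  lra.
apply: yA => /=; rewrite addrAC subrr add0r euclZ gtr0_norm//.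
apply: (@le_lt_trans _ _ (e / 2)); last by lra.
apply: (@le_trans _ _ (e / (2 * eucl (x - y)) * eucl (x - y))).
  by rewrite ler_wpM2r ?eucl_ge0// ge_min lexx orbT.
by rewrite le_eqVlt; apply/orP; left; apply/eqP; field; rewrite gt_eqF.
Qed.

(** The balls touch at the point [y] nearest to [x]. Once the normal at [y] is known to point
    towards [x], their centres can be written from [x], at the distances [r0 - d] and [r0 + d]. *)
Lemma tangent_balls : open O -> (~` O) !=set0 -> boundedset O -> C11_boundary O ->
  exists2 r0, 0 < r0 & forall x, O x -> distc O x < r0 -> exists v : 'rV[R]_n.+1,
    [/\ eucl v = 1, forall y, eucl (y - (x + (r0 - distc O x) *: v)) < r0 -> O y &
     forall y, eucl (y - (x - (r0 + distc O x) *: v)) < r0 -> ~ O y].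
Proof.
move=> oO neO bO Ob; have [r0 r00 hr0] := uniform_two_balls oO bO Ob.
exists r0 => // x Ox dr; have [y Oy E] := distc_nearest oO neO x.
set d := distc O x in dr E *.
have d0 : 0 < d by exact: distc_gt0.
have [v [v1 vin vout]] := hr0 y (bdry_nearest Ox Oy E).
have h := distc_ball_le r00 vout Ox; rewrite -/d in h.
pose w := d^-1 *: (x - y).
have w1 : eucl w = 1 by rewrite /w euclZ -E ger0_norm ?invr_ge0 ?(ltW d0)// mulVf ?gt_eqF.
have xE : x = y + d *: w.
  by rewrite /w scalerA mulfV ?gt_eqF// scale1r addrC subrK.
clearbody w; have wv : w = v.
  (* The exterior ball keeps [x] at distance at least [d + r0] from its centre. This is the equality
     case of the triangle inequality, which forces [w = v]. *)
  have h2 : (d + r0) ^+ 2 <= eucl (d *: w + r0 *: v) ^+ 2.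
    rewrite lerXn2r ?nnegrE ?eucl_ge0 ?addr_ge0 ?(ltW d0) ?(ltW r00)//.
    have -> : d *: w + r0 *: v = x - (y - r0 *: v) by rewrite xE; apply/rowP => i; rewrite !mxE; ring.
    lra.
  rewrite [in X in _ <= X]sqr_eucl !(dotvDl,dotvDr,dotvZl,dotvZr) -!sqr_eucl w1 v1 (dotvC v w) in h2.
  have h3 : 1 <= dotv w v.
    rewrite -(ler_pM2l (_ : 0 < 2 * d * r0)) ?mulr_gt0//; lra.
  apply/eqP; rewrite -subr_eq0 -eucl_eq0 -sqrf_eq0 sqr_eucl !(dotvBl,dotvBr) -!sqr_eucl w1 v1 (dotvC v w).
  rewrite eq_le; apply/andP; split; first by lra.
  by have := sqr_ge0 (eucl (w - v)); rewrite sqr_eucl !(dotvBl,dotvBr) -!sqr_eucl w1 v1 (dotvC v w); lra.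
rewrite wv in xE; exists v; split => // z hz.
  apply: vin; rewrite (_ : y + r0 *: v = x + (r0 - d) *: v)// xE; apply/rowP => i; rewrite !mxE; ring.
apply: vout; rewrite (_ : y - r0 *: v = x - (r0 + d) *: v)// xE; apply/rowP => i; rewrite !mxE; ring.
Qed.

End Graph.

(** * The half-line *)

Section MeasurableJreg.
Set Implicit Arguments. Unset Strict Implicit.
Context {R : realType} d (T : measurableType d).

Lemma measurable_jreg (q h : R) (f g : T -> R) : measurable_fun setT f -> measurable_fun setT g ->
  measurable_fun setT (fun t => jreg q h (f t) (g t)).
Proof. by move=> mf mg; rewrite /jreg /wreg; mfun. Qed.

End MeasurableJreg.

Section HalfLine.
Set Implicit Arguments. Unset Strict Implicit.
Context {R : realType}.
Local Notation leb := (@lebesgue_measure R).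

Lemma is_derive_onemV (x : R) : x < 1 ->
  is_derive x 1 (fun y : R => (1 - y)^-1 - 1) ((1 - x)^-1 * (1 - x)^-1).
Proof.
move=> x1; have n0 : 1 - x != 0 by rewrite subr_eq0 gt_eqF.
have h1 : is_derive x 1 (fun y : R => 1 - y) (-1).
  have : is_derive x (1 : R) (cst (1 : R) - id) (0 - 1) by exact: is_deriveB.
  by rewrite sub0r.
have h2 : is_derive x (1 : R) (fun y : R => (1 - y)^-1) (- (1 - x) ^- 2 *: (-1)).
  exact: (@is_deriveV R (fun y : R => 1 - y) x (-1) 1 n0 h1).
have : is_derive x (1 : R) ((fun y : R => (1 - y)^-1) - cst 1) (- (1 - x) ^- 2 *: (-1) - 0).
  exact: is_deriveB.
by rewrite subr0 /GRing.scale/= mulrN1 opprK -exprVn expr2.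
Qed.

(** The map [t -> 1/(1-t) - 1] carries (0,1) onto the positive half-line. The substitution is made
    on compact intervals and passed to the limit by monotone convergence. *)
Lemma integral_inversion (G : R -> R) : (forall x, 0 < x -> {for x, continuous G}) ->
  (forall x, 0 < x -> 0 <= G x) ->
  (\int[leb]_(x in `]0%R, +oo[%classic) (G x)%:E =
   \int[leb]_(x in `]0%R, 1%R[%classic) (G ((1 - x)^-1 - 1) * ((1 - x)^-1 * (1 - x)^-1))%:E)%E.
Proof.
move=> cG G0; pose F (x : R) := (1 - x)^-1 - 1; pose F' (x : R) := (1 - x)^-1 * (1 - x)^-1.
(* These end points are chosen because [F] sends them to [1/(k+1)] and [k+1]. *)
pose a (k : nat) : R := k.+2%:R^-1; pose b (k : nat) : R := 1 - k.+2%:R^-1.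
pose D k : set R := `[a k, b k]%classic; pose E k : set R := `[k.+1%:R^-1, k.+1%:R]%classic.
have a0 k : 0 < a k by rewrite invr_gt0.
have b1 k : b k < 1 by rewrite gtrBl invr_gt0.
have ab k : a k <= b k.
  have : a k <= 2^-1 by rewrite lef_pV2 ?posrE// ler_nat.
  by rewrite /b -/(a k); lra.
have Fa k : F (a k) = k.+1%:R^-1.
  have k2 : k.+2%:R != 0 :> R by rewrite pnatr_eq0.
  have k1 : k.+1%:R != 0 :> R by rewrite pnatr_eq0.
  have E1 : 1 - (k.+2%:R)^-1 = k.+1%:R / k.+2%:R :> R.
    by rewrite -[X in X - _](mulfV k2) -[k.+2%:R](natr1 k.+1) -[X in _ - X]mul1r -mulrBl addrK.
  rewrite /F /a E1 invfM invrK -[X in _ - X](mulVf k1) -mulrBr -natrB//.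
  by rewrite subSnn mulr1.
have Fb k : F (b k) = k.+1%:R.
  by rewrite /F /b opprB addrCA subrr addr0 invrK -(natr1 k.+1) addrK.
have Fmono : forall x y : R, x < y -> y < 1 -> F x < F y.
  move=> x y xy y1; rewrite /F ltrD2r ltf_pV2 ?posrE ?subr_gt0//; last exact: lt_trans y1.
  by rewrite ltrD2l ltrN2.
have dF (x : R) : x < 1 -> is_derive x 1 F (F' x) by exact: is_derive_onemV.
have F'E (x : R) : x < 1 -> derive1 F x = F' x.
  by move=> /dF h; rewrite derive1E; exact: derive_val.
have cF' (x : R) : x < 1 -> F' y @[y --> x] --> F' x.
  move=> x1; have n0 : 1 - x != 0 by rewrite subr_eq0 gt_eqF.
  by apply: cvgM; apply: cvgV => //; apply: cvgB => //; exact: cvg_cst.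
have cDF (x : R) : x < 1 -> derive1 F y @[y --> x] --> F' x.
  move=> x1; apply: cvg_trans (cF' x x1); apply: near_eq_cvg.
  near=> y; rewrite F'E//; near: y; exact: lt_nbhsl.
have cF (x : R) : x < 1 -> F y @[y --> x] --> F x.
  move=> x1; have h := dF x x1.
  by apply: differentiable_continuous; apply/derivable1_diffP; exact: ex_derive.
have DE k : (\int[leb]_(x in E k) (G x)%:E = \int[leb]_(x in D k) (G (F x) * F' x)%:E)%E.
  rewrite /E -Fa -Fb; rewrite (@integration_by_substitution_increasing _ F G (a k) (b k)).
  - apply: eq_integral => x; rewrite inE /= in_itv/= => /andP[_ xb].
    have x1 : x < 1 := le_lt_trans xb (b1 k).
    by have -> : ((G \o F) * derive1 F) x = G (F x) * F' x by rewrite -(F'E x x1).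
  - exact: ab.
  - move=> x y; rewrite !in_itv/= => /andP[_ xb] /andP[_ yb] xy.
    by apply: Fmono => //; exact: le_lt_trans (b1 k).
  - move=> x; rewrite in_itv/= => /andP[_ xb].
    have x1 : x < 1 := lt_trans xb (b1 k).
    by rewrite /continuous_at F'E//; exact: cDF.
  - apply/cvg_ex; exists (F' (a k)); apply: cvg_at_right_filter; apply: cDF.
    exact: le_lt_trans (ab k) (b1 k).
  - by apply/cvg_ex; exists (F' (b k)); apply: cvg_at_left_filter; apply: cDF.
  - split.
    + move=> x; rewrite in_itv/= => /andP[_ xb].
      by apply: (@ex_derive _ _ _ _ _ _ (F' x)); apply: dF; exact: lt_trans (b1 k).
    + by apply: cvg_at_right_filter; apply: cF; exact: le_lt_trans (ab k) (b1 k).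
    + by apply: cvg_at_left_filter; exact: cF.
  - apply: continuous_in_subspaceT => x; rewrite inE /= in_itv/= Fa => /andP[xk _].
    by apply: cG; apply: lt_le_trans xk; rewrite invr_gt0.
have E0 k x : E k x -> 0 < x.
  by rewrite /E/= in_itv/= => /andP[+ _]; apply: lt_le_trans; rewrite invr_gt0.
have D01 k x : D k x -> 0 < x < 1.
  rewrite /D/= in_itv/= => /andP[ax xb].
  by rewrite (lt_le_trans (a0 k) ax) (le_lt_trans xb (b1 k)).
have UE : \bigcup_k E k = `]0, +oo[%classic.
  apply/seteqP; split => [x [k _ /E0 x0]|x]; rewrite /= in_itv/= andbT// => x0.
  have [k kx] : exists k : nat, Num.max x x^-1 <= k%:R.
    by exists (Num.truncn (Num.max x x^-1)).+1; apply: ltW; exact: Num.Theory.truncnS_gt.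
  move: kx; rewrite ge_max => /andP[xk xk'].
  have kk : k%:R <= k.+1%:R :> R by rewrite ler_nat.
  exists k => //; rewrite /E/= in_itv/=; apply/andP; split; last exact: le_trans kk.
  by rewrite -[leRHS]invrK lef_pV2 ?posrE ?invr_gt0//; exact: le_trans kk.
have UD : \bigcup_k D k = `]0, 1[%classic.
  apply/seteqP; split => [x [k _ /D01]|x]; rewrite /= in_itv/=// => /andP[x0 x1].
  have y0 : 0 < 1 - x by rewrite subr_gt0.
  have [k kx] : exists k : nat, Num.max x^-1 (1 - x)^-1 <= k%:R.
    by exists (Num.truncn (Num.max x^-1 (1 - x)^-1)).+1; apply: ltW; exact: Num.Theory.truncnS_gt.
  move: kx; rewrite ge_max => /andP[xk xk'].
  have kk : k%:R <= k.+2%:R :> R by rewrite ler_nat leqW.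
  exists k => //; rewrite /D/= in_itv/=; apply/andP; split.
    by rewrite -[leRHS]invrK lef_pV2 ?posrE ?invr_gt0//; exact: le_trans kk.
  rewrite /b lerBrDr addrC -lerBrDr -[leRHS]invrK lef_pV2 ?posrE ?invr_gt0//; exact: le_trans kk.
have ndE : {homo E : n m / (n <= m)%N >-> (n <= m)%O}.
  move=> n m nm; apply/subsetPset => x; rewrite /E/= !in_itv/= => /andP[h1 h2].
  apply/andP; split; last by rewrite (le_trans h2)// ler_nat.
  by rewrite (le_trans _ h1)// lef_pV2 ?posrE// ler_nat.
have ndD : {homo D : n m / (n <= m)%N >-> (n <= m)%O}.
  move=> n m nm; apply/subsetPset => x; rewrite /D/= !in_itv/= => /andP[h1 h2].
  have le : a m <= a n by rewrite /a lef_pV2 ?posrE// ler_nat.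
  apply/andP; split; first exact: le_trans h1.
  by rewrite (le_trans h2)// /b lerD2l lerN2.
have mE k : measurable (E k) by exact: measurable_itv.
have mD k : measurable (D k) by exact: measurable_itv.
have mG k : measurable_fun (E k) (EFin \o G).
  apply/measurable_EFinP.
  have sub : E k `<=` `]0, +oo[%classic by move=> x /E0 x0; rewrite /= in_itv/= andbT.
  apply: (measurable_funS _ sub) => //.
  apply: open_continuous_measurable_fun => // x; rewrite inE/= in_itv/= andbT; exact: cG.
have mGF k : measurable_fun (D k) (fun x => (G (F x) * F' x)%:E).
  apply/measurable_EFinP.
  have sub : D k `<=` `]0, 1[%classic by move=> x /D01; rewrite /= in_itv/=.
  apply: (measurable_funS _ sub) => //.
  apply: open_continuous_measurable_fun => // x; rewrite inE/= in_itv/= => /andP[x0 x1].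
  apply: cvgM; last exact: cF'.
  apply: continuous_comp; first exact: cF.
  apply: cG; have := Fmono 0 x x0 x1; by rewrite /F subr0 invr1 subrr.
have GE k x : E k x -> (0 <= (EFin \o G) x)%E by move=> /E0 x0; rewrite lee_fin G0.
have GD k x : D k x -> (0 <= (G (F x) * F' x)%:E)%E.
  move=> /D01/andP[x0 x1]; rewrite lee_fin mulr_ge0//; last by rewrite mulr_ge0 ?invr_ge0 ?subr_ge0 ?ltW.
  by apply: G0; have := Fmono 0 x x0 x1; rewrite /F subr0 invr1 subrr.
have c1 := @ge0_nondecreasing_set_cvg_integral _ (measurableTypeR R) R E (EFin \o G) leb ndE mE mG GE.
have c2 := @ge0_nondecreasing_set_cvg_integral _ (measurableTypeR R) R D (fun x => (G (F x) * F' x)%:E) leb ndD mD mGF GD.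
rewrite UE in c1; rewrite UD in c2.
have DE' : (fun k => \int[leb]_(x in D k) (G (F x) * F' x)%:E)%E = (fun k => \int[leb]_(x in E k) (G x)%:E)%E.
  by apply/funext => k; rewrite DE.
rewrite DE' in c2; exact: (cvg_unique _ c1 c2).
Unshelve. all: by end_near. Qed.

Context (s p : R) (s0 : 0 < s) (s1 : s < 1) (p1 : 1 < p).
Let q := p - 1.
Let q0 : 0 < q. Proof. by rewrite subr_gt0. Qed.

(* [p s theta] is the derivative of [(1 - (1-x)^s)^p x^(-ps)]. *)
Let theta (x : R) : R := x `^ (- (p * s) - 1) * (((1 - x) `^ (s - 1) - 1) * (1 - (1 - x) `^ s) `^ q).

Lemma onem_powR_bounds (x : R) : 0 < x -> x < 1 ->
  [/\ 0 < 1 - (1 - x) `^ s, 1 - (1 - x) `^ s <= x & 0 <= (1 - x) `^ (s - 1) - 1].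
Proof.
move=> x0 x1; have y0 : 0 < 1 - x by rewrite subr_gt0.
have y1 : 1 - x < 1 by lra.
split.
- have : (1 - x) `^ s < 1 `^ s by apply: gt0_ltr_powR; rewrite ?nnegrE ?ler01 ?(ltW y0).
  by rewrite powR1 subr_gt0.
- have := @powR_mul_le _ (1 - x) 1 s (ltW y0) (ltW y1) ltr01 (ltW s1) s0.
  by rewrite powR1 mulr1; lra.
- have : 1 `^ (s - 1) <= (1 - x) `^ (s - 1) by apply: le0_powR; rewrite ?subr_le0 ?(ltW s1) ?(ltW y1).
  by rewrite powR1 subr_ge0.
Qed.

Lemma theta_ge0 x : 0 < x -> x < 1 -> 0 <= theta x.
Proof.
move=> x0 x1; have [_ _ h] := onem_powR_bounds x0 x1.
by rewrite /theta mulr_ge0 ?powR_ge0// mulr_ge0 ?powR_ge0.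
Qed.

Lemma continuous_onem (k x : R) : x < 1 -> {for x, continuous (fun y : R => (1 - y) `^ k)}.
Proof.
move=> x1; apply: (@continuous_comp _ _ _ (fun y : R => 1 - y) (fun y => y `^ k)).
  by apply: cvgB => //; exact: cvg_cst.
by apply: continuous_powR; rewrite subr_gt0.
Qed.

Lemma continuous_theta x : 0 < x -> x < 1 -> {for x, continuous theta}.
Proof.
move=> x0 x1; have [u0 _ _] := onem_powR_bounds x0 x1.
apply: cvgM; first exact: continuous_powR.
apply: cvgM; first by apply: cvgB; [exact: continuous_onem|exact: cvg_cst].
apply: (@continuous_comp _ _ _ (fun y : R => 1 - (1 - y) `^ s) (fun y => y `^ q)).
  by apply: cvgB; [exact: cvg_cst|exact: continuous_onem].
exact: continuous_powR.
Qed.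

(** The value is also that of the integral of [x^(-ps-1)] over the half-line from 1, the
    contribution of the points where the profile is 0. This coincidence makes the limit in
    [halfline_limit] vanish. *)
Lemma integral_theta : (\int[leb]_(x in `]0%R, 1%R[%classic) (theta x)%:E = ((p * s)^-1)%:E)%E.
Proof.
have p0 : 0 < p := lt_trans ltr01 p1.
have a0 : 0 < p * s by rewrite mulr_gt0.
pose u (x : R) := 1 - (1 - x) `^ s.
pose Psi (x : R) := (p * s)^-1 * (u x `^ p * x `^ (- (p * s))).
rewrite (@ge0_FTC_oo _ theta Psi 0 1 0 (p * s)^-1) ?subr0//.
- by move=> x; rewrite in_itv/= => /andP[]; exact: theta_ge0.
- by move=> x; rewrite in_itv/= => /andP[]; exact: continuous_theta.
- move=> x; rewrite in_itv/= => /andP[x0 x1].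
  have [u0 _ _] := onem_powR_bounds x0 x1.
  have y0 : 0 < 1 - x by rewrite subr_gt0.
  have h1 : is_derive x 1 (fun y : R => 1 - y) (-1).
    have : is_derive x (1 : R) (cst (1 : R) - id) (0 - 1) by exact: is_deriveB.
    by rewrite sub0r.
  have hs : is_derive x 1 (fun y : R => (1 - y) `^ s) (- (s * (1 - x) `^ (s - 1))).
    have hp : is_derive (1 - x) 1 (fun y : R => y `^ s) (s * (1 - x) `^ (s - 1)) by exact: is_derive_powR.
    have := @is_derive1_comp _ (fun y : R => y `^ s) (fun y : R => 1 - y) x _ _ hp h1.
    by rewrite mulrN1.
  have hu : is_derive x 1 u (s * (1 - x) `^ (s - 1)).
    have : is_derive x (1 : R) (cst (1 : R) - (fun y : R => (1 - y) `^ s)) (0 - - (s * (1 - x) `^ (s - 1))) by exact: is_deriveB.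
    by rewrite sub0r opprK.
  have hup : is_derive x 1 (fun y => u y `^ p) ((s * (1 - x) `^ (s - 1)) * (p * u x `^ q)).
    have hp : is_derive (u x) 1 (fun y : R => y `^ p) (p * u x `^ (p - 1)) by exact: is_derive_powR.
    have := @is_derive1_comp R (fun y : R => y `^ p) u x _ _ hp hu.
    by rewrite mulrC.
  have hx : is_derive x 1 (fun y : R => y `^ (- (p * s))) (- (p * s) * x `^ (- (p * s) - 1)) by exact: is_derive_powR.
  have hm := is_deriveM hup hx.
  have hZ : is_derive x 1 ((p * s)^-1 *: ((fun y => u y `^ p) * (fun y : R => y `^ (- (p * s)))))
      ((p * s)^-1 *: (u x `^ p *: (- (p * s) * x `^ (- (p * s) - 1)) + x `^ (- (p * s)) *: ((s * (1 - x) `^ (s - 1)) * (p * u x `^ q)))).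
    exact: is_deriveZ.
  apply: is_derive_eq hZ _; rewrite /GRing.scale/= /theta -/(u x).
  have -> : x `^ (- (p * s)) = x * x `^ (- (p * s) - 1) by rewrite -powR_split.
  have -> : u x `^ p = u x * u x `^ q by rewrite -powR_split.
  have e1 : (1 - x) `^ s = (1 - x) * (1 - x) `^ (s - 1) by rewrite -powR_split.
  rewrite {1}/u e1; field; apply/andP; split; rewrite gt_eqF//; lra.
(* At 0, [u x <= x] bounds the primitive by a multiple of [x^(p - ps)], whose exponent is positive
   as [s < 1]. *)
- apply: (@squeeze_cvgr _ _ _ _ (cst 0) (fun x => (p * s)^-1 * x `^ (p - p * s))); last 2 first.
  + exact: cvg_cst.
  + rewrite -[X in _ --> X](mulr0 (p * s)^-1); apply: cvgM; first exact: cvg_cst.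
    apply: powR_cvg0; rewrite -{1}(mulr1 p) -mulrBr mulr_gt0 ?subr_gt0//; lra.
  near=> x; have x0 : 0 < x by [].
  have x1 : x < 1 by near: x; exact: nbhs_right_lt.
  have [u0 ux _] := onem_powR_bounds x0 x1.
  rewrite /Psi !mulr_ge0 ?invr_ge0 ?powR_ge0 ?(ltW a0)//= ler_wpM2l ?invr_ge0 ?(ltW a0)//.
  rewrite powR_addp// ler_wpM2r ?powR_ge0// ge0_ler_powR ?nnegrE ?(ltW u0) ?(ltW x0)//; lra.
- rewrite -[X in _ --> X]mulr1; apply: cvgM; first exact: cvg_cst.
  rewrite -[X in _ --> X]mulr1; apply: cvgM; last first.
    rewrite -[X in _ --> X](_ : 1 `^ (- (p * s)) = 1); last by rewrite powR1.
    by apply: cvg_at_left_filter; exact: continuous_powR.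
  rewrite -[X in _ --> X](_ : 1 `^ p = 1); last by rewrite powR1.
  apply: (@continuous_cvg _ _ _ _ _ u (fun y => y `^ p)); first exact: continuous_powR.
  rewrite -[X in _ --> X]subr0; apply: cvgB; first exact: cvg_cst.
  apply/cvgrPdist_lt => e e0.
  have e'0 : 0 < e `^ s^-1 by rewrite powR_gt0.
  near=> x; have x1 : x < 1 by [].
  have y0 : 0 < 1 - x by rewrite subr_gt0.
  have ye : 1 - x < e `^ s^-1 by near: x; exact: nbhs_left_ltBl.
  rewrite sub0r normrN ger0_norm ?powR_ge0//.
  have -> : e = (e `^ s^-1) `^ s by rewrite -powRrM mulVf ?gt_eqF// powRr1// ltW.
  by apply: gt0_ltr_powR; rewrite ?nnegrE ?powR_ge0 ?(ltW y0).
Unshelve. all: by end_near. Qed.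

Let al := p * s.
Let p0 : 0 < p. Proof. exact: lt_trans ltr01 p1. Qed.

Let al0 : 0 < al. Proof. by rewrite mulr_gt0. Qed.

Lemma jreg1_onem h x : 0 < x -> x < 1 ->
  jreg q h 1 ((1 - x) `^ s) = (1 - (1 - x) `^ s) `^ q * wreg h 1 ((1 - x) `^ s).
Proof.
move=> x0 x1; have [u0 _ _] := onem_powR_bounds x0 x1.
by rewrite /jreg spow_ge0 // ltW.
Qed.

(** [Xi] is the part common to the two half-line integrals; its integral may diverge as [h] tends to
    0, but it cancels in their difference. [Yi] is what remains of the outer integral, and it is
    dominated by [theta]. *)
Let Xi h (x : R) := x `^ (- al - 1) * jreg q h 1 ((1 - x) `^ s).
Let Yi h (x : R) := theta x * wreg h 1 ((1 - x) `^ s).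

Let wreg01 (h x : R) : 0 < h -> 0 <= wreg h 1 ((1 - x) `^ s) <= 1.
Proof. by move=> h0; rewrite wreg_ge0 ?wreg_le1 ?powR_ge0. Qed.

Let continuous_wreg (h x : R) : 0 < h -> 0 < x -> x < 1 -> {for x, continuous (fun y : R => wreg h 1 ((1 - y) `^ s))}.
Proof.
move=> h0 x0 x1; have [u0 _ _] := onem_powR_bounds x0 x1.
have c1 : {for x, continuous (fun y : R => `|1 - (1 - y) `^ s|)}.
  apply: (@continuous_comp _ _ _ (fun y : R => 1 - (1 - y) `^ s) (fun y : R => `|y|)).
    by apply: cvgB; [exact: cvg_cst|exact: continuous_onem].
  exact: norm_continuous.
apply: cvgM; first exact: c1.
apply: cvgV.
  rewrite gt_eqF// addr_gt0 ?mulr_gt0 ?normr_gt0 ?gt_eqF//.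
  by rewrite ltr_pwDl// powR_ge0.
apply: cvgD; first exact: c1.
apply: cvgM; first exact: cvg_cst.
by apply: cvgD; [exact: cvg_cst|exact: continuous_onem].
Qed.

Let measurable01 (f : R -> R) : (forall x, 0 < x -> x < 1 -> {for x, continuous f}) ->
  measurable_fun (`]0%R, 1%R[%classic : set (measurableTypeR R)) (EFin \o f).
Proof.
move=> cf; apply/measurable_EFinP; apply: open_continuous_measurable_fun => //.
by move=> x; rewrite inE/= in_itv/= => /andP[]; exact: cf.
Qed.

Let mtheta : measurable_fun (`]0%R, 1%R[%classic : set (measurableTypeR R)) (EFin \o theta).
Proof. by apply: measurable01 => x; exact: continuous_theta. Qed.

Let mYi (h : R) : 0 < h -> measurable_fun (`]0%R, 1%R[%classic : set (measurableTypeR R)) (EFin \o Yi h).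
Proof.
move=> h0; apply: measurable01 => x x0 x1.
by apply: cvgM; [exact: continuous_theta|exact: continuous_wreg].
Qed.

Let mXi (h : R) : 0 < h -> measurable_fun (`]0%R, 1%R[%classic : set (measurableTypeR R)) (EFin \o Xi h).
Proof.
move=> h0; apply: (eq_measurable_fun (fun x => (x `^ (- al - 1) * ((1 - (1 - x) `^ s) `^ q * wreg h 1 ((1 - x) `^ s)))%:E)).
  by move=> x; rewrite inE/= in_itv/= => /andP[x0 x1]; rewrite /Xi jreg1_onem.
apply: measurable01 => x x0 x1; have [u0 _ _] := onem_powR_bounds x0 x1.
apply: cvgM; first exact: continuous_powR.
apply: cvgM; last exact: continuous_wreg.
apply: (@continuous_comp _ _ _ (fun y : R => 1 - (1 - y) `^ s) (fun y => y `^ q)).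
  by apply: cvgB; [exact: cvg_cst|exact: continuous_onem].
exact: continuous_powR.
Qed.

Let Xi_ge0 (h x : R) : 0 < h -> 0 < x -> x < 1 -> 0 <= Xi h x.
Proof.
move=> h0 x0 x1; rewrite /Xi jreg1_onem// mulr_ge0 ?powR_ge0// mulr_ge0 ?powR_ge0//.
by have /andP[] := wreg01 x h0.
Qed.

Let Yi_ge0 (h x : R) : 0 < h -> 0 < x -> x < 1 -> 0 <= Yi h x.
Proof.
move=> h0 x0 x1; rewrite /Yi mulr_ge0 ?theta_ge0//.
by have /andP[] := wreg01 x h0.
Qed.

Let Yi_le (h x : R) : 0 < h -> 0 < x -> x < 1 -> Yi h x <= theta x.
Proof.
move=> h0 x0 x1; rewrite /Yi ler_piMr ?theta_ge0//.
by have /andP[] := wreg01 x h0.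
Qed.

Let Xint h := (\int[leb]_(x in `]0%R, 1%R[%classic) (Xi h x)%:E)%E.
Let Yint h := (\int[leb]_(x in `]0%R, 1%R[%classic) (Yi h x)%:E)%E.

(** For fixed [h] the gain in [jreg_le_reg] bounds [Xi] by a multiple of [x^(p - ps - 1)]. *)
Let Xint_fin h : 0 < h -> Xint h \is a fin_num.
Proof.
move=> h0; have pal : 0 < p - al by rewrite /al -{1}(mulr1 p) -mulrBr mulr_gt0 ?subr_gt0.
have mono (x : R) : `]0%R, 1%R[%classic x -> ((Xi h x)%:E <= h^-1%:E * (x `^ (p - al - 1))%:E)%E.
  rewrite /= in_itv/= => /andP[x0 x1]; have [u0 ux _] := onem_powR_bounds x0 x1.
  rewrite -EFinM lee_fin /Xi.
  have := @jreg_le_reg _ q h 1 ((1 - x) `^ s) ltr01 (powR_ge0 _ _) h0 q0.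
  rewrite mulr1 (gtr0_norm u0) subrK => jl.
  have -> : p - al - 1 = (- al - 1) + p by ring.
  have -> : h^-1 * x `^ (- al - 1 + p) = x `^ (- al - 1) * (h^-1 * x `^ p) by rewrite powR_addp//; ring.
  rewrite ler_wpM2l ?powR_ge0//.
  apply: (le_trans (ler_norm _)); apply: (le_trans jl).
  rewrite mulrC ler_wpM2l ?invr_ge0 ?(ltW h0)// ge0_ler_powR ?nnegrE ?(ltW p0) ?(ltW u0) ?(ltW x0)//.
rewrite ge0_fin_numE; last first.
  by apply: integral_ge0 => x; rewrite /= in_itv/= => /andP[x0 x1]; rewrite lee_fin Xi_ge0.
apply: (@le_lt_trans _ _ (\int[leb]_(x in `]0%R, 1%R[%classic) (h^-1%:E * (x `^ (p - al - 1))%:E))%E).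
  apply: ge0_le_integral => //.
  - by move=> x; rewrite /= in_itv/= => /andP[x0 x1]; rewrite lee_fin Xi_ge0.
  - exact: mXi.
  - apply: measurable_funTS; apply/measurable_EFinP; apply: measurable_funM => //; exact: measurable_powR.
rewrite ge0_integralZl_EFin//.
- by rewrite integral_powR_head// -EFinM ltry.
- by move=> x _; rewrite lee_fin powR_ge0.
- by apply: measurable_funTS; apply/measurable_EFinP; exact: measurable_powR.
- by rewrite invr_ge0 ltW.
Qed.

Let Yint_fin h : 0 < h -> Yint h \is a fin_num.
Proof.
move=> h0; rewrite ge0_fin_numE; last first.
  by apply: integral_ge0 => x; rewrite /= in_itv/= => /andP[x0 x1]; rewrite lee_fin Yi_ge0.
apply: (@le_lt_trans _ _ (\int[leb]_(x in `]0%R, 1%R[%classic) (theta x)%:E)%E); last first.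
  by rewrite integral_theta ltry.
apply: ge0_le_integral => //.
- by move=> x; rewrite /= in_itv/= => /andP[x0 x1]; rewrite lee_fin Yi_ge0.
- exact: mYi.
- by move=> x; rewrite /= in_itv/= => /andP[x0 x1]; rewrite lee_fin Yi_le.
Qed.

Let Yint_cvg : Yint k.+1%:R^-1 @[k --> \oo] --> (al^-1)%:E.
Proof.
rewrite -integral_theta.
have h0 k : 0 < k.+1%:R^-1 :> R by rewrite invr_gt0.
apply: (@dominated_cvg _ (measurableTypeR R) R leb `]0%R, 1%R[%classic _ (fun k x => (Yi k.+1%:R^-1 x)%:E) _ (EFin \o theta)).
- by [].
- by move=> k; exact: mYi.
- move=> x; rewrite /= in_itv/= => /andP[x0 x1].
  apply: cvg_EFin; first by near=> k.
  rewrite -[X in _ --> X]mulr1; apply: cvgM; first exact: cvg_cst.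
  have [u0 _ _] := onem_powR_bounds x0 x1.
  by apply: cvg_wreg; rewrite gt_eqF// -subr_gt0.
- by move=> x _.
- apply/integrableP; split; first exact: mtheta.
  have -> : (\int[leb]_(x in `]0%R, 1%R[%classic) `|(EFin \o theta) x| = \int[leb]_(x in `]0%R, 1%R[%classic) (theta x)%:E)%E.
    apply: eq_integral => x; rewrite inE/= in_itv/= => /andP[x0 x1].
    by rewrite ger0_norm ?theta_ge0.
  by rewrite integral_theta ltry.
- move=> k x; rewrite /= in_itv/= => /andP[x0 x1].
  by rewrite lee_fin ger0_norm ?Yi_ge0 ?Yi_le.
Unshelve. all: by end_near. Qed.

(** [Pint] collects the points where the profile is below its value 1 at the base point, [Nint]
    those where it is above, with the sign reversed. Both are integrals of nonnegative functions. *)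
Let Pint h := (\int[leb]_x ((0 < x)%R%:R * x `^ (- al - 1) * jreg q h 1 ((Num.max 0 (1 - x)) `^ s))%:E)%E.
Let Nint h := (\int[leb]_x ((0 < x)%R%:R * x `^ (- al - 1) * jreg q h ((Num.max 0 (1 + x)) `^ s) 1)%:E)%E.

Let indic01 (x : R) : \1_(`]0%R, 1%R[%classic) x = ((0 < x) && (x < 1))%:R :> R.
Proof.
rewrite indicE; congr (nat_of_bool _)%:R; apply/idP/idP.
  by rewrite inE/= in_itv.
by move=> h; rewrite inE/= in_itv.
Qed.

(* The substitution [x = t/(1-t)], that is [1 + x = 1/(1-t)], turns the outer integral into one over [(0,1)]; homogeneity of [jreg] then produces the weight [(1-t)^(s-1)] in place of [1]. *)
Let NintE h : 0 < h -> Nint h = (Xint h + Yint h)%E.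
Proof.
move=> h0.
pose B (x : R) := (1 + x) `^ s - 1.
pose G (x : R) := x `^ (- al - 1) * (B x `^ q * (B x / (B x + h * (B x + 2)))).
have B0 (x : R) : 0 < x -> 0 < B x.
  move=> x0; have : 1 `^ s < (1 + x) `^ s by apply: gt0_ltr_powR; rewrite ?nnegrE ?ler01 ?ltrDl ?addr_ge0 ?(ltW x0).
  by rewrite powR1 subr_gt0.
have GE (x : R) : 0 < x -> x `^ (- al - 1) * jreg q h ((Num.max 0 (1 + x)) `^ s) 1 = G x.
  move=> x0; have -> : Num.max 0 (1 + x) = 1 + x by apply/max_idPr; lra.
  have E1 : spow ((1 + x) `^ s - 1) q = B x `^ q by rewrite spow_ge0// ltW// B0.
  have E2 : `|(1 + x) `^ s - 1| = B x by rewrite ger0_norm// ltW// B0.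
  rewrite /G /jreg /wreg E1 E2.
  by have -> : (1 + x) `^ s + 1 = B x + 2 by rewrite /B; ring.
have G0 (x : R) : 0 < x -> 0 <= G x.
  move=> x0; have b0 := B0 x x0.
  rewrite !mulr_ge0 ?powR_ge0 ?(ltW b0)// invr_ge0 addr_ge0 ?(ltW b0)// mulr_ge0 ?(ltW h0)// addr_ge0// ltW//.
have cB (x : R) : 0 < x -> {for x, continuous B}.
  move=> x0; apply: cvgB; last exact: cvg_cst.
  apply: (@continuous_comp _ _ _ (fun y : R => 1 + y) (fun y => y `^ s)).
    by apply: cvgD; [exact: cvg_cst|exact: cvg_id].
  by apply: continuous_powR; lra.
have cG (x : R) : 0 < x -> {for x, continuous G}.
  move=> x0; have b0 := B0 x x0.
  have d0 : 0 < B x + h * (B x + 2) by rewrite addr_gt0// mulr_gt0// addr_gt0.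
  apply: cvgM; first exact: continuous_powR.
  apply: cvgM.
    apply: (@continuous_comp _ _ _ B (fun y => y `^ q)); first exact: cB.
    exact: continuous_powR.
  apply: cvgM; first exact: cB.
  apply: cvgV; first by rewrite gt_eqF.
  apply: cvgD; first exact: cB.
  apply: cvgM; first exact: cvg_cst.
  by apply: cvgD; [exact: cB|exact: cvg_cst].
have -> : Nint h = (\int[leb]_(x in `]0%R, +oo[%classic) (G x)%:E)%E.
  rewrite /Nint [RHS]integral_indicE; apply: eq_integral => x _.
  rewrite indicE -mulrA; have [x0|x0] := ltP 0 (x : R).
    by rewrite mem_set ?mul1r ?GE//= in_itv/= andbT.
  by rewrite memNset ?mul0r//= in_itv/= andbT => /lt_geF; rewrite x0.
rewrite (integral_inversion cG G0).
rewrite -ge0_integralD//; [|by move=> x; rewrite /= in_itv/= => /andP[x0 x1]; rewrite lee_fin Xi_ge0|exact: mXi|by move=> x; rewrite /= in_itv/= => /andP[x0 x1]; rewrite lee_fin Yi_ge0|exact: mYi].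
apply: eq_integral => x; rewrite inE/= in_itv/= => /andP[x0 x1].
rewrite -EFinD; congr EFin.
have y0 : 0 < 1 - x by rewrite subr_gt0.
have F0 : 0 < (1 - x)^-1 - 1 by rewrite subr_gt0 invf_gt1//; lra.
rewrite -GE//; have -> : Num.max 0 (1 + ((1 - x)^-1 - 1)) = (1 - x)^-1.
  by rewrite addrCA subrr addr0; apply/max_idPr; rewrite invr_ge0 ltW.
have N1 : (1 - x)^-1 = (1 - x) `^ (- 1) by rewrite powR_inv1// ltW.
have e1 : (1 - x)^-1 `^ s = ((1 - x) `^ s)^-1.
  by rewrite N1 -powRrM mulN1r powRN.
have e2 : jreg q h ((1 - x)^-1 `^ s) 1 = (1 - x) `^ (- (s * q)) * jreg q h 1 ((1 - x) `^ s).
  rewrite e1 powRN powRrM; set Y := (1 - x) `^ s.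
  have Y0 : 0 < Y by rewrite powR_gt0.
  have := @jreg_homog _ q h 1 Y Y^-1; rewrite invr_gt0 mulr1 mulVf ?gt_eqF// => ->//.
  by rewrite -powR_inv1 ?(ltW Y0)// -powRrM mulN1r powRN.
have e3 : ((1 - x)^-1 - 1) `^ (- al - 1) = x `^ (- al - 1) * (1 - x) `^ (al + 1).
  have -> : (1 - x)^-1 - 1 = x * (1 - x)^-1 by field; rewrite gt_eqF.
  rewrite powRM ?invr_ge0 ?(ltW x0) ?(ltW y0)// N1 -powRrM.
  by congr (_ * _ `^ _); ring.
(* The kernel, the homogeneity of [jreg] and the Jacobian combine to the exponent
   [(ps + 1) - s(p - 1) - 2 = s - 1]. *)
have e4 : (1 - x) `^ (s - 1) = (1 - x) `^ (al + 1) * ((1 - x) `^ (- (s * q)) * ((1 - x)^-1 * (1 - x)^-1)).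
  by rewrite N1 -!powR_addp//; congr (_ `^ _); rewrite /al /q; ring.
rewrite e2 e3 /Xi /Yi /theta -/q -/al jreg1_onem// e4; ring.
Qed.

(** For [x >= 1] the profile is 0 and [jreg (p - 1) h 1 0] is just the weight [1/(1+h)]. *)
Let PintE h : 0 < h -> Pint h = (Xint h + ((1 + h)^-1 / al)%:E)%E.
Proof.
move=> h0.
pose T (x : R) := (1 + h)^-1 * x `^ (- al - 1).
have T0 x : 0 <= T x by rewrite mulr_ge0 ?powR_ge0// invr_ge0 addr_ge0// ltW.
have mT : measurable_fun setT (T : measurableTypeR R -> R).
  by apply: measurable_funM => //; exact: measurable_powR.
have -> : ((1 + h)^-1 / al)%:E = (\int[leb]_(x in `[1%R, +oo[%classic) (T x)%:E)%E.
  rewrite -integral_itv_obnd_cbnd; last by apply: measurable_funTS; apply/measurable_EFinP.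
  under eq_integral do rewrite EFinM.
  rewrite ge0_integralZl_EFin//.
  - by rewrite integral_powR_tail// powR1 -EFinM mul1r.
  - by move=> x _; rewrite lee_fin powR_ge0.
  - by apply: measurable_funTS; apply/measurable_EFinP; exact: measurable_powR.
  - by rewrite invr_ge0 addr_ge0// ltW.
rewrite /Xint [X in (X + _)%E]integral_indicE [X in (_ + X)%E]integral_indicE -int_add.
- rewrite /Pint; apply: eq_integral => x _; congr EFin.
  rewrite indic01 indicE /Xi /T.
  have -> : (x \in `[1%R, +oo[%classic) = (1 <= x).
    by apply/idP/idP; [rewrite inE/= in_itv/= andbT|move=> ?; rewrite inE/= in_itv/= andbT].
  have [x1|x1] := ltP x 1; last first.
    have -> : Num.max 0 (1 - x) = 0 by apply/max_idPl; rewrite subr_le0.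
    rewrite andbF mul0r add0r mul1r (lt_le_trans ltr01 x1) mul1r mulrC powR0 ?gt_eqF//; congr (_ * _).
    by rewrite /jreg /wreg subr0 addr0 normr1 mulr1 spow_ge0// powR1 !mul1r.
  have -> : Num.max 0 (1 - x) = 1 - x by apply/max_idPr; rewrite subr_ge0 ltW.
  rewrite andbT (_ : false%:R = 0)// mul0r addr0 -mulrA; reflexivity.
- apply: measurable_funM; first exact: measurable_indic.
  by apply: measurable_funM; [mfun|apply: measurable_jreg; mfun].
- by apply: measurable_funM; [exact: measurable_indic|exact: mT].
- move=> x; rewrite indic01; have [/andP[x0 x1]|_] := boolP (_ && _); last by rewrite mul0r.
  by rewrite mul1r Xi_ge0.
- by move=> x; rewrite mulr_ge0.
Qed.

(** The shared part being finite for each [h], it cancels, and there remains [(1+h)^-1/(ps)] minus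
    the integral of [Yi]; both tend to [1/(ps)]. *)
Lemma halfline_limit : exists x y : nat -> R,
  [/\ forall k, Pint k.+1%:R^-1 = (x k)%:E, forall k, Nint k.+1%:R^-1 = (y k)%:E &
      x k - y k @[k --> \oo] --> (0 : R)].
Proof.
have h0 k : 0 < k.+1%:R^-1 :> R by rewrite invr_gt0.
exists (fun k => fine (Xint k.+1%:R^-1) + (1 + k.+1%:R^-1)^-1 / al).
exists (fun k => fine (Xint k.+1%:R^-1) + fine (Yint k.+1%:R^-1)); split.
- by move=> k; rewrite PintE// EFinD fineK ?Xint_fin.
- by move=> k; rewrite NintE// EFinD !fineK ?Xint_fin ?Yint_fin.
have -> : (fun k => fine (Xint k.+1%:R^-1) + (1 + k.+1%:R^-1)^-1 / al - (fine (Xint k.+1%:R^-1) + fine (Yint k.+1%:R^-1)))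
  = (fun k => (1 + k.+1%:R^-1)^-1 / al - fine (Yint k.+1%:R^-1)).
  by apply/funext => k; ring.
rewrite -(subrr al^-1); apply: cvgB; last exact: (fine_cvg Yint_cvg).
rewrite -[X in _ --> X]mul1r; apply: cvgM; last exact: cvg_cst.
rewrite -[X in _ --> X]invr1; apply: cvgV; first exact: oner_neq0.
rewrite -[X in _ --> X]addr0; apply: cvgD; first exact: cvg_cst.
exact: cvg_harmonic.
Qed.

End HalfLine.

(** * Comparison with the half-space *)

Section KernelBounds.
Set Implicit Arguments. Unset Strict Implicit.
Context {R : realType} {N : nat}.
Hypothesis N0 : (0 < N)%N.
Context (mu : {sigma_finite_measure set (Rn R N) -> \bar R}) (lmu : is_lebesgue mu).

(* The product of powers, rather than [eucl z `^ (c - N)], vanishes at [z = 0] also when [c = N], since [0 `^ 0 = 1]. *)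
Lemma near_power_bound (c : R) : 0 < c -> exists2 C : R, 0 <= C &
  forall d : R, 0 < d ->
   (\int[mu]_z ((eucl z < d)%R%:R * (eucl z `^ c * eucl z `^ (- N%:R)))%:E <= (C * d `^ c)%:E)%E.
Proof.
(* [near_kernel_bound] requires an exponent below [N]. A larger [c] is reduced to [c'], the
   remaining power of [eucl z] being at most [d^(c - c')]. *)
move=> c0; pose c' := Num.min c (1 / 2).
have c'0 : 0 < c' by rewrite lt_min c0; lra.
have c'c : c' <= c by rewrite ge_min lexx.
have NR1 : 1 <= N%:R :> R by rewrite ler1n.
have c'N : c' < N%:R.
  apply: lt_le_trans NR1; have : c' <= 1 / 2 by rewrite ge_min lexx orbT.
  lra.
pose C := 2 ^+ N * (N%:R - c') * (2 `^ (c' - 0) / (c' - 0) + (N%:R - c')^-1).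
have C0 : 0 <= C.
  apply: mulr_ge0; first by rewrite mulr_ge0 ?exprn_ge0// subr_ge0 ltW.
  by rewrite addr_ge0 ?divr_ge0 ?invr_ge0 ?powR_ge0// subr_ge0 ltW.
exists C => // d d0.
have H := @near_kernel_bound R N mu 0 c' (2 ^+ N) d (fun=> 1) c'0 c'N.
have {}H : (\int[mu]_z ((eucl z < d)%R%:R * 1 * eucl z `^ (c' - N%:R))%:E <= (C * d `^ (c' - 0))%:E)%E.
  apply: H => //.
  move=> x x0; under eq_integral do rewrite mulr1.
  by rewrite subr0 powR_mulrn ?(ltW x0)// -exprMn; apply: integral_ball_le => //; exact: ltW.
have E : C * d `^ c = d `^ (c - c') * (C * d `^ (c' - 0)).
  by rewrite subr0 mulrCA -powR_addp// subrK.
rewrite E EFinM; apply: (@le_trans _ _ ((d `^ (c - c'))%:E * \int[mu]_z ((eucl z < d)%R%:R * 1 * eucl z `^ (c' - N%:R))%:E)%E); last first.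
  by apply: lee_wpmul2l => //; rewrite lee_fin powR_ge0.
rewrite -int_scale ?powR_ge0//; [|by mfun|by move=> z; rewrite !mulr_ge0 ?powR_ge0].
apply: int_le; [by mfun|by mfun|by move=> z; rewrite !mulr_ge0 ?powR_ge0|move=> z].
have [zd|_] := ltP (eucl z) d; last by rewrite !mul0r mulr0.
rewrite !mul1r; have [->|z0] := eqVneq (eucl z) 0.
  by rewrite [X in _ * X]powR0 ?oppr_eq0 ?gt_eqF ?ltr0n// mulr0 mulr_ge0 ?powR_ge0.
have zp : 0 < eucl z by rewrite lt_def z0 eucl_ge0.
rewrite -powR_addp// (_ : c + - N%:R = (c - c') + (c' - N%:R)); last by ring.
rewrite powR_addp// ler_wpM2r ?powR_ge0// ge0_ler_powR ?nnegrE ?(ltW zp) ?(ltW d0) ?(ltW zd)//.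
by rewrite subr_ge0.
Qed.

(* [0 `^ (-k) = 0] makes [slab_bound] blind to [G = 0]; applied to [G + t] it bounds the measure of [G = 0] by [C t^(1/2)]. *)
Lemma hyperplane_null (x : R) (G : Rn R N -> R) (e : 'rV[R]_N) : 0 < x ->
  measurable_fun setT G -> eucl e <= 1 ->
  (forall (z : 'rV[R]_N) (t : R), G (z + t *: e) = G z + t) ->
  mu.-negligible [set z | eucl z < x /\ G z = 0].
Proof.
move=> x0 mG e1 Ge; set A : set (Rn R N) := [set z | _].
have AE : A = [set z | ((eucl z < x)%R && (G z == 0))] .
  by apply/seteqP; split => z /=; [move=> [-> /eqP ->]|move=> /andP[? /eqP]].
have mb : measurable_fun setT (fun z : Rn R N => (eucl z < x)%R && (G z == 0)).
  by apply: measurable_and; [mfun|apply: measurable_fun_eqr].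
have mA : measurable A.
  by rewrite AE -[X in measurable X]setTI; exact: (mb measurableT [set true]).
exists A; split => //.
pose C := (2 / (1 - 1/2) + 1) * 4 ^+ N * x `^ (N%:R - 1 / 2) : R.
have C0 : 0 <= C by rewrite mulr_ge0 ?powR_ge0// mulr_ge0 ?exprn_ge0// addr_ge0// divr_ge0//; lra.
have bnd (t : R) : 0 < t -> (mu A <= (C * t `^ (1 / 2))%:E)%E.
  move=> t0.
  have mGt : measurable_fun setT (fun z : Rn R N => G z + t) by mfun.
  have Get (z : 'rV[R]_N) (u : R) : G (z + u *: e) + t = (G z + t) + u by rewrite Ge addrAC.
  have H : (\int[mu]_z ((eucl z < x)%R%:R * `|G z + t| `^ (- (1 / 2)))%:E <= C%:E)%E.
    by apply: (slab_bound N0 lmu _ _ x0 mGt e1 Get); lra.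
  have tE : (mu A = (t `^ (1 / 2))%:E * \int[mu]_z (\1_A z * t `^ (- (1 / 2)))%:E)%E.
    rewrite -int_scale ?powR_ge0//.
    - rewrite -[in LHS](setTI A) setIC -integral_indic//.
      apply: eq_integral => z _; congr EFin.
      by rewrite mulrCA -powR_addp// subrr powRr0 mulr1.
    - by apply: measurable_funM => //; exact: measurable_indic.
    - by move=> z; rewrite mulr_ge0 ?powR_ge0.
  rewrite tE (mulrC C) EFinM; apply: lee_wpmul2l; first by rewrite lee_fin powR_ge0.
  apply: le_trans H; apply: int_le.
  - by apply: measurable_funM => //; exact: measurable_indic.
  - by mfun.
  - by move=> z; rewrite mulr_ge0 ?powR_ge0.
  - move=> z; rewrite indicE; have [|] := boolP (z \in A); last by rewrite mul0r mulr_ge0 ?powR_ge0.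
    by rewrite inE /A/= => -[-> ->]; rewrite add0r gtr0_norm.
apply/eqP; rewrite eq_le measure_ge0 andbT.
apply/lee_addgt0Pr => e' e'0; rewrite add0e.
(* This [t] makes [C t^(1/2)] equal to [C e'/(C + 1)], below [e']. *)
have t0 : 0 < (e' / (C + 1)) `^ 2 by apply: powR_gt0; rewrite divr_gt0// ltr_wpDl.
apply: (le_trans (bnd _ t0)); rewrite lee_fin -powRrM (_ : 2 * (1 / 2) = 1); last by lra.
rewrite powRr1; last by rewrite divr_ge0 ?(ltW e'0)// addr_ge0.
rewrite mulrA ler_pdivrMr ?ltr_wpDl//; have := mulr_ge0 C0 (ltW e'0); lra.
Qed.

Lemma near_slab_bound (b c : R) : 0 <= b -> b < 1 -> b < c -> exists2 C : R, 0 <= C &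
  forall (d : R) (v : 'rV[R]_N), eucl v = 1 ->
   (\int[mu]_z ((eucl z < 1)%R%:R * (`|d + dotv v z| `^ (- b) * (eucl z `^ c * eucl z `^ (- N%:R))))%:E <= C%:E)%E.
Proof.
(* The exponent must stay above [b] and below [N], which is at least 1; [(b + 1)/2] does both. *)
move=> b0 b1 bc; pose c' := Num.min c ((b + 1) / 2).
have bc' : b < c' by rewrite lt_min bc; lra.
have c'c : c' <= c by rewrite ge_min lexx.
have NR1 : 1 <= N%:R :> R by rewrite ler1n.
have c'N : c' < N%:R.
  apply: lt_le_trans NR1; have : c' <= (b + 1) / 2 by rewrite ge_min lexx orbT.
  lra.
pose C0 := (2 / (1 - b) + 1) * 4 ^+ N : R.
have C00 : 0 <= C0 by rewrite mulr_ge0 ?exprn_ge0// addr_ge0// divr_ge0//; lra.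
pose C := C0 * (N%:R - c') * (2 `^ (c' - b) / (c' - b) + (N%:R - c')^-1).
exists C.
  apply: mulr_ge0; first by rewrite mulr_ge0// subr_ge0 ltW.
  by rewrite addr_ge0 ?divr_ge0 ?invr_ge0 ?powR_ge0// subr_ge0 ltW.
move=> d v v1; pose g (z : Rn R N) := `|d + dotv v z| `^ (- b).
have mg : measurable_fun setT g by rewrite /g; mfun.
have g0 z : 0 <= g z by exact: powR_ge0.
have gC (x : R) : 0 < x ->
    (\int[mu]_z ((eucl z < x)%R%:R * g z)%:E <= (C0 * x `^ (N%:R - b))%:E)%E.
  move=> x0; apply: (slab_bound N0 lmu (G := fun z => d + dotv v z) (e := v)) => //.
  - by mfun.
  - by rewrite v1.
  - by move=> z t; rewrite dotvDr dotvZr -sqr_eucl v1 expr1n mulr1 addrA.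
have H := near_kernel_bound (d := 1) bc' c'N C00 ltr01 mg g0 gC.
rewrite powR1 mulr1 -/C in H; apply: le_trans H; apply: int_le.
- by rewrite /g; mfun.
- by mfun.
- by move=> z; rewrite !mulr_ge0 ?powR_ge0.
- move=> z; have [z1|_] := ltP (eucl z) 1; last by rewrite !mul0r.
  rewrite !mul1r ler_wpM2l ?powR_ge0//; have [->|z0] := eqVneq (eucl z) 0.
    by rewrite [X in _ * X]powR0 ?oppr_eq0 ?gt_eqF ?ltr0n// mulr0 powR_ge0.
  have zp : 0 < eucl z by rewrite lt_def z0 eucl_ge0.
  rewrite -powR_addp// (_ : c + - N%:R = (c - c') + (c' - N%:R)); last by ring.
  have e1 : eucl z `^ (c - c') <= 1 `^ (c - c').
    by rewrite ge0_ler_powR ?nnegrE ?(ltW zp) ?(ltW z1)// subr_ge0.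
  by rewrite powR1 in e1; rewrite powR_addp// ler_piMl ?powR_ge0.
Qed.

End KernelBounds.

Section ProfileIntegrals.
Set Implicit Arguments. Unset Strict Implicit.
Context {R : realType} {N : nat}.
Hypothesis N0 : (0 < N)%N.
Context (mu : {sigma_finite_measure set (Rn R N) -> \bar R}) (lmu : is_lebesgue mu).
Context (s p : R) (s0 : 0 < s) (s1 : s < 1) (p1 : 1 < p).

Let ps0 : 0 < p * s. Proof. by rewrite mulr_gt0// (lt_trans ltr01 p1). Qed.
Let K (z : Rn R N) := eucl z `^ (- (N%:R + p * s)).
Let mK : measurable_fun setT K. Proof. by rewrite /K; mfun. Qed.
Let K0 z : 0 <= K z. Proof. exact: powR_ge0. Qed.
Let NR0 : 0 < N%:R :> R. Proof. by rewrite ltr0n. Qed.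

Let Kfar (z : Rn R N) : 0 < eucl z -> eucl z `^ (s * (p - 1)) * K z = eucl z `^ (- (N%:R + s)).
Proof. by move=> z0; rewrite -powR_addp//; congr (_ `^ _); ring. Qed.

Let Knear (z : Rn R N) : eucl z `^ p * K z = eucl z `^ (p - p * s) * eucl z `^ (- N%:R).
Proof.
have [z0|z0] := eqVneq (eucl z) 0.
  have Nps : 0 < N%:R + p * s by rewrite addr_gt0.
  have -> : K z = 0 by rewrite /K z0 powR0// oppr_eq0 gt_eqF.
  by rewrite z0 mulr0 [X in _ * X]powR0 ?mulr0// oppr_eq0 gt_eqF.
have zp : 0 < eucl z by rewrite lt_def z0 eucl_ge0.
by rewrite -!powR_addp//; congr (_ `^ _); ring.
Qed.

(** The integral is split at [eucl z = d]: inside, the regularization gives convergence, with a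
    constant depending on [h]; outside, Hoelder continuity of [u] suffices. Both pieces scale like
    [d^(-s)]. *)
Lemma jreg_int_bound (h : R) : 0 < h -> exists2 C : R, 0 <= C &
  forall (d : R) (del : Rn R N -> R), 0 < d -> measurable_fun setT del -> (forall z, 0 <= del z) ->
   (forall z, `|d - del z| <= eucl z) ->
   (\int[mu]_z (`|jreg (p - 1) h (d `^ s) (del z `^ s)| * K z)%:E <= (C * d `^ (- s))%:E)%E.
Proof.
move=> h0; have pps0 : 0 < p - p * s by rewrite -{1}(mulr1 p) -mulrBr mulr_gt0 ?subr_gt0// (lt_trans ltr01 p1).
have [C1 C10 HC1] := near_power_bound N0 lmu pps0.
pose C2 := (N%:R + s) * 2 ^+ N / s.
have C20 : 0 <= C2 by rewrite mulr_ge0 ?invr_ge0 ?(ltW s0)// mulr_ge0 ?exprn_ge0// addr_ge0// ltW.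
exists (h^-1 * C1 + C2); first by rewrite addr_ge0// mulr_ge0// invr_ge0 ltW.
move=> d del d0 mdel del0 ddel.
pose g1 (z : Rn R N) := h^-1 * d `^ ((s - 1) * p - s) * ((eucl z < d)%R%:R * (eucl z `^ (p - p * s) * eucl z `^ (- N%:R))).
pose g2 (z : Rn R N) := (d <= eucl z)%R%:R * eucl z `^ (- (N%:R + s)).
have c0 : 0 <= h^-1 * d `^ ((s - 1) * p - s) by rewrite mulr_ge0 ?powR_ge0// invr_ge0 ltW.
have g10 z : 0 <= g1 z by rewrite mulr_ge0// !mulr_ge0 ?powR_ge0.
have g20 z : 0 <= g2 z by rewrite mulr_ge0 ?powR_ge0.
have mg1 : measurable_fun setT g1 by rewrite /g1; mfun.
have mg2 : measurable_fun setT g2 by rewrite /g2; mfun.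
apply: (@le_trans _ _ (\int[mu]_z (g1 z + g2 z)%:E)%E).
  apply: int_le.
  - by apply: measurable_funM => //; apply: measurable_normrc; apply: measurable_jreg; mfun.
  - by mfun.
  - by move=> z; rewrite mulr_ge0.
  move=> z; rewrite /g1 /g2; have [zd|dz] := ltP (eucl z) d.
    rewrite mul1r mul0r addr0 -Knear mulrA ler_wpM2r//.
    exact: jreg_error_near.
  rewrite mul0r mulr0 add0r mul1r -Kfar; last exact: lt_le_trans dz.
  by rewrite ler_wpM2r//; exact: (jreg_error_far _ _ _ _ d0).
rewrite int_add// mulrDl EFinD; apply: leeD; last exact: far_kernel_bound.
rewrite /g1 int_scale//; [|by mfun|by move=> z; rewrite !mulr_ge0 ?powR_ge0].
apply: (@le_trans _ _ ((h^-1 * d `^ ((s - 1) * p - s))%:E * (C1 * d `^ (p - p * s))%:E)%E).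
  by apply: lee_wpmul2l; [rewrite lee_fin|exact: HC1].
rewrite -EFinM lee_fin le_eqVlt; apply/orP; left; apply/eqP.
have -> : d `^ (- s) = d `^ ((s - 1) * p - s) * d `^ (p - p * s).
  by rewrite -powR_addp//; congr (_ `^ _); ring.
ring.
Qed.

(** The same [B] dominates the error for all [h], so that it also serves for dominated convergence
    as [h] tends to 0, and the bound [M] on its integral does not depend on [d] or [v]. *)
Lemma jreg_error_int (c : R) : 0 <= c -> exists2 M : R, 0 <= M &
  forall (d : R) (v : 'rV[R]_N) (del : Rn R N -> R), 0 < d -> eucl v = 1 -> (forall z, 0 <= del z) ->
   (forall z, `|d - del z| <= eucl z) ->
   (forall z, del z <= Num.max 0 (d + dotv v z + c * eucl z ^+ 2)) ->
   (forall z, d + dotv v z - c * eucl z ^+ 2 <= del z) ->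
   exists B : Rn R N -> R, [/\ measurable_fun setT B, forall z, 0 <= B z,
    (\int[mu]_z (B z)%:E <= M%:E)%E &
    {ae mu, forall z, forall h, 0 < h ->
     `|jreg (p - 1) h (d `^ s) (del z `^ s) - jreg (p - 1) h (d `^ s) (Num.max 0 (d + dotv v z) `^ s)| * K z <= B z}].
Proof.
move=> c0; have [C [e [C0 [/andP[b10 b11] /andP[b20 b21] /andP[b30 b31] [bc1 bc2 bc3]] Hj]]] := jreg_error s0 s1 p1 c0.
have [M1 M10 HM1] := near_slab_bound N0 lmu b10 b11 bc1.
have [M2 M20 HM2] := near_slab_bound N0 lmu b20 b21 bc2.
have [M3 M30 HM3] := near_slab_bound N0 lmu b30 b31 bc3.
pose M4 := (N%:R + s) * 2 ^+ N / s.
have M40 : 0 <= M4 by rewrite mulr_ge0 ?invr_ge0 ?(ltW s0)// mulr_ge0 ?exprn_ge0// addr_ge0// ltW.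
exists (C * M1 + C * M2 + C * M3 + 2 * M4).
  by rewrite !addr_ge0// mulr_ge0.
move=> d v del d0 v1 del0 ddel up low.
pose T (a b g : R) (z : Rn R N) := (eucl z < 1)%R%:R * (`|a + dotv v z| `^ (- b) * (eucl z `^ g * eucl z `^ (- N%:R))).
have T0 a b g z : 0 <= T a b g z by rewrite /T !mulr_ge0 ?powR_ge0.
have mT a b g : measurable_fun setT (T a b g) by rewrite /T; mfun.
pose F (z : Rn R N) := (1 <= eucl z)%R%:R * eucl z `^ (- (N%:R + s)).
have F0 z : 0 <= F z by rewrite /F mulr_ge0 ?powR_ge0.
have mF : measurable_fun setT F by rewrite /F; mfun.
have TE a b g z : T a b g z = (eucl z < 1)%R%:R * (`|a + dotv v z| `^ (- b) * (eucl z `^ g * eucl z `^ (- N%:R))) by [].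
have FE z : F z = (1 <= eucl z)%R%:R * eucl z `^ (- (N%:R + s)) by [].
have iF : (\int[mu]_z (F z)%:E <= M4%:E)%E.
  by have := far_kernel_bound lmu s0 (@ltr01 R); rewrite powR1 mulr1.
have I1 : (\int[mu]_z (T d (eb1 e) (ec1 e) z)%:E <= M1%:E)%E by exact: HM1.
have I2 : (\int[mu]_z (T 0 (eb2 e) (ec2 e) z)%:E <= M2%:E)%E by exact: HM2.
have I3 : (\int[mu]_z (T d (eb3 e) (ec3 e) z)%:E <= M3%:E)%E by exact: HM3.
clearbody T F.
exists (fun z => C * T d (eb1 e) (ec1 e) z + C * T 0 (eb2 e) (ec2 e) z + C * T d (eb3 e) (ec3 e) z + 2 * F z).
have CT0 a b g z : 0 <= C * T a b g z by rewrite mulr_ge0.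
have mCT a b g : measurable_fun setT (fun z => C * T a b g z) by exact: measurable_funM.
have bT a b g M : (\int[mu]_z (T a b g z)%:E <= M%:E -> \int[mu]_z (C * T a b g z)%:E <= (C * M)%:E)%E.
  by move=> H; rewrite int_scale// EFinM; apply: lee_wpmul2l; rewrite ?lee_fin.
have m12 : measurable_fun setT (fun z => C * T d (eb1 e) (ec1 e) z + C * T 0 (eb2 e) (ec2 e) z).
  exact: measurable_funD.
have m123 : measurable_fun setT (fun z => C * T d (eb1 e) (ec1 e) z + C * T 0 (eb2 e) (ec2 e) z + C * T d (eb3 e) (ec3 e) z).
  exact: measurable_funD.
have m4 : measurable_fun setT (fun z => 2 * F z) by exact: measurable_funM.
split.
- exact: measurable_funD.
- by move=> z; rewrite !addr_ge0// mulr_ge0.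
- rewrite (int_add _ m123 m4); [|by move=> z; rewrite !addr_ge0|by move=> z; rewrite mulr_ge0].
  rewrite EFinD; apply: leeD; last first.
    by rewrite int_scale// EFinM; apply: lee_wpmul2l; rewrite ?lee_fin.
  rewrite (int_add _ m12 (mCT _ _ _)); [|by move=> z; rewrite !addr_ge0|by []].
  rewrite EFinD; apply: leeD; last exact: bT.
  by rewrite (int_add _ (mCT _ _ _) (mCT _ _ _))// EFinD; apply: leeD; exact: bT.
have hyp (a : R) : mu.-negligible [set z | eucl z < 1 /\ a + dotv v z = 0].
  apply: (hyperplane_null N0 lmu (G := fun z => a + dotv v z) (e := v) ltr01).
  - by mfun.
  - by rewrite v1.
  - by move=> z t; rewrite dotvDr dotvZr -sqr_eucl v1 expr1n mulr1 addrA.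
(* The excluded null sets are the hyperplanes [t = 0] and [tau = 0] of [jreg_error]. *)
have := negligibleU (hyp d) (hyp 0).
apply: negligibleS => z /=; apply: contra_notP => /not_orP[n1 n2] h h0.
have [z1|z1] := ltP (eucl z) 1.
  have tn0 : d + dotv v z != 0 by apply/eqP => t0; apply: n1.
  have taun0 : dotv v z != 0 by apply/eqP => t0; apply: n2; rewrite add0r.
  have taur : `|dotv v z| <= eucl z by have := norm_dotv_le v z; rewrite v1 mul1r.
  have zp : 0 < eucl z by apply: lt_le_trans taur; rewrite normr_gt0.
  apply: (le_trans (Hj N%:R d (dotv v z) _ (eucl z) (del z) h h0 d0 erefl tn0 taun0 taur (del0 z) (ddel z) (up z) (low z))).
  have -> : F z = 0 by rewrite FE leNgt z1 mul0r.
  rewrite mulr0 addr0 !TE z1 !mul1r add0r -!powR_addp//.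
  by rewrite !mulrDr.
(* Away from the origin the two terms are not close; each is bounded alone, whence the factor 2
   before [F]. *)
rewrite !TE ltNge z1 !mul0r !mulr0 !add0r FE z1 mul1r -Kfar; last exact: lt_le_trans z1.
rewrite mulrA ler_wpM2r// (_ : 2 * _ = eucl z `^ (s * (p - 1)) + eucl z `^ (s * (p - 1))); last by ring.
apply: (le_trans (ler_normB _ _)); apply: lerD.
  exact: (jreg_error_far _ _ _ _ d0).
apply: (jreg_error_far _ _ _ _ d0) => //; first by rewrite le_max lexx.
apply: (le_trans (max0_dist d0 erefl)).
by have := norm_dotv_le v z; rewrite v1 mul1r.
Qed.

End ProfileIntegrals.

(** * Exact evaluation on the half-space profile *)

Section HalfspaceProfile.
Set Implicit Arguments. Unset Strict Implicit.
Context {R : realType} {N : nat}.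
Hypothesis N0 : (0 < N)%N.
Context (mu : {sigma_finite_measure set (Rn R N) -> \bar R}) (lmu : is_lebesgue mu).
Context (s p : R) (s0 : 0 < s) (s1 : s < 1) (p1 : 1 < p).

Let ps0 : 0 < p * s. Proof. by rewrite mulr_gt0// (lt_trans ltr01 p1). Qed.
Let q0 : 0 < p - 1. Proof. by rewrite subr_gt0. Qed.
Let K (z : Rn R N) := eucl z `^ (- (N%:R + p * s)).

Let Pint h := (\int[@lebesgue_measure R]_x ((0 < x)%R%:R * x `^ (- (p * s) - 1) * jreg (p - 1) h 1 ((Num.max 0 (1 - x)) `^ s))%:E)%E.
Let Nint h := (\int[@lebesgue_measure R]_x ((0 < x)%R%:R * x `^ (- (p * s) - 1) * jreg (p - 1) h ((Num.max 0 (1 + x)) `^ s) 1)%:E)%E.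

Let jregAA h A : jreg (p - 1) h A A = 0.
Proof. by rewrite /jreg subrr /spow sgr0 !mul0r. Qed.

Let jreg_pos h A B : 0 < h -> 0 <= B -> B <= A -> 0 <= jreg (p - 1) h A B.
Proof.
move=> h0 B0 BA; have A0 := le_trans B0 BA.
by rewrite /jreg spow_ge0 ?subr_ge0// mulr_ge0 ?powR_ge0// wreg_ge0.
Qed.

(** Homogeneity of [jreg] contributes [d^(s(p-1))] and the substitution [d^(-ps)]; together they
    give [d^(-s)]. *)
Let scaled (d : R) (g : R -> R) : 0 < d -> measurable_fun setT (g : measurableTypeR R -> R) ->
  (forall x, 0 <= g x) ->
  (\int[@lebesgue_measure R]_x ((0 < x)%R%:R * x `^ (- (p * s) - 1) * (d `^ (s * (p - 1)) * g (d^-1 * x)))%:E =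
   (d `^ (- s))%:E * \int[@lebesgue_measure R]_x ((0 < x)%R%:R * x `^ (- (p * s) - 1) * g x)%:E)%E.
Proof.
move=> d0 mg g0; have d'0 : 0 < d^-1 by rewrite invr_gt0.
have S := scale_halfline (p * s) d'0 mg g0.
have mgd : measurable_fun setT (fun x : measurableTypeR R => g (d^-1 * x)).
  by apply: measurableT_comp => //; exact: measurable_funM.
rewrite (eq_integral (fun x : measurableTypeR R => (d `^ (s * (p - 1)) * ((0 < x)%R%:R * x `^ (- (p * s) - 1) * g (d^-1 * x)))%:E)); last first.
  by move=> x _; congr EFin; ring.
rewrite (@int_scale _ _ (measurableTypeR R)) ?powR_ge0//.
- rewrite S muleA -EFinM; congr (_%:E * _)%E.
  rewrite -(powR_inv1 (ltW d0)) -powRrM -powR_addp//; congr (_ `^ _); ring.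
- by mfun.
- by move=> x; rewrite !mulr_ge0 ?powR_ge0.
Qed.

(** The profile is monotone along [v], so the positive part lives on [v.z < 0] and the negative part
    on [v.z > 0]. In [halfspace_integral] each therefore keeps just one of the two half-line
    integrals. *)
Lemma halfspace_jreg (h d : R) (v : 'rV[R]_N) : 0 < h -> 0 < d -> eucl v <= 1 ->
  (\int[mu]_z (Num.max 0 (jreg (p - 1) h (d `^ s) (Num.max 0 (d + dotv v z) `^ s)) * K z)%:E =
   halfspace_const mu v (p * s) * ((d `^ (- s))%:E * Pint h) /\
   \int[mu]_z (Num.max 0 (- jreg (p - 1) h (d `^ s) (Num.max 0 (d + dotv v z) `^ s)) * K z)%:E =
   halfspace_const mu v (p * s) * ((d `^ (- s))%:E * Nint h))%E.
Proof.
move=> h0 d0 v1; pose j (x : R) := jreg (p - 1) h (d `^ s) (Num.max 0 (d + x) `^ s).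
have mj : measurable_fun setT (j : measurableTypeR R -> R) by apply: measurable_jreg; mfun.
have j00 : j 0 = 0 by rewrite /j addr0 max_r ?(ltW d0)// jregAA.
have jpos x : 0 <= x -> j x <= 0.
  move=> x0; rewrite /j jregC oppr_le0; apply: jreg_pos; rewrite ?powR_ge0//.
  have dx : 0 <= d + x by rewrite addr_ge0// ltW.
  by rewrite max_r// ge0_ler_powR ?nnegrE ?(ltW s0) ?(ltW d0)// lerDl.
have jneg x : 0 <= x -> 0 <= j (- x).
  move=> x0; rewrite /j; apply: jreg_pos; rewrite ?powR_ge0//.
  rewrite ge0_ler_powR ?nnegrE ?(ltW s0) ?(ltW d0)//; first by rewrite le_max lexx.
  by rewrite ge_max (ltW d0) gerBl.
have max_scale x : d * Num.max 0 (1 + d^-1 * x) = Num.max 0 (d + x).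
  by rewrite maxr_pMr ?(ltW d0)// mulr0 mulrDr mulr1 mulVKf// gt_eqF.
have m0 x : 0 <= Num.max 0 (1 + d^-1 * x) by rewrite le_max lexx.
have jscale x : j x = d `^ (s * (p - 1)) * jreg (p - 1) h 1 (Num.max 0 (1 + d^-1 * x) `^ s).
  by rewrite powRrM -jreg_homog ?powR_gt0// mulr1 -powRM ?(ltW d0) ?max_scale.
have z0 : (\int[@lebesgue_measure R]_x ((0 < x)%R%:R * x `^ (- (p * s) - 1) * 0)%:E = 0)%E.
  by apply: integral0_eq => x _; rewrite mulr0.
have le1 (x : R) : 0 <= x -> 0 <= jreg (p - 1) h 1 (Num.max 0 (1 - x) `^ s).
  move=> x0; apply: jreg_pos; rewrite ?powR_ge0//.
  have : Num.max 0 (1 - x) `^ s <= 1 `^ s.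
    rewrite ge0_ler_powR ?nnegrE ?(ltW s0)//; first by rewrite le_max lexx.
    by rewrite ge_max ler01 gerBl.
  by rewrite powR1.
have ge1 (x : R) : 0 <= x -> 0 <= jreg (p - 1) h (Num.max 0 (1 + x) `^ s) 1.
  move=> x0; apply: jreg_pos; rewrite ?powR_ge0//.
  have dx : 0 <= 1 + x by rewrite addr_ge0.
  have : 1 `^ s <= (1 + x) `^ s by rewrite ge0_ler_powR ?nnegrE ?(ltW s0)// lerDl.
  by rewrite powR1 max_r.
split.
- have mj' : measurable_fun setT (fun x : measurableTypeR R => Num.max 0 (j x)) by exact: measurable_maxr.
  have := @halfspace_integral R N N0 mu lmu v (p * s) (fun x => Num.max 0 (j x)) ps0 mj'.
  move=> ->; rewrite ?j00 ?maxxx//; last by move=> x; rewrite le_max lexx.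
  congr (_ * _)%E.
  rewrite (_ : (\int[_]_x _)%E = 0%E) ?add0e; last first.
    rewrite -[RHS]z0; apply: eq_integral => x _; congr EFin.
    have [x0|_] := ltP 0 x; last by rewrite !mul0r.
    by rewrite max_l// jpos// ltW.
  pose g (x : R) := `|jreg (p - 1) h 1 (Num.max 0 (1 - x) `^ s)|.
  have mg : measurable_fun setT (g : measurableTypeR R -> R).
    by apply: measurable_normrc; apply: measurable_jreg; mfun.
  rewrite (eq_integral (fun x : measurableTypeR R => ((0 < x)%R%:R * x `^ (- (p * s) - 1) * (d `^ (s * (p - 1)) * g (d^-1 * x)))%:E)); last first.
    move=> x _; congr EFin; have [x0|_] := ltP 0 x; last by rewrite !mul0r.
    rewrite max_r ?jneg ?(ltW x0)// jscale /g; congr (_ * (_ * _)); rewrite mulrN.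
    by rewrite ger0_norm// le1// mulr_ge0 ?invr_ge0 ?(ltW d0) ?(ltW x0).
  have g0 x : 0 <= g x by exact: normr_ge0.
  rewrite (scaled d0 mg g0); congr (_ * _)%E; apply: eq_integral => x _; congr EFin.
  have [x0|_] := ltP 0 x; last by rewrite !mul0r.
  by congr (_ * _); rewrite /g ger0_norm// le1// ltW.
- have mj' : measurable_fun setT (fun x : measurableTypeR R => Num.max 0 (- j x)).
    by apply: measurable_maxr => //; exact: measurable_oppc.
  have := @halfspace_integral R N N0 mu lmu v (p * s) (fun x => Num.max 0 (- j x)) ps0 mj'.
  move=> ->; rewrite ?j00 ?oppr0 ?maxxx//; last by move=> x; rewrite le_max lexx.
  congr (_ * _)%E.
  rewrite addeC (_ : (\int[_]_x _)%E = 0%E) ?add0e; last first.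
    rewrite -[RHS]z0; apply: eq_integral => x _; congr EFin.
    have [x0|_] := ltP 0 x; last by rewrite !mul0r.
    by rewrite max_l// oppr_le0 jneg// ltW.
  pose g (x : R) := `|jreg (p - 1) h (Num.max 0 (1 + x) `^ s) 1|.
  have mg : measurable_fun setT (g : measurableTypeR R -> R).
    by apply: measurable_normrc; apply: measurable_jreg; mfun.
  rewrite (eq_integral (fun x : measurableTypeR R => ((0 < x)%R%:R * x `^ (- (p * s) - 1) * (d `^ (s * (p - 1)) * g (d^-1 * x)))%:E)); last first.
    move=> x _; congr EFin; have [x0|_] := ltP 0 x; last by rewrite !mul0r.
    have E : - j x = d `^ (s * (p - 1)) * jreg (p - 1) h (Num.max 0 (1 + d^-1 * x) `^ s) 1.
      by rewrite jscale -mulrN -jregC.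
    rewrite max_r ?oppr_ge0 ?jpos ?(ltW x0)// E /g; congr (_ * (_ * _)).
    by rewrite ger0_norm// ge1// mulr_ge0 ?invr_ge0 ?(ltW d0) ?(ltW x0).
  have g0 x : 0 <= g x by exact: normr_ge0.
  rewrite (scaled d0 mg g0); congr (_ * _)%E; apply: eq_integral => x _; congr EFin.
  have [x0|_] := ltP 0 x; last by rewrite !mul0r.
  by congr (_ * _); rewrite /g ger0_norm// ge1// ltW.
Qed.

End HalfspaceProfile.

Section BoundedSequences.
Set Implicit Arguments. Unset Strict Implicit.
Context {R : realType}.
Implicit Types u : nat -> R.

Lemma cvgn_norm_le u (l b : R) : u k @[k --> \oo] --> l -> (forall k, `|u k| <= b) -> `|l| <= b.
Proof.
move=> cu ub; have cn : `|u k| @[k --> \oo] --> `|l| by exact: cvg_norm.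
rewrite -(cvg_lim _ cn)//; apply: limr_le; first by apply/cvg_ex; exists `|l|.
by near=> k.
Unshelve. all: by end_near. Qed.

Lemma cvgn_bounded u (l : R) : u k @[k --> \oo] --> l ->
  exists2 S : R, 0 <= S & forall k, `|u k| <= S.
Proof.
move=> cu; have /cvg_seq_bounded/pinfty_ex_gt0[S S0 HS] : cvgn u by apply/cvg_ex; exists l.
by exists S; [exact: ltW|move=> k; exact: HS].
Qed.

End BoundedSequences.

Section Domination.
Set Implicit Arguments. Unset Strict Implicit.
Context {R : realType} d (T : measurableType d) (m : {measure set T -> \bar R}).
Implicit Types (f g : T -> R).

Lemma integrable_dom f g : measurable_fun setT f -> measurable_fun setT g -> (forall x, 0 <= g x) ->
  {ae m, forall x, `|f x| <= g x} -> (\int[m]_x (g x)%:E < +oo)%E ->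
  m.-integrable setT (EFin \o f) /\ (`|\int[m]_x (f x)%:E| <= \int[m]_x (g x)%:E)%E.
Proof.
move=> mf mg g0 fg goo.
have mEf : measurable_fun setT (EFin \o f) by apply/measurable_EFinP.
have h : (\int[m]_x `|(f x)%:E| <= \int[m]_x (g x)%:E)%E.
  apply: ae_ge0_le_integral => //.
  - exact: measurableT_comp.
  - by move=> x _; rewrite lee_fin.
  - by apply/measurable_EFinP.
  - by apply: filterS fg => x fgx _; rewrite lee_fin.
split; first by apply/integrableP; split => //; exact: le_lt_trans goo.
by apply: le_trans h; exact: le_abse_integral.
Qed.

Lemma integral_dominated_cvg (f_ : nat -> T -> R) f g : (forall k, measurable_fun setT (f_ k)) ->
  measurable_fun setT f -> measurable_fun setT g -> (forall x, 0 <= g x) ->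
  {ae m, forall x, f_ k x @[k --> \oo] --> f x} -> {ae m, forall x k, `|f_ k x| <= g x} ->
  (\int[m]_x (g x)%:E < +oo)%E ->
  (\int[m]_x (f_ k x)%:E)%E @[k --> \oo] --> (\int[m]_x (f x)%:E)%E.
Proof.
move=> mf_ mf mg g0 cf dom goo.
suff: [/\ m.-integrable setT (EFin \o f), (\int[m]_x `|(f_ k x)%:E - (f x)%:E|)%E @[k --> \oo] --> 0%E &
  (\int[m]_x (f_ k x)%:E)%E @[k --> \oo] --> (\int[m]_x (f x)%:E)%E] by case.
apply: (@dominated_convergence _ T R m setT measurableT (fun k => EFin \o f_ k) (EFin \o f) (EFin \o g)).
- by move=> k; apply/measurable_EFinP.
- by apply/measurable_EFinP.
- by apply: filterS cf => x h _; apply: cvg_EFin => //; near=> k.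
- apply/integrableP; split; first by apply/measurable_EFinP.
  by under eq_integral do rewrite /= ger0_norm//.
- by apply: filterS dom => x h k _; rewrite lee_fin.
Unshelve. all: by end_near. Qed.

End Domination.

(** * Limit of the regularized operator at one point *)

Section RegularizedLimit.
Set Implicit Arguments. Unset Strict Implicit.
Context {R : realType} {N : nat}.
Hypothesis N0 : (0 < N)%N.
Context (mu : {sigma_finite_measure set (Rn R N) -> \bar R}) (lmu : is_lebesgue mu).
Context (s p : R) (s0 : 0 < s) (s1 : s < 1) (p1 : 1 < p).

Let ps0 : 0 < p * s. Proof. by rewrite mulr_gt0// (lt_trans ltr01 p1). Qed.
Let K (z : Rn R N) := eucl z `^ (- (N%:R + p * s)).

Let mK : measurable_fun setT K. Proof. by rewrite /K; mfun. Qed.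
Let K0 z : 0 <= K z. Proof. exact: powR_ge0. Qed.

Let Ju (k : nat) (d : R) (del : Rn R N -> R) (z : Rn R N) : R :=
  jreg (p - 1) k.+1%:R^-1 (d `^ s) (del z `^ s) * K z.
Let JU (k : nat) (d : R) (v : 'rV[R]_N) (z : Rn R N) : R :=
  jreg (p - 1) k.+1%:R^-1 (d `^ s) (Num.max 0 (d + dotv v z) `^ s) * K z.

Let hs0 k : 0 < k.+1%:R^-1 :> R. Proof. by rewrite invr_gt0. Qed.

Let mJu k d (del : Rn R N -> R) : measurable_fun setT del -> measurable_fun setT (Ju k d del).
Proof. by move=> md; apply: measurable_funM => //; apply: measurable_jreg; mfun. Qed.

Let mJU k d v : measurable_fun setT (JU k d v).
Proof. by apply: measurable_funM => //; apply: measurable_jreg; mfun. Qed.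

(** The sequence [c] depends neither on [d] nor on [v]; of the constant [kap] only a uniform bound
    is kept. *)
Lemma halfspace_sequence : exists c : nat -> R, c k @[k --> \oo] --> (0 : R) /\
  forall (d : R) (v : 'rV[R]_N) k, 0 < d -> eucl v <= 1 ->
   mu.-integrable setT (EFin \o JU k d v) /\
   exists kap : R, 0 <= kap <= (N%:R + p * s) * 2 ^+ N /\
   (\int[mu]_z (JU k d v z)%:E = (kap * (d `^ (- s) * c k))%:E)%E.
Proof.
have [x [y [Px Ny xy]]] := halfline_limit s0 s1 p1.
exists (fun k => x k - y k); split => // d v k d0 v1.
have [Hp Hn] := halfspace_jreg N0 lmu s0 p1 (hs0 k) d0 v1.
have /andP[k0 k1] := halfspace_const_le lmu ps0 v1.
set kap := halfspace_const mu v (p * s) in k0 k1 Hp Hn.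
have kfin : kap \is a fin_num by rewrite ge0_fin_numE// (le_lt_trans k1)// ltry.
have mp : measurable_fun setT (fun z => Num.max 0 (JU k d v z)) by exact: measurable_maxr.
have mn : measurable_fun setT (fun z => Num.max 0 (- JU k d v z)).
  by apply: measurable_maxr => //; exact: measurable_oppc.
have mK0 a z : Num.max 0 a * K z = Num.max 0 (a * K z) by rewrite maxr_pMl// mul0r.
have Ep : (\int[mu]_z (Num.max 0 (JU k d v z))%:E = (fine kap * (d `^ (- s) * x k))%:E)%E.
  rewrite EFinM fineK// EFinM -Px -Hp; apply: eq_integral => z _; congr EFin.
  by rewrite mK0.
have En : (\int[mu]_z (Num.max 0 (- JU k d v z))%:E = (fine kap * (d `^ (- s) * y k))%:E)%E.
  rewrite EFinM fineK// EFinM -Ny -Hn; apply: eq_integral => z _; congr EFin.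
  by rewrite mK0 mulNr.
have iJ : mu.-integrable setT (EFin \o JU k d v).
  apply: (@integrable_dom _ _ _ _ _ (fun z => Num.max 0 (JU k d v z) + Num.max 0 (- JU k d v z)) _ _ _ _ _).1.
  - exact: mJU.
  - exact: measurable_funD.
  - by move=> z; rewrite addr_ge0// le_max lexx.
  - apply: aeW => z; have [h|h] := ltP 0 (JU k d v z).
      by rewrite gtr0_norm// lerDl le_max lexx.
    by rewrite ler0_norm// (@max_r _ _ 0 (- _)) ?oppr_ge0// lerDr.
  - rewrite int_add//; [by rewrite Ep En -EFinD ltry| |]; by move=> z; rewrite le_max lexx.
split=> //; exists (fine kap); split.
  by rewrite -!lee_fin fineK// k0 k1.
rewrite integralE.
have -> : (\int[mu]_z ((fun z => (JU k d v z)%:E)^\+ z) = \int[mu]_z (Num.max 0 (JU k d v z))%:E)%E.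
  by apply: eq_integral => z _; rewrite funeposE EFin_max maxC.
have -> : (\int[mu]_z ((fun z => (JU k d v z)%:E)^\- z) = \int[mu]_z (Num.max 0 (- JU k d v z))%:E)%E.
  by apply: eq_integral => z _; rewrite funenegE EFin_max maxC.
by rewrite Ep En -EFinB; congr EFin; ring.
Qed.

(** The integral is the comparison error plus the half-space term. The latter tends to 0 for each
    [d], so [M] alone bounds the limit, but along the sequence it is only bounded by a multiple of
    [d^(-s)]. *)
Lemma regularized_limit (c : R) : 0 <= c -> exists2 M : R, 0 <= M &
  forall (d : R) (v : 'rV[R]_N) (del : Rn R N -> R), 0 < d -> eucl v = 1 -> measurable_fun setT del ->
   (forall z, 0 <= del z) -> (forall z, `|d - del z| <= eucl z) ->
   (forall z, del z <= Num.max 0 (d + dotv v z + c * eucl z ^+ 2)) ->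
   (forall z, d + dotv v z - c * eucl z ^+ 2 <= del z) ->
   (exists2 l : R, (\int[mu]_z (Ju k d del z)%:E)%E @[k --> \oo] --> l%:E & `|l| <= M) /\
   forall k, (`|\int[mu]_z (Ju k d del z)%:E| <= (M + M * d `^ (- s))%:E)%E.
Proof.
move=> c0; have [M M0 HM] := jreg_error_int N0 lmu s0 s1 p1 c0.
have [a [a0 Ha]] := halfspace_sequence.
have [S S0 HS] : exists2 S : R, 0 <= S & forall k, `|a k| <= S.
  exact: cvgn_bounded a0.
pose L := (N%:R + p * s) * 2 ^+ N.
have L0 : 0 <= L by rewrite mulr_ge0 ?exprn_ge0// addr_ge0// ltW.
(* [M] bounds the comparison error, [L] the half-space constants and [S] the sequence [a]. *)
exists (M + L * S); first by rewrite addr_ge0// mulr_ge0.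
move=> d v del d0 v1 mdel del0 ddel up low.
have [B [mB B0 iB HB]] := HM d v del d0 v1 del0 ddel up low.
have v1' : eucl v <= 1 by rewrite v1.
pose E k (z : Rn R N) := Ju k d del z - JU k d v z.
pose E' (z : Rn R N) := (spow (d `^ s - del z `^ s) (p - 1) - spow (d `^ s - Num.max 0 (d + dotv v z) `^ s) (p - 1)) * K z.
have mE k : measurable_fun setT (E k) by apply: measurable_funB; [exact: mJu|exact: mJU].
have mE' : measurable_fun setT E'.
  apply: measurable_funM => //; apply: measurable_funB; apply: measurable_spowc; mfun.
have EB : {ae mu, forall z k, `|E k z| <= B z}.
  apply: filterS HB => z h k; apply: le_trans (h _ (hs0 k)).
  by rewrite /E /Ju /JU -mulrBl normrM (ger0_norm (K0 z)).
have EE' z : E k z @[k --> \oo] --> E' z.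
  have -> : (fun k => E k z) = (fun k => (jreg (p - 1) k.+1%:R^-1 (d `^ s) (del z `^ s) -
      jreg (p - 1) k.+1%:R^-1 (d `^ s) (Num.max 0 (d + dotv v z) `^ s)) * K z).
    by apply/funext => k; rewrite /E /Ju /JU -mulrBl.
  apply: cvgM; last exact: cvg_cst.
  by apply: cvgB; exact: cvg_jreg.
have Boo : (\int[mu]_z (B z)%:E < +oo)%E by rewrite (le_lt_trans iB)// ltry.
have E'B : {ae mu, forall z, `|E' z| <= B z}.
  apply: filterS EB => z h.
  exact: cvgn_norm_le (EE' z) h.
have [iE' bE'] := integrable_dom mE' mB B0 E'B Boo.
have iE k : mu.-integrable setT (EFin \o E k) /\ (`|\int[mu]_z (E k z)%:E| <= M%:E)%E.
  have EBk : {ae mu, forall z, `|E k z| <= B z} by apply: filterS EB.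
  have [? h] := integrable_dom (mE k) mB B0 EBk Boo; split => //; exact: le_trans h _.
have cE : (\int[mu]_z (E k z)%:E)%E @[k --> \oo] --> (\int[mu]_z (E' z)%:E)%E.
  apply: (integral_dominated_cvg mE mE' mB B0 _ EB Boo); exact: aeW.
have [kap [kap0 HJ]] : exists kap : nat -> R, (forall k, 0 <= kap k <= L) /\
   forall k, (\int[mu]_z (JU k d v z)%:E = (kap k * (d `^ (- s) * a k))%:E)%E.
  have /choice[kap Hk] : forall k, exists kap : R, 0 <= kap <= L /\
     (\int[mu]_z (JU k d v z)%:E = (kap * (d `^ (- s) * a k))%:E)%E.
    by move=> k; have [_ H] := Ha d v k d0 v1'.
  by exists kap; split => k; have [] := Hk k.
have JE k : (\int[mu]_z (Ju k d del z)%:E = \int[mu]_z (E k z)%:E + (kap k * (d `^ (- s) * a k))%:E)%E.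
  have [iJU _] := Ha d v k d0 v1'; have [iEk _] := iE k.
  rewrite -HJ -integralD_EFin//; apply: eq_integral => z _; rewrite -EFinD.
  by rewrite /E subrK.
have M1 : M <= M + L * S by rewrite lerDl mulr_ge0.
split.
  have e'fin := integrable_fin_num measurableT iE'.
  exists (fine (\int[mu]_z (E' z)%:E)%E).
    rewrite fineK//.
    have c2 : ((kap k * (d `^ (- s) * a k))%:E @[k --> \oo] --> 0%E)%E.
      apply: cvg_EFin; first by near=> k.
      apply: norm_cvg0.
      apply: (@squeeze_cvgr _ _ _ _ (cst 0) (fun k => L * (d `^ (- s) * `|a k|))).
      - near=> k; rewrite normr_ge0/= normrM normrM (ger0_norm (powR_ge0 _ _)).
        have /andP[k0 kL] := kap0 k; rewrite (ger0_norm k0).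
        by rewrite ler_wpM2r// mulr_ge0 ?powR_ge0.
      - exact: cvg_cst.
      - rewrite -[X in _ --> X](mulr0 L); apply: cvgM; first exact: cvg_cst.
        rewrite -[X in _ --> X](mulr0 (d `^ (- s))); apply: cvgM; first exact: cvg_cst.
        by rewrite -[X in _ --> X](@normr0 _ R); exact: cvg_norm.
    have -> : (fun k => \int[mu]_z (Ju k d del z)%:E)%E = (fun k => \int[mu]_z (E k z)%:E + (kap k * (d `^ (- s) * a k))%:E)%E.
      by apply/funext => k; exact: JE.
    rewrite -(adde0 (\int[mu]_z (E' z)%:E)%E); apply: cvgeD => //.
    by rewrite fin_num_adde_defl.
  have : (`|(fine (\int[mu]_z (E' z)%:E))%:E| <= (M + L * S)%:E)%E.
    by rewrite fineK//; apply: le_trans bE' _; apply: le_trans iB _; rewrite lee_fin.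
  by [].
move=> k; rewrite JE; apply: (le_trans (lee_abs_add _ _)).
rewrite EFinD; apply: leeD.
  apply: le_trans (iE k).2 _; by rewrite lee_fin.
rewrite lee_fin normrM normrM (ger0_norm (powR_ge0 _ _)).
have /andP[k0 kL] := kap0 k; rewrite (ger0_norm k0).
apply: (@le_trans _ _ (L * (d `^ (- s) * S))).
  apply: ler_pM; rewrite ?mulr_ge0 ?powR_ge0// ler_wpM2l ?powR_ge0//.
have : 0 <= M * d `^ (- s) by rewrite mulr_ge0 ?powR_ge0.
rewrite mulrDl; lra.
Unshelve. all: by end_near. Qed.

End RegularizedLimit.

(** * The weak formulation *)

Section ProductIntegrals.
Set Implicit Arguments. Unset Strict Implicit.
Context {R : realType} d (T : measurableType d) (m : {sigma_finite_measure set T -> \bar R}).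
Implicit Types (f J : T -> T -> R) (phi : T -> R).

Lemma prod_integral f : measurable_fun setT (fun z : T * T => f z.1 z.2) -> (forall x y, 0 <= f x y) ->
  (\int[(m \x m)%E]_z (f z.1 z.2)%:E = \int[m]_x \int[m]_y (f x y)%:E)%E.
Proof.
move=> /measurable_EFinP mf f0.
have f0' (z : T * T) : (0 <= (EFin \o (fun z : T * T => f z.1 z.2)) z)%E by rewrite lee_fin.
exact: (@fubini_tonelli1 _ _ _ _ _ m m _ mf f0').
Qed.

Lemma measurable_fun_swap f : measurable_fun setT (fun z : T * T => f z.1 z.2) ->
  measurable_fun setT (fun z : T * T => f z.2 z.1).
Proof.
move=> mf; apply: (measurableT_comp (f := fun z : T * T => f z.1 z.2) (g := fun z : T * T => (z.2, z.1))) => //.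
by apply/measurable_fun_pairP; split; [exact: measurable_snd|exact: measurable_fst].
Qed.

Lemma prod_integral_swap f : measurable_fun setT (fun z : T * T => f z.1 z.2) -> (forall x y, 0 <= f x y) ->
  (\int[(m \x m)%E]_z (f z.2 z.1)%:E = \int[m]_x \int[m]_y (f x y)%:E)%E.
Proof.
move=> /measurable_fun_swap/measurable_EFinP mf f0.
have f0' (z : T * T) : (0 <= (EFin \o (fun z : T * T => f z.2 z.1)) z)%E by rewrite lee_fin.
exact: (@fubini_tonelli2 _ _ _ _ _ m m _ mf f0').
Qed.

Lemma measurable_section f x : measurable_fun setT (fun z : T * T => f z.1 z.2) ->
  measurable_fun setT (f x).
Proof.
move=> mf; apply: (measurableT_comp (f := fun z : T * T => f z.1 z.2) (g := fun y : T => (x, y))) => //.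
by apply/measurable_fun_pairP; split; [exact: measurable_cst|exact: measurable_id].
Qed.

Lemma measurable_section_integral f : measurable_fun setT (fun z : T * T => f z.1 z.2) ->
  measurable_fun setT (fun x => \int[m]_y (f x y)%:E)%E.
Proof.
move=> /measurable_EFinP mf; set F := EFin \o _ in mf.
rewrite (_ : (fun x => _) = (fun x => \int[m]_y (F^\+ (x, y)) - \int[m]_y (F^\- (x, y))))%E.
  apply: emeasurable_funB.
    apply: (@measurable_fun_fubini_tonelli_F _ _ _ _ _ m (F^\+)%E).
    - exact: measurable_funepos.
    - by move=> z; exact: funepos_ge0.
  apply: (@measurable_fun_fubini_tonelli_F _ _ _ _ _ m (F^\-)%E).
  - exact: measurable_funeneg.
  - by move=> z; exact: funeneg_ge0.
apply/funext => x; rewrite integralE; congr (_ - _)%E.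
  by apply: eq_integral => y _; rewrite !funeposE.
by apply: eq_integral => y _; rewrite !funenegE.
Qed.

(** Absolute convergence allows the terms with [phi z.1] and [phi z.2] to be integrated separately,
    in opposite orders. Exchanging the variables in [J] then identifies the second with minus the
    first. *)
Lemma antisymmetric_form J phi : measurable_fun setT (fun z : T * T => J z.1 z.2) ->
  measurable_fun setT phi -> (forall x y, J x y = - J y x) ->
  (forall x, phi x != 0 -> m.-integrable setT (EFin \o J x)) ->
  (\int[m]_x \int[m]_y (`|J x y| * `|phi x|)%:E < +oo)%E ->
  (\int[(m \x m)%E]_z (J z.1 z.2 * (phi z.1 - phi z.2))%:E =
   2%:E * \int[m]_x (phi x * fine (\int[m]_y (J x y)%:E))%:E)%E.
Proof.
move=> mJ mphi Janti iJ fin.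
pose g (z : T * T) := J z.1 z.2 * phi z.1; pose g' (z : T * T) := J z.1 z.2 * phi z.2.
have mg : measurable_fun setT (EFin \o g).
  by apply/measurable_EFinP; apply: measurable_funM => //; exact: measurableT_comp measurable_fst.
have mg' : measurable_fun setT (EFin \o g').
  by apply/measurable_EFinP; apply: measurable_funM => //; exact: measurableT_comp measurable_snd.
have ig : (m \x m)%E.-integrable setT (EFin \o g).
  apply/(integrable12ltyP _ _ mg); apply: le_lt_trans fin; rewrite le_eqVlt; apply/orP; left; apply/eqP.
  by apply: eq_integral => x _; apply: eq_integral => y _; rewrite /= /g/= normrM.
have ig' : (m \x m)%E.-integrable setT (EFin \o g').
  apply/(integrable21ltyP _ _ mg'); apply: le_lt_trans fin; rewrite le_eqVlt; apply/orP; left; apply/eqP.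
  by apply: eq_integral => y _; apply: eq_integral => x _; rewrite /= /g'/= normrM (Janti x y) normrN.
have E1 x : (\int[m]_y (J x y * phi x)%:E = (phi x * fine (\int[m]_y (J x y)%:E))%:E)%E.
  (* Where [phi] vanishes [J x] need not be integrable, but the product with the value of [fine] is
     0 anyway. *)
  have [->|px] := eqVneq (phi x) 0.
    by rewrite mul0r integral0_eq// => y _; rewrite mulr0.
  have iJx := iJ x px.
  under eq_integral do rewrite mulrC EFinM.
  by rewrite integralZl// EFinM fineK//; exact: integrable_fin_num.
rewrite (eq_integral (fun z : T * T => (EFin \o g) z - (EFin \o g') z)%E); last first.
  by move=> z _; rewrite /g /g' /= -EFinB mulrBr.
rewrite integralB//.
rewrite -(integral12_prod_meas1 ig) -(integral21_prod_meas1 ig').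
have -> : (\int[m]_y \int[m]_x (EFin \o g') (x, y) = - \int[m]_x (phi x * fine (\int[m]_y (J x y)%:E))%:E)%E.
  rewrite -integralN; last first.
    apply: integrable_add_def => //.
    rewrite (_ : (fun x => _) = fubini_F m (EFin \o g)); first exact: integrable_fubini_F.
    by apply/funext => x; rewrite -E1.
  apply: eq_integral => y _; rewrite -EFinN -mulNr.
  have [py|py] := eqVneq (phi y) 0.
    by rewrite py oppr0 mul0r integral0_eq// => x _; rewrite /g'/= py mulr0.
  have iJy := iJ y py.
  rewrite (eq_integral (fun x => (- phi y)%:E * (J y x)%:E)%E); last first.
    by move=> x _; rewrite /g'/= -EFinM (Janti x y); congr EFin; ring.
  by rewrite integralZl// EFinM fineK//; exact: integrable_fin_num.
have -> : (\int[m]_x \int[m]_y (EFin \o g) (x, y) = \int[m]_x (phi x * fine (\int[m]_y (J x y)%:E))%:E)%E.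
  by apply: eq_integral => x _; rewrite -E1; apply: eq_integral => y _.
by rewrite oppeK -mule2n mule_natl.
Qed.

(** By Tonelli the transpose of [A] or [B] has the same integral over the product, so finiteness in
    one order of integration is enough. *)
Lemma symmetric_sum_fin (E A B : T -> T -> R) :
  measurable_fun setT (fun z : T * T => E z.1 z.2) -> measurable_fun setT (fun z : T * T => A z.1 z.2) ->
  measurable_fun setT (fun z : T * T => B z.1 z.2) ->
  (forall x y, 0 <= E x y) -> (forall x y, 0 <= A x y) -> (forall x y, 0 <= B x y) ->
  (\int[(m \x m)%E]_z (E z.1 z.2)%:E < +oo)%E -> (\int[m]_x \int[m]_y (A x y)%:E < +oo)%E ->
  (\int[m]_x \int[m]_y (B x y)%:E < +oo)%E ->
  let W (z : T * T) := E z.1 z.2 + ((A z.1 z.2 + A z.2 z.1) + (B z.1 z.2 + B z.2 z.1)) in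
  [/\ measurable_fun setT W, (forall z, 0 <= W z) & (\int[(m \x m)%E]_z (W z)%:E < +oo)%E].
Proof.
move=> mE mA mB E0 A0 B0 fE fA fB W.
have sym f : measurable_fun setT (fun z : T * T => f z.1 z.2) -> (forall x y, 0 <= f x y) ->
    (\int[m]_x \int[m]_y (f x y)%:E < +oo)%E ->
    measurable_fun setT (fun z : T * T => f z.1 z.2 + f z.2 z.1) /\
    (\int[(m \x m)%E]_z (f z.1 z.2 + f z.2 z.1)%:E < +oo)%E.
  move=> mf f0 ff; have mf' := measurable_fun_swap mf; split; first exact: measurable_funD.
  rewrite int_add//; apply: lte_add_pinfty.
    by rewrite prod_integral.
  by rewrite prod_integral_swap.
have [mAA fAA] := sym _ mA A0 fA; have [mBB fBB] := sym _ mB B0 fB.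
have A0' (z : T * T) : 0 <= A z.1 z.2 + A z.2 z.1 by rewrite addr_ge0.
have B0' (z : T * T) : 0 <= B z.1 z.2 + B z.2 z.1 by rewrite addr_ge0.
have mAB : measurable_fun setT (fun z : T * T => (A z.1 z.2 + A z.2 z.1) + (B z.1 z.2 + B z.2 z.1)).
  exact: measurable_funD.
split.
- exact: measurable_funD.
- by move=> z; rewrite /W !addr_ge0.
- rewrite int_add//; last by move=> z; rewrite addr_ge0.
  by apply: lte_add_pinfty => //; rewrite int_add//; exact: lte_add_pinfty.
Qed.

End ProductIntegrals.

Section TubularPoints.
Set Implicit Arguments. Unset Strict Implicit.
Context {R : realType} {n : nat}.
Local Notation N := n.+1.
Context (mu : {sigma_finite_measure set (Rn R N) -> \bar R}) (lmu : is_lebesgue mu).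
Context (O : set 'rV[R]_N) (oO : open O) (bO : boundedset O).
Lemma bounded_compl_neq0 : (~` O) !=set0.
Proof.
have [M HM] := bO; exists (const_mx (`|M| + 1)) => /HM h.
have := coord_le_eucl (const_mx (`|M| + 1) : 'rV[R]_N) ord0; rewrite mxE ger0_norm ?addr_ge0// => h'.
by have := ler_norm M; lra.
Qed.
Local Notation neO := bounded_compl_neq0.

Lemma continuous_distc : continuous (distc O).
Proof. by apply: (@continuous_lipeucl _ _ _ 1) => a b; rewrite mul1r; exact: distc_lip neO _ _. Qed.

Lemma measurable_distc : measurable_fun setT (distc O : Rn R N -> R).
Proof. by apply: continuous_measurable_Rn; exact: continuous_distc. Qed.

Lemma open_lt_distc (r : R) : open [set x : 'rV[R]_N | distc O x < r].
Proof.
rewrite (_ : [set x | _] = distc O @^-1` [set t | t < r])//.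
by apply: open_comp => [x _|]; [exact: continuous_distc|exact: open_lt].
Qed.

Lemma bounded_measure_fin (A : set (Rn R N)) : measurable A -> boundedset A -> (mu A < +oo)%E.
Proof.
move=> mA [M HM]; apply: (@le_lt_trans _ _ (mu [set y : Rn R N | (eucl ((y : 'rV[R]_N) - 0) < `|M| + 1)%R])).
  apply: le_measure; rewrite ?inE//.
    rewrite -[X in measurable X]setTI.
    have : measurable_fun setT (fun z : Rn R N => (eucl ((z : 'rV[R]_N) - 0) < `|M| + 1)%R) by mfun.
    by move=> /(_ measurableT [set true]); rewrite /preimage/=; apply.
  by move=> z /HM h /=; rewrite subr0; have := ler_norm M; lra.
by apply: (le_lt_trans (lebesgue_ball lmu 0 _)); rewrite ?addr_ge0// ltry.
Qed.

(** For [d < r0/2] both radii [r0 - d] and [r0 + d] are at least [r0/2], which turns the quadratic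
    error of [eucl_le_tangent] into [eucl z ^+ 2 / r0]. This fixes the width of the boundary
    layer. *)
Lemma distc_ball_bounds (r0 : R) (x v z : 'rV[R]_N) : 0 < r0 -> O x -> distc O x < r0 / 2 -> eucl v = 1 ->
  (forall y, eucl (y - (x + (r0 - distc O x) *: v)) < r0 -> O y) ->
  (forall y, eucl (y - (x - (r0 + distc O x) *: v)) < r0 -> ~ O y) ->
  distc O (z + x) <= Num.max 0 (distc O x + dotv v z + r0^-1 * eucl z ^+ 2) /\
  distc O x + dotv v z - r0^-1 * eucl z ^+ 2 <= distc O (z + x).
Proof.
move=> r00 Ox; set d := distc O x => dr v1 vin vout.
have d0 : 0 < d by exact: distc_gt0 oO neO _ Ox.
have z20 : 0 <= eucl z ^+ 2 by exact: sqr_ge0.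
have inv_le (A : R) : r0 / 2 <= A -> eucl z ^+ 2 / (2 * A) <= r0^-1 * eucl z ^+ 2.
  move=> rA; rewrite mulrC ler_wpM2r// lef_pV2 ?posrE//; lra.
split.
  rewrite le_max; have [Oz|Oz] := pselect (O (z + x)); last by rewrite (distc_notin neO Oz) lexx.
  apply/orP; right; apply: (le_trans (distc_ball_le r00 vout Oz)).
  have -> : z + x - (x - (r0 + d) *: v) = z + (r0 + d) *: v by apply/rowP => i; rewrite !mxE; ring.
  have A0 : 0 < r0 + d by rewrite addr_gt0.
  have := eucl_le_tangent z A0 v1; have := inv_le (r0 + d); lra.
apply: (le_trans _ (distc_ball_ge neO (z + x) vin)).
have -> : z + x - (x + (r0 - d) *: v) = z + (r0 - d) *: (- v) by apply/rowP => i; rewrite !mxE; ring.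
have A0 : 0 < r0 - d by lra.
have v1' : eucl (- v) = 1 by rewrite euclN.
have := eucl_le_tangent z A0 v1'; rewrite dotvNl; have := inv_le (r0 - d); lra.
Qed.

End TubularPoints.

(** * Integrability estimates and the pointwise Hardy inequality *)

Section Estimates.
Set Implicit Arguments. Unset Strict Implicit.
Context {R : realType} {n : nat}.
Local Notation N := n.+1.
Context (mu : {sigma_finite_measure set (Rn R N) -> \bar R}) (lmu : is_lebesgue mu).
Context (O : set 'rV[R]_N) (oO : open O) (bO : boundedset O).
Context (s p : R) (s0 : 0 < s) (s1 : s < 1) (p1 : 1 < p).
Let N0 : (0 < N)%N. Proof. by []. Qed.
Let neO := bounded_compl_neq0 bO.
Let p0 : 0 < p. Proof. exact: lt_trans ltr01 p1. Qed.
Let ps0 : 0 < p * s. Proof. by rewrite mulr_gt0. Qed.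
Let Nps0 : 0 < N%:R + p * s :> R. Proof. by rewrite addr_gt0. Qed.
Let K (z : Rn R N) := eucl z `^ (- (N%:R + p * s)).
Let mK : measurable_fun setT K. Proof. by rewrite /K; mfun. Qed.
Let K0 z : 0 <= K z. Proof. exact: powR_ge0. Qed.
Let dd : Rn R N -> R := distc O.
Let mdd : measurable_fun setT dd. Proof. exact: measurable_distc bO. Qed.
Let dd0 x : 0 <= dd x. Proof. exact: distc_ge0 neO x. Qed.
Let u (x : Rn R N) : R := dd x `^ s.

Let msub (x : Rn R N) : measurable_fun setT (fun y : Rn R N => (x : 'rV[R]_N) - y : Rn R N).
Proof. by mfun. Qed.

Let mKsub (x : 'rV[R]_N) : measurable_fun setT (fun y : Rn R N => K (x - y)).
Proof. exact: measurableT_comp mK (msub x). Qed.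

Let mu_ : measurable_fun setT u. Proof. exact: measurable_powRl. Qed.

Let mdiff (f : Rn R N -> R) (x : Rn R N) : measurable_fun setT f ->
  measurable_fun setT (fun y => `|f x - f y| `^ p * K (x - y)).
Proof.
move=> mf; apply: measurable_funM; last exact: mKsub.
apply: measurable_powRl; apply: measurable_normrc; apply: measurable_funB => //; exact: measurable_cst.
Qed.

Lemma convolve_eucl (x : 'rV[R]_N) (g : R -> R) : measurable_fun setT (g : measurableTypeR R -> R) ->
  (forall r, 0 <= g r) ->
  (\int[mu]_y (g (eucl (x - y)))%:E = \int[mu]_z (g (eucl z))%:E)%E.
Proof.
move=> mg g0; rewrite (ge0_integral_translate N0 lmu x); last by move=> y; rewrite lee_fin.
  apply: eq_integral => z _; congr (g _)%:E.
  by rewrite (_ : x - (z + x) = - z) ?euclN//; apply/rowP => i; rewrite !mxE; ring.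
apply/measurable_EFinP; apply: (measurableT_comp (f := g : measurableTypeR R -> R)) => //.
exact: measurable_euclc.
Qed.

Lemma far_difference_bound : exists2 C : R, 0 <= C & forall (x : 'rV[R]_N) (d : R), 0 < d ->
  (\int[mu]_y ((d <= eucl (x - y))%R%:R * (eucl (x - y) `^ (s * (p - 1)) * K (x - y)))%:E <= (C * d `^ (- s))%:E)%E.
Proof.
exists ((N%:R + s) * 2 ^+ N / s).
  by rewrite mulr_ge0 ?invr_ge0 ?(ltW s0)// mulr_ge0 ?exprn_ge0// addr_ge0// ltW.
move=> x d d0.
rewrite (convolve_eucl x (g := fun r => (d <= r)%R%:R * (r `^ (s * (p - 1)) * r `^ (- (N%:R + p * s)))))//.
- apply: le_trans (far_kernel_bound lmu s0 d0).
  rewrite le_eqVlt; apply/orP; left; apply/eqP; apply: eq_integral => z _; congr EFin.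
  have [dz|_] := leP d (eucl z); last by rewrite !mul0r.
  by rewrite -powR_addp ?(lt_le_trans d0)//; congr (_ * _ `^ _); ring.
- by mfun.
- by move=> r; rewrite !mulr_ge0 ?powR_ge0.
Qed.

(** Within [dd x] of [x], [|u x - u y|^p] is at most [d^((s-1)p) |x - y|^p]. The kernel integral
    then gives [d^(p - ps)], and the powers of [d] cancel. *)
Lemma near_difference_bound : exists2 C : R, 0 <= C & forall (x : 'rV[R]_N), 0 < dd x ->
  (\int[mu]_y ((eucl (x - y) < dd x)%R%:R * (`|u x - u y| `^ p * K (x - y)))%:E <= C%:E)%E.
Proof.
have pps0 : 0 < p - p * s by rewrite -{1}(mulr1 p) -mulrBr mulr_gt0 ?subr_gt0.
have [C C0 HC] := near_power_bound N0 lmu pps0.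
exists C => // x dx0.
pose g (r : R) := dd x `^ ((s - 1) * p) * ((r < dd x)%R%:R * (r `^ p * r `^ (- (N%:R + p * s)))).
have mg : measurable_fun setT (g : measurableTypeR R -> R).
  by rewrite /g; move: (dd x) => D; clear -D p s; mfun.
have g0 r : 0 <= g r by rewrite /g !mulr_ge0 ?powR_ge0.
apply: (@le_trans _ _ (\int[mu]_y (g (eucl (x - y)))%:E)%E).
  apply: int_le.
  - apply: measurable_funM; last exact: mdiff.
    by apply: measurable_natr; apply: measurable_fun_ltr => //; apply: measurable_euclc; exact: msub.
  - by apply: (measurableT_comp (f := g : measurableTypeR R -> R)) => //; apply: measurable_euclc; exact: msub.
  - by move=> y; rewrite !mulr_ge0 ?powR_ge0.
  - move=> y; rewrite /g (mulrCA (dd x `^ _)) ler_wpM2l// mulrA ler_wpM2r// powRrM -powRM ?powR_ge0 ?eucl_ge0//.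
    rewrite ge0_ler_powR ?nnegrE ?(ltW p0) ?mulr_ge0 ?powR_ge0 ?eucl_ge0//.
    apply: (le_trans (powR_dist_lip dx0 (dd0 y) s0 (ltW s1))).
    by rewrite ler_wpM2l ?powR_ge0//; exact: distc_lip neO _ _.
rewrite convolve_eucl// /g int_scale ?powR_ge0//; [|by mfun|by move=> z; rewrite !mulr_ge0 ?powR_ge0].
apply: (@le_trans _ _ ((dd x `^ ((s - 1) * p))%:E * (C * dd x `^ (p - p * s))%:E)%E).
  apply: lee_wpmul2l; first by rewrite lee_fin powR_ge0.
  apply: le_trans (HC _ dx0); rewrite le_eqVlt; apply/orP; left; apply/eqP.
  apply: eq_integral => z _; congr (_ * _)%:E.
  have [->|z0] := eqVneq (eucl z) 0.
    by rewrite [X in _ * X]powR0 ?oppr_eq0 ?gt_eqF// [X in _ = _ * X]powR0 ?oppr_eq0 ?gt_eqF// !mulr0.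
  by rewrite -!powR_addp ?lt_def ?z0 ?eucl_ge0//; congr (_ `^ _); ring.
rewrite -EFinM mulrCA -powR_addp// (_ : (s - 1) * p + (p - p * s) = 0) ?powRr0 ?mulr1//; ring.
Qed.

Context (r0 : R) (r00 : 0 < r0).
Hypothesis tangent : forall x, O x -> distc O x < r0 / 2 -> exists v : 'rV[R]_N,
    [/\ eucl v = 1, forall y, eucl (y - (x + (r0 - distc O x) *: v)) < r0 -> O y &
     forall y, eucl (y - (x - (r0 + distc O x) *: v)) < r0 -> ~ O y].

(** The integral is restricted to a ball of radius [d] outside the domain, all of whose points are
    within [3 d] of [x] and where [phi] is 0. In the constant, 3 comes from this distance and [N^N]
    from [lebesgue_ball_ge]. *)
Lemma hardy_pointwise : exists2 C : R, 0 <= C & forall (phi : Rn R N -> R) (x : 'rV[R]_N),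
  measurable_fun setT phi -> (forall y, ~ O y -> phi y = 0) -> O x -> dd x < r0 / 2 ->
  ((`|phi x| `^ p * dd x `^ (- (p * s)))%:E <= C%:E * \int[mu]_y (`|phi x - phi y| `^ p * K (x - y))%:E)%E.
Proof.
pose C : R := 3 `^ (N%:R + p * s) * N%:R ^+ N; have C0 : 0 <= C by rewrite mulr_ge0 ?powR_ge0 ?exprn_ge0.
exists C => // phi x mphi phiO Ox dr; set d := dd x.
have d0 : 0 < d by exact: distc_gt0 oO neO _ Ox.
have [v [v1 _ vout]] := tangent Ox dr.
pose c := x - (2 * d) *: v.
pose a := `|phi x| `^ p * (3 * d) `^ (- (N%:R + p * s)).
have a0 : 0 <= a by rewrite mulr_ge0 ?powR_ge0.
pose b (y : Rn R N) : R := (eucl ((y : 'rV[R]_N) - c) < d)%R%:R.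
have mb : measurable_fun setT b by rewrite /b; mfun.
have bmu : (\int[mu]_y (b y)%:E = mu [set y : Rn R N | (eucl ((y : 'rV[R]_N) - c) < d)%R])%E.
  rewrite -[in RHS](setIT [set y | _]) -integral_indic//; last first.
    rewrite -[X in measurable X]setTI.
    have : measurable_fun setT (fun z : Rn R N => (eucl ((z : 'rV[R]_N) - c) < d)%R) by mfun.
    by move=> /(_ measurableT [set true]); rewrite /preimage/=; apply.
  apply: eq_integral => y _; rewrite indicE; congr (nat_of_bool _)%:R%:E.
  by apply/idP/idP => h; [rewrite inE|rewrite inE in h].
have lower : ((a * (d / N%:R) ^+ N)%:E <= \int[mu]_y (`|phi x - phi y| `^ p * K (x - y))%:E)%E.
  rewrite EFinM; apply: (@le_trans _ _ (a%:E * \int[mu]_y (b y)%:E)%E).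
    by apply: lee_wpmul2l; [rewrite lee_fin|rewrite bmu; exact: lebesgue_ball_ge].
  rewrite -int_scale//; apply: int_le.
  - exact: measurable_funM.
  - exact: mdiff.
  - by move=> y; rewrite mulr_ge0.
  - move=> y; rewrite /b; have [yc|_] := ltP; last by rewrite mulr0 mulr_ge0 ?powR_ge0.
    (* The centres are [r0 - d] apart, so the ball of radius [d] about [c] lies in the exterior
       tangent ball of radius [r0]. *)
    have Oy : ~ O y.
      apply: vout; apply: (le_lt_trans (ler_eucl_dist _ c _)).
      rewrite (_ : c - (x - (r0 + distc O x) *: v) = (r0 - d) *: v); last first.
        by apply/rowP => i; rewrite /c /d /dd !mxE; ring.
      by rewrite euclZ v1 mulr1 ger0_norm; lra.
    rewrite mulr1 (phiO y Oy) subr0 ler_wpM2l ?powR_ge0//.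
    have xy0 : 0 < eucl (x - y).
      by apply: lt_le_trans d0 _; exact: distc_le Oy.
    apply: le0_powR => //; last by rewrite oppr_le0 ltW.
    have := ler_eucl_dist x c y; rewrite (euclB c y).
    rewrite (_ : x - c = (2 * d) *: v); last by apply/rowP => i; rewrite /c !mxE; ring.
    by rewrite euclZ v1 mulr1 ger0_norm; lra.
apply: le_trans (lee_wpmul2l _ lower); last by rewrite lee_fin.
rewrite -EFinM lee_fin le_eqVlt; apply/orP; left; apply/eqP; rewrite /C /a.
rewrite powRM ?(ltW d0)// expr_div_n -(powR_mulrn N (ltW d0)).
have -> : d `^ (- (p * s)) = d `^ (- (N%:R + p * s)) * d `^ N%:R.
  by rewrite -powR_addp//; congr (_ `^ _); ring.
have : 3 `^ (N%:R + p * s) * 3 `^ (- (N%:R + p * s)) = 1 :> R by rewrite -powR_addp// subrr powRr0.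
have : N%:R ^+ N * (N%:R ^+ N)^-1 = 1 :> R by rewrite mulfV// expf_neq0// gt_eqF.
set X := 3 `^ _; set Y := 3 `^ _; set Z := N%:R ^+ N; set W := Z^-1 => ZW XY.
transitivity (`|phi x| `^ p * (d `^ (- (N%:R + p * s)) * d `^ N%:R) * (X * Y) * (Z * W)).
  by rewrite XY ZW !mulr1.
ring.
Qed.

End Estimates.

(** * Passage to the limit in the weak formulation *)

Section WeakSolution.
Set Implicit Arguments. Unset Strict Implicit.
Context {R : realType} {n : nat}.
Local Notation N := n.+1.
Context (mu : {sigma_finite_measure set (Rn R N) -> \bar R}) (lmu : is_lebesgue mu).
Context (O : set 'rV[R]_N) (oO : open O) (bO : boundedset O).
Context (s p : R) (s0 : 0 < s) (s1 : s < 1) (p1 : 1 < p).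
Let N0 : (0 < N)%N. Proof. by []. Qed.
Let neO := bounded_compl_neq0 bO.
Let p0 : 0 < p. Proof. exact: lt_trans ltr01 p1. Qed.
Let ps0 : 0 < p * s. Proof. by rewrite mulr_gt0. Qed.
Let q0 : 0 < p - 1. Proof. by rewrite subr_gt0. Qed.
Let K (z : Rn R N) := eucl z `^ (- (N%:R + p * s)).
Let mK : measurable_fun setT K. Proof. by rewrite /K; mfun. Qed.
Let K0 z : 0 <= K z. Proof. exact: powR_ge0. Qed.
Let dd : Rn R N -> R := distc O.
Let mdd : measurable_fun setT dd. Proof. exact: measurable_distc bO. Qed.
Let dd0 x : 0 <= dd x. Proof. exact: distc_ge0 neO x. Qed.
Let u (x : Rn R N) : R := dd x `^ s.

Let msub (x : Rn R N) : measurable_fun setT (fun y : Rn R N => (x : 'rV[R]_N) - y : Rn R N).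
Proof. by mfun. Qed.

Let mKsub (x : 'rV[R]_N) : measurable_fun setT (fun y : Rn R N => K (x - y)).
Proof. exact: measurableT_comp mK (msub x). Qed.

Let mu_ : measurable_fun setT u. Proof. exact: measurable_powRl. Qed.

Context (r0 : R) (r00 : 0 < r0).
Hypothesis tangent : forall x, O x -> distc O x < r0 / 2 -> exists v : 'rV[R]_N,
    [/\ eucl v = 1, forall y, eucl (y - (x + (r0 - distc O x) *: v)) < r0 -> O y &
     forall y, eucl (y - (x - (r0 + distc O x) *: v)) < r0 -> ~ O y].

Let rho := r0 / 2.
Let U : set (Rn R N) := [set x | O x /\ dd x < rho].
Let J (k : nat) (x y : Rn R N) : R := jreg (p - 1) k.+1%:R^-1 (u x) (u y) * K (x - y).
(** This is half of [f_h] with [h = 1/(k+1)]; the factor 2 reappears in [antisymmetric_form] and in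
    the final right-hand side. *)
Let G (k : nat) (x : Rn R N) : \bar R := (\int[mu]_y (J k x y)%:E)%E.

Let hs0 k : 0 < k.+1%:R^-1 :> R. Proof. by rewrite invr_gt0. Qed.

Let m1 (f : Rn R N -> R) : measurable_fun setT f -> measurable_fun setT (fun z : Rn R N * Rn R N => f z.1).
Proof. by move=> mf; apply: (measurableT_comp mf); exact: measurable_fst. Qed.

Let m2 (f : Rn R N -> R) : measurable_fun setT f -> measurable_fun setT (fun z : Rn R N * Rn R N => f z.2).
Proof. by move=> mf; apply: (measurableT_comp mf); exact: measurable_snd. Qed.

Let mes : measurable_fun setT (fun z : Rn R N * Rn R N => eucl (z.1 - z.2)).
Proof. by clear; mfun. Qed.

Let mKs : measurable_fun setT (fun z : Rn R N * Rn R N => K (z.1 - z.2)).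
Proof. exact: measurable_powRl mes. Qed.

Let mJ k : measurable_fun setT (fun z : Rn R N * Rn R N => J k z.1 z.2).
Proof.
apply: measurable_funM; last exact: mKs.
by apply: measurable_jreg; [exact: m1|exact: m2].
Qed.

Let KC (x y : Rn R N) : K (x - y) = K (y - x). Proof. by rewrite /K euclB. Qed.

Let J_anti k x y : J k x y = - J k y x.
Proof.
have e1 : jreg (p - 1) k.+1%:R^-1 (u x) (u y) = - jreg (p - 1) k.+1%:R^-1 (u y) (u x) by exact: jregC.
transitivity (- jreg (p - 1) k.+1%:R^-1 (u y) (u x) * K (y - x)); last exact: mulNr.
by apply: (f_equal2 _ e1); exact: KC.
Qed.

Let shift (x z : 'rV[R]_N) : x - (z + x) = - z.
Proof. by apply/rowP => i; rewrite !mxE; ring. Qed.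

Let del_lip x z : `|dd x - dd (z + x)| <= eucl z.
Proof. by apply: (le_trans (distc_lip neO _ _)); rewrite shift euclN. Qed.

Let mdel x : measurable_fun setT (fun z : Rn R N => dd ((z : 'rV[R]_N) + x)).
Proof.
apply: (measurableT_comp mdd (g := fun z : Rn R N => (z : 'rV[R]_N) + x : Rn R N)).
by apply: measurable_addv; [exact: measurable_id|exact: measurable_cst].
Qed.

Let G_shift k x : G k x = (\int[mu]_z (jreg (p - 1) k.+1%:R^-1 (dd x `^ s) (dd ((z : 'rV[R]_N) + x) `^ s) * K z)%:E)%E.
Proof.
rewrite /G (integral_translate N0 lmu x); last first.
  by apply/measurable_EFinP; exact: (measurable_section _ (mJ k)).
by apply: eq_integral => z _; rewrite /J /K shift euclN.
Qed.

(** Here [C] depends on [k]: the bound provides absolute convergence at fixed [k], while the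
    estimates uniform in [k] are those of [reg], where the sign of [J] is used. *)
Let abs_bound k : exists2 C : R, 0 <= C & forall x, O x ->
  (\int[mu]_y (`|J k x y|)%:E <= (C * dd x `^ (- s))%:E)%E.
Proof.
have [C C0 HC] := jreg_int_bound N0 lmu s0 s1 p1 (hs0 k).
exists C => // x Ox; have dx0 : 0 < dd x by exact: distc_gt0 oO neO _ Ox.
apply: le_trans (HC _ (fun z : Rn R N => dd ((z : 'rV[R]_N) + x)) dx0 (mdel x) (fun z => dd0 _) (del_lip x)).
rewrite (ge0_integral_translate N0 lmu x); last by move=> y; rewrite lee_fin.
  rewrite le_eqVlt; apply/orP; left; apply/eqP.
  by apply: eq_integral => z _; rewrite /J /K shift euclN normrM (ger0_norm (powR_ge0 _ _)).
apply/measurable_EFinP; apply: measurable_normrc; exact: (measurable_section _ (mJ k)).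
Qed.

Let J_integrable k x : O x -> mu.-integrable setT (EFin \o J k x).
Proof.
move=> Ox; have [C C0 HC] := abs_bound k.
have mJx : measurable_fun setT (J k x) by exact: (measurable_section _ (mJ k)).
apply: (@integrable_dom _ _ _ _ _ (fun y => `|J k x y|) mJx _ _ _ _).1 => //.
- exact: measurable_normrc.
- by apply: aeW.
- by apply: (le_lt_trans (HC x Ox)); rewrite ltry.
Qed.

Let reg : exists2 M : R, 0 <= M & forall x, U x ->
  (exists2 l : R, G k x @[k --> \oo] --> l%:E & `|l| <= M) /\
  forall k, (`|G k x| <= (M + M * dd x `^ (- s))%:E)%E.
Proof.
have c0 : 0 <= r0^-1 by rewrite invr_ge0 ltW.
have [M M0 HM] := regularized_limit N0 lmu s0 s1 p1 c0.
exists M => // x [Ox dr]; have dx0 : 0 < dd x by exact: distc_gt0 oO neO _ Ox.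
have [v [v1 vin vout]] := tangent Ox dr.
have bnd z := distc_ball_bounds oO bO z r00 Ox dr v1 vin vout.
have [[l lc lM] H] := HM _ v (fun z : Rn R N => dd ((z : 'rV[R]_N) + x)) dx0 v1 (mdel x) (fun z => dd0 _) (del_lip x)
  (fun z => (bnd z).1) (fun z => (bnd z).2).
split; last by move=> k; rewrite G_shift.
exists l; last exact: lM.
by under eq_fun do rewrite G_shift.
Qed.

(** Convergence is known only in [U]; elsewhere the value is arbitrary, and test functions vanish
    there. *)
Let flim (x : Rn R N) : R := limn (fun k => fine (G k x)).

Let mG k : measurable_fun setT (fun x => fine (G k x)).
Proof.
have mGk : measurable_fun setT (fun x => G k x) by exact: (@measurable_section_integral _ _ _ mu (J k) (mJ k)).
by apply: (measurableT_comp (f := @fine R)).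
Qed.

Let flim_cvg x : U x -> fine (G k x) @[k --> \oo] --> flim x.
Proof.
have [M M0 HM] := reg => Ux; have [[l lc lM] _] := HM x Ux.
have c : fine (G k x) @[k --> \oo] --> l by exact: fine_cvg lc.
by rewrite /flim (cvg_lim _ c).
Qed.

Lemma linfty_limit : Linfty mu U (fun x => 2 * flim x).
Proof.
have [M M0 HM] := reg; split.
  apply: measurable_funM => //.
  apply: (@measurable_fun_cvg _ _ _ U (fun k x => fine (G k x))).
  - by move=> k; apply: measurable_funTS; exact: mG.
  - by move=> x Ux; exact: flim_cvg.
exists (2 * M); apply: aeW => x Ux; have [[l lc lM] _] := HM x Ux.
have c : fine (G k x) @[k --> \oo] --> l by exact: fine_cvg lc.
by rewrite /flim (cvg_lim _ c)// normrM ger0_norm// ler_wpM2l.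
Qed.

Lemma powR_young_split (a b : R) : 0 <= a -> 0 <= b -> a `^ (p - 1) * b <= a `^ p + b `^ p.
Proof.
move=> a0 b0; have [ab|ba] := leP a b.
  have [b00|bn0] := eqVneq b 0.
    by rewrite b00 mulr0 addr_ge0 ?powR_ge0.
  have bp : 0 < b by rewrite lt_def bn0.
  apply: (@le_trans _ _ (b `^ p)); last by rewrite lerDr powR_ge0.
  by rewrite (powR_split p bp) mulrC ler_wpM2l// ge0_ler_powR ?nnegrE ?(ltW q0).
have ap : 0 < a := le_lt_trans b0 ba.
apply: (@le_trans _ _ (a `^ p)); last by rewrite lerDl powR_ge0.
by rewrite (powR_split p ap) mulrC ler_wpM2r ?powR_ge0// ltW.
Qed.

Lemma le_powR_add1 (a : R) : 0 <= a -> a <= a `^ p + 1.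
Proof.
move=> a0; have := powR_young_split (@ler01 R) a0.
by rewrite !powR1 mul1r addrC.
Qed.

Section TestFunction.
Context (U' : set 'rV[R]_N) (oU' : open U') (U'U : U' `<=` U).
Context (phi : Rn R N -> R) (mphi : measurable_fun setT phi) (phi0 : forall x, ~ U' x -> phi x = 0).
Hypothesis phip : (\int[mu]_x (`|phi x| `^ p)%:E < +oo)%E.
Let E (x y : Rn R N) : R := `|phi x - phi y| `^ p * K (x - y).
Hypothesis phiE : (\int[(mu \x mu)%E]_z (E z.1 z.2)%:E < +oo)%E.

Let U'O x : U' x -> O x. Proof. by move=> /U'U[]. Qed.
Let phiO y : ~ O y -> phi y = 0. Proof. by move=> Oy; apply: phi0 => /U'O. Qed.
Let phiU x : phi x != 0 -> U x.
Proof. by move=> px; apply: U'U; apply: contrapT => /phi0 h; rewrite h eqxx in px. Qed.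

Let E0 x y : 0 <= E x y. Proof. by rewrite mulr_ge0 ?powR_ge0. Qed.

Let mE : measurable_fun setT (fun z : Rn R N * Rn R N => E z.1 z.2).
Proof.
apply: measurable_funM; last exact: mKs.
by apply: measurable_powRl; apply: measurable_normrc; apply: measurable_funB; [exact: m1|exact: m2].
Qed.

(** [PP] is the Hardy integrand and equals the power [p] of [Phi]. As [U'] has finite measure,
    integrability of [PP] passes to [Phi], the weight that controls [phi] times [d^(-s)]. *)
Let PP (x : Rn R N) : R := `|phi x| `^ p * dd x `^ (- (p * s)).
Let Phi (x : Rn R N) : R := `|phi x| * dd x `^ (- s).
Let chi (x : Rn R N) : R := \1_(U' : set (Rn R N)) x.

Let mPP : measurable_fun setT PP.
Proof.
by apply: measurable_funM; apply: measurable_powRl => //; exact: measurable_normrc.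
Qed.
Let mPhi : measurable_fun setT Phi.
Proof.
by apply: measurable_funM; [exact: measurable_normrc|exact: measurable_powRl].
Qed.
Let mU' : measurable (U' : set (Rn R N)). Proof. exact: measurable_open. Qed.
Let mchi : measurable_fun setT chi. Proof. exact: measurable_indic. Qed.
Let chi0 x : 0 <= chi x. Proof. by rewrite /chi indicE. Qed.
Let PP0 x : 0 <= PP x. Proof. by rewrite mulr_ge0 ?powR_ge0. Qed.
Let Phi0 x : 0 <= Phi x. Proof. by rewrite mulr_ge0 ?powR_ge0. Qed.

Let chi_fin : (\int[mu]_x (chi x)%:E < +oo)%E.
Proof.
rewrite integral_indic// setIT; apply: (bounded_measure_fin lmu) => //.
by have [M HM] := bO; exists M => x /U'O; exact: HM.
Qed.

Let hardy : (\int[mu]_x (PP x)%:E < +oo)%E.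
Proof.
have [C C0 HC] := hardy_pointwise lmu oO bO s0 p1 tangent.
have mI : measurable_fun setT (fun x => \int[mu]_y (E x y)%:E)%E.
  exact: (@measurable_section_integral _ _ _ mu E mE).
have I0 x : (0 <= \int[mu]_y (E x y)%:E)%E by apply: integral_ge0 => y _; rewrite lee_fin.
apply: (@le_lt_trans _ _ (\int[mu]_x (C%:E * \int[mu]_y (E x y)%:E))%E).
  apply: ge0_le_integral => //.
  - by move=> x _; rewrite lee_fin.
  - by apply/measurable_EFinP.
  - exact: measurable_funeM.
  - move=> x _; have [px|px] := eqVneq (phi x) 0.
      by rewrite /PP px normr0 powR0 ?gt_eqF// mul0r mule_ge0.
    by have [Ox dr] := phiU px; exact: HC.
rewrite ge0_integralZl_EFin// -(@prod_integral _ _ _ mu E mE E0).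
exact: lte_mul_pinfty.
Qed.

Let Phi_fin : (\int[mu]_x (Phi x)%:E < +oo)%E.
Proof.
apply: (@le_lt_trans _ _ (\int[mu]_x (PP x + chi x)%:E)%E); last first.
  by rewrite int_add//; apply: lte_add_pinfty.
apply: int_le => //; first exact: measurable_funD.
move=> x; have [Ux|Ux] := pselect (U' x); last first.
  by rewrite /Phi phi0// normr0 mul0r addr_ge0.
have -> : chi x = 1 by rewrite /chi indicE mem_set.
have -> : PP x = Phi x `^ p by rewrite /PP /Phi powRM ?powR_ge0// -powRrM mulNr (mulrC s).
exact: le_powR_add1.
Qed.

Let phi_fin : (\int[mu]_x (`|phi x|)%:E < +oo)%E.
Proof.
have mp : measurable_fun setT (fun x => `|phi x| `^ p) by apply: measurable_powRl; exact: measurable_normrc.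
apply: (@le_lt_trans _ _ (\int[mu]_x (`|phi x| `^ p + chi x)%:E)%E); last first.
  by rewrite int_add//; apply: lte_add_pinfty.
apply: int_le => //; [exact: measurable_normrc|exact: measurable_funD|].
move=> x; have [Ux|Ux] := pselect (U' x); last first.
  by rewrite phi0// normr0 addr_ge0 ?powR_ge0.
have -> : chi x = 1 by rewrite /chi indicE mem_set.
exact: le_powR_add1.
Qed.

Let A (x y : Rn R N) : R := (eucl (x - y) < dd x)%R%:R * (`|u x - u y| `^ p * K (x - y)).
Let B (x y : Rn R N) : R := `|phi x| * ((dd x <= eucl (x - y))%R%:R * (eucl (x - y) `^ (s * (p - 1)) * K (x - y))).

Let A0 x y : 0 <= A x y. Proof. by rewrite mulr_ge0// mulr_ge0 ?powR_ge0. Qed.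
Let B0 x y : 0 <= B x y. Proof. by rewrite mulr_ge0// mulr_ge0// mulr_ge0 ?powR_ge0. Qed.

Let mA : measurable_fun setT (fun z : Rn R N * Rn R N => A z.1 z.2).
Proof.
apply: measurable_funM.
  by apply: measurable_natr; apply: measurable_fun_ltr; [exact: mes|exact: m1].
apply: measurable_funM; last exact: mKs.
by apply: measurable_powRl; apply: measurable_normrc; apply: measurable_funB; [exact: m1|exact: m2].
Qed.

Let mB : measurable_fun setT (fun z : Rn R N * Rn R N => B z.1 z.2).
Proof.
apply: measurable_funM; first by apply: measurable_normrc; exact: m1.
apply: measurable_funM.
  by apply: measurable_natr; apply: measurable_fun_ler; [exact: m1|exact: mes].
by apply: measurable_funM; [apply: measurable_powRl; exact: mes|exact: mKs].
Qed.

Let A_fin : (\int[mu]_x \int[mu]_y (A x y)%:E < +oo)%E.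
Proof.
have [C C0 HC] := near_difference_bound lmu bO s0 s1 p1.
have mO : measurable (O : set (Rn R N)) by exact: measurable_open.
have m1O : measurable_fun setT (fun x => C * \1_(O : set (Rn R N)) x).
  by apply: measurable_funM => //; exact: measurable_indic.
apply: (@le_lt_trans _ _ (\int[mu]_x (C * \1_(O : set (Rn R N)) x)%:E)%E); last first.
  rewrite int_scale//.
  by rewrite integral_indic// setIT lte_mul_pinfty//; apply: (bounded_measure_fin lmu).
apply: ge0_le_integral => //.
- by move=> x _; apply: integral_ge0 => y _; rewrite lee_fin.
- exact: (@measurable_section_integral _ _ _ mu A mA).
- by apply/measurable_EFinP.
- move=> x _; rewrite indicE; have [Ox|Ox] := pselect (O x).
    rewrite mem_set// mulr1; apply: HC; exact: distc_gt0 oO neO _ Ox.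
  rewrite memNset// mulr0 integral0_eq// => y _.
  have -> : A x y = 0 by rewrite /A /dd (distc_notin neO Ox) ltNge eucl_ge0 mul0r.
  by [].
Qed.

Let B_fin : (\int[mu]_x \int[mu]_y (B x y)%:E < +oo)%E.
Proof.
have [C C0 HC] := far_difference_bound lmu p s0.
apply: (@le_lt_trans _ _ (\int[mu]_x (C * Phi x)%:E)%E); last first.
  rewrite (int_scale mu C0 mPhi Phi0); exact: lte_mul_pinfty.
apply: ge0_le_integral => //.
- by move=> x _; apply: integral_ge0 => y _; rewrite lee_fin.
- exact: (@measurable_section_integral _ _ _ mu B mB).
- by apply/measurable_EFinP; exact: measurable_funM.
- move=> x _; have [px|px] := eqVneq (phi x) 0.
    by rewrite integral0_eq ?lee_fin ?(mulr_ge0 C0 (Phi0 x))// => y _; rewrite /B px normr0 mul0r.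
  have [Ox _] := phiU px; have dx0 : 0 < dd x by exact: distc_gt0 oO neO _ Ox.
  have msec : measurable_fun setT (fun y : Rn R N => (dd x <= eucl ((x : 'rV[R]_N) - y))%R%:R * (eucl ((x : 'rV[R]_N) - y) `^ (s * (p - 1)) * K ((x : 'rV[R]_N) - y))).
    have mex : measurable_fun setT (fun y : Rn R N => eucl ((x : 'rV[R]_N) - y)).
      by apply: measurable_euclc; exact: msub.
    apply: measurable_funM; first by apply: measurable_natr; apply: measurable_fun_ler => //; exact: measurable_cst.
    by apply: measurable_funM; [exact: measurable_powRl|exact: mKsub].
  rewrite /B int_scale//; last by move=> y; rewrite mulr_ge0// mulr_ge0 ?powR_ge0.
  rewrite /Phi mulrCA [in leRHS]EFinM; apply: lee_wpmul2l; first by rewrite lee_fin.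
  exact: HC.
Qed.

(** The dominating function is symmetrized because [|x - y| < d] may hold at either of the two
    points. *)
Let W (z : Rn R N * Rn R N) : R := E z.1 z.2 + ((A z.1 z.2 + A z.2 z.1) + (B z.1 z.2 + B z.2 z.1)).

Let Wok : [/\ measurable_fun setT W, (forall z, 0 <= W z) & (\int[(mu \x mu)%E]_z (W z)%:E < +oo)%E].
Proof. exact: (symmetric_sum_fin mE mA mB E0 A0 B0 phiE A_fin B_fin). Qed.

Let L (k : nat) (z : Rn R N * Rn R N) : R := J k z.1 z.2 * (phi z.1 - phi z.2).
Let Linf (z : Rn R N * Rn R N) : R := spow (u z.1 - u z.2) (p - 1) * K (z.1 - z.2) * (phi z.1 - phi z.2).

Let u_dist (x y : Rn R N) : `|u x - u y| <= eucl (x - y) `^ s.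
Proof.
apply: (le_trans (powR_dist_le (dd0 x) (dd0 y) s0 (ltW s1))).
rewrite ge0_ler_powR ?nnegrE ?(ltW s0) ?eucl_ge0//; exact: distc_lip neO _ _.
Qed.

Let L_le k x y : `|J k x y * (phi x - phi y)| <= W (x, y).
Proof.
set Du := `|u x - u y|; set Dp := `|phi x - phi y|; set k0 := K (x - y).
have Du0 : 0 <= Du by exact: normr_ge0.
have Dp0 : 0 <= Dp by exact: normr_ge0.
have k00 : 0 <= k0 by exact: K0.
have J1 : `|J k x y| <= Du `^ (p - 1) * k0.
  rewrite /J normrM (ger0_norm (K0 _)) ler_wpM2r//.
  exact: (jreg_le (powR_ge0 _ _) (powR_ge0 _ _) (hs0 k) q0).
have L1 : `|J k x y * (phi x - phi y)| <= Du `^ (p - 1) * k0 * Dp by rewrite normrM ler_wpM2r.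
apply: (le_trans L1).
have young : Du `^ (p - 1) * k0 * Dp <= Du `^ p * k0 + E x y.
  have -> : E x y = Dp `^ p * k0 by [].
  by rewrite mulrAC -mulrDl ler_wpM2r// powR_young_split.
have sum1 (X t e a a' b b' w : R) : w = e + ((a + a') + (b + b')) -> a = t -> X <= t + e ->
    0 <= a' -> 0 <= b -> 0 <= b' -> X <= w.
  by move=> -> -> h1 h2 h3 h4; lra.
have sum2 (X t e a a' b b' w : R) : w = e + ((a + a') + (b + b')) -> a' = t -> X <= t + e ->
    0 <= a -> 0 <= b -> 0 <= b' -> X <= w.
  by move=> -> -> h1 h2 h3 h4; lra.
have sum3 (X e a a' b b' w : R) : w = e + ((a + a') + (b + b')) -> X <= b + b' ->
    0 <= e -> 0 <= a -> 0 <= a' -> X <= w.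
  by move=> -> h1 h2 h3 h4; lra.
have WE : W (x, y) = E x y + ((A x y + A y x) + (B x y + B y x)) by [].
have Ax := A0 x y; have Ay := A0 y x; have Bx := B0 x y; have By := B0 y x; have Ex := E0 x y.
have [xd|xd] := ltP (eucl (x - y)) (dd x).
  have HA : A x y = Du `^ p * k0 by rewrite /A xd mul1r.
  exact: (sum1 _ _ _ _ _ _ _ _ WE HA young Ay Bx By).
have [yd|yd] := ltP (eucl (y - x)) (dd y).
  have HA : A y x = Du `^ p * k0 by rewrite /A yd mul1r (KC y x) distrC.
  exact: (sum2 _ _ _ _ _ _ _ _ WE HA young Ax Bx By).
have Bxy : B x y = `|phi x| * (eucl (x - y) `^ (s * (p - 1)) * k0) by rewrite /B xd mul1r.
have Byx : B y x = `|phi y| * (eucl (x - y) `^ (s * (p - 1)) * k0).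
  by rewrite /B yd mul1r (KC y x) (euclB y x).
(* Here [|x - y|] is at least both distances, so splitting [phi x - phi y] gives one term of [B]
   centred at each point. *)
have far : Du `^ (p - 1) * k0 * Dp <= B x y + B y x.
  rewrite Bxy Byx -mulrDl mulrC; apply: ler_pM => //; rewrite ?mulr_ge0 ?powR_ge0//.
    exact: ler_normB.
  rewrite ler_wpM2r// powRrM ge0_ler_powR ?nnegrE ?(ltW q0) ?powR_ge0//.
  exact: u_dist.
exact: (sum3 _ _ _ _ _ _ _ WE far Ex Ax Ay).
Qed.

Let mL k : measurable_fun setT (L k).
Proof.
by apply: measurable_funM; [exact: mJ|apply: measurable_funB; [exact: m1|exact: m2]].
Qed.

Let mLinf : measurable_fun setT Linf.
Proof.
apply: measurable_funM; last by apply: measurable_funB; [exact: m1|exact: m2].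
apply: measurable_funM; last exact: mKs.
by apply: measurable_spowc; apply: measurable_funB; [exact: m1|exact: m2].
Qed.

Let L_cvg z : L k z @[k --> \oo] --> Linf z.
Proof.
apply: cvgM; last exact: cvg_cst.
by apply: cvgM; [exact: cvg_jreg|exact: cvg_cst].
Qed.

Let lhs_cvg : (\int[(mu \x mu)%E]_z (L k z)%:E)%E @[k --> \oo] --> (\int[(mu \x mu)%E]_z (Linf z)%:E)%E.
Proof.
have [mW W0 W_fin] := Wok.
apply: (@integral_dominated_cvg _ _ _ (mu \x mu)%E L Linf W mL mLinf mW W0 _ _ W_fin).
- by apply: aeW => z; exact: L_cvg.
- by apply: aeW => -[x y] k; exact: L_le.
Qed.

Let lhs_form k : (\int[(mu \x mu)%E]_z (L k z)%:E = 2%:E * \int[mu]_x (phi x * fine (G k x))%:E)%E.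
Proof.
apply: (@antisymmetric_form _ _ _ mu (J k) phi (mJ k) mphi (J_anti k)).
  by move=> x /phiU[Ox _]; exact: J_integrable.
have [C C0 HC] := abs_bound k.
have mabs : measurable_fun setT (fun z : Rn R N * Rn R N => `|J k z.1 z.2| * `|phi z.1|).
  apply: measurable_funM; apply: measurable_normrc; first exact: mJ.
  exact: m1.
apply: (@le_lt_trans _ _ (\int[mu]_x (C * Phi x)%:E)%E); last first.
  rewrite (int_scale mu C0 mPhi Phi0); exact: lte_mul_pinfty.
apply: ge0_le_integral => //.
- by move=> x _; apply: integral_ge0 => y _; rewrite lee_fin mulr_ge0.
- exact: (@measurable_section_integral _ _ _ mu (fun x y => `|J k x y| * `|phi x|) mabs).
- by apply/measurable_EFinP; exact: measurable_funM.
- move=> x _; have [px|px] := eqVneq (phi x) 0.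
    by rewrite integral0_eq ?lee_fin ?(mulr_ge0 C0 (Phi0 x))// => y _; rewrite px normr0 mulr0.
  have [Ox _] := phiU px.
  have mJx : measurable_fun setT (fun y => `|J k x y|).
    by apply: measurable_normrc; exact: (@measurable_section _ _ _ (J k) x (mJ k)).
  under eq_integral do rewrite mulrC.
  rewrite int_scale// /Phi mulrCA [in leRHS]EFinM; apply: lee_wpmul2l; first by rewrite lee_fin.
  exact: HC.
Qed.

Let g (k : nat) (x : Rn R N) : R := phi x * fine (G k x).
Let ginf (x : Rn R N) : R := phi x * flim x.

Let mg k : measurable_fun setT (g k). Proof. by apply: measurable_funM => //; exact: mG. Qed.

Let g_cvg x : g k x @[k --> \oo] --> ginf x.
Proof.
have [px|px] := eqVneq (phi x) 0; last first.
  by apply: cvgM; [exact: cvg_cst|apply: flim_cvg; exact: phiU].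
rewrite /ginf px mul0r (_ : (fun k => g k x) = cst 0); first exact: cvg_cst.
by apply/funext => k; rewrite /g px mul0r.
Qed.

Let mginf : measurable_fun setT ginf.
Proof. by apply: (@measurable_fun_cvg _ _ _ setT g) => // x _; exact: g_cvg. Qed.

(** [Phi] is needed beside [phi] because the bound on [G k] that is uniform in [k] contains
    [d^(-s)]. *)
Let rhs_dom : exists2 D : Rn R N -> R, measurable_fun setT D /\ (\int[mu]_x (D x)%:E < +oo)%E &
  (forall x, 0 <= D x) /\ forall k x, `|g k x| <= D x.
Proof.
have [M M0 HM] := reg.
have m_phi : measurable_fun setT (fun x => M * `|phi x|) by apply: measurable_funM => //; exact: measurable_normrc.
have m_Phi : measurable_fun setT (fun x => M * Phi x) by exact: measurable_funM.
exists (fun x => M * `|phi x| + M * Phi x); split.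
- exact: measurable_funD.
- rewrite int_add//; [|by move=> x; rewrite mulr_ge0|by move=> x; rewrite mulr_ge0].
  have mn : measurable_fun setT (fun x => `|phi x|) by exact: measurable_normrc.
  apply: lte_add_pinfty.
    rewrite (int_scale mu M0 mn (fun x => normr_ge0 _)); exact: lte_mul_pinfty.
  rewrite (int_scale mu M0 mPhi Phi0); exact: lte_mul_pinfty.
- by move=> x; rewrite addr_ge0// mulr_ge0.
- move=> k x; have [px|px] := eqVneq (phi x) 0.
    by rewrite /g px mul0r normr0 addr_ge0// mulr_ge0.
  have [[l lc lM] H] := HM x (phiU px).
  have Gfin : G k x \is a fin_num.
    by rewrite fin_num_abs (le_lt_trans (H k))// ltry.
  have := H k; rewrite -(fineK Gfin) => Hk.
  have {}Hk : `|fine (G k x)| <= M + M * dd x `^ (- s) by rewrite -lee_fin.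
  rewrite /g normrM; apply: (le_trans (ler_wpM2l (normr_ge0 _) Hk)).
  by rewrite /Phi le_eqVlt; apply/orP; left; apply/eqP; ring.
Qed.

Let rhs_cvg : (\int[mu]_x (g k x)%:E)%E @[k --> \oo] --> (\int[mu]_x (ginf x)%:E)%E.
Proof.
have [D [mD Doo] [D0 HD]] := rhs_dom.
apply: (@integral_dominated_cvg _ _ _ mu g ginf D mg mginf mD D0 _ _ Doo).
- by apply: aeW => x; exact: g_cvg.
- by apply: aeW => x k; exact: HD.
Qed.

Let ginf_int : mu.-integrable setT (EFin \o ginf).
Proof.
have [D [mD Doo] [D0 HD]] := rhs_dom.
apply: (@integrable_dom _ _ _ mu ginf D mginf mD D0 _ Doo).1.
by apply: aeW => x; exact: (cvgn_norm_le (@g_cvg x) (fun k => HD k x)).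
Qed.

(** For each [k] the form equals twice the integral of [g k] by antisymmetry; the two sides are the
    limits of these equal sequences. *)
Lemma limit_identity :
  (\int[(mu \x mu)%E]_z (Linf z)%:E = \int[mu]_x (2 * flim x * phi x)%:E)%E.
Proof.
rewrite (eq_integral (fun x => 2%:E * (EFin \o ginf) x)%E); last first.
  by move=> x _; rewrite /ginf /= -EFinM; congr EFin; ring.
rewrite integralZl//.
have c2 : (\int[(mu \x mu)%E]_z (L k z)%:E)%E @[k --> \oo] --> (2%:E * \int[mu]_x (ginf x)%:E)%E.
  rewrite (_ : (fun k => _) = (fun k => 2%:E * \int[mu]_x (g k x)%:E)%E); last by apply/funext => k; exact: lhs_form.
  by apply: cvgeZl.
exact: (cvg_unique _ lhs_cvg c2).
Qed.

End TestFunction.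

End WeakSolution.

Theorem theorem3p6 (R : realType) (n : nat) (s p : R)
  (mu : {sigma_finite_measure set (Rn R n.+1) -> \bar R})
  (Omega : set 'rV[R]_n.+1) :
  0 < s < 1 -> 1 < p -> is_lebesgue mu ->
  open Omega -> connected Omega -> Omega !=set0 -> boundedset Omega ->
  C11_boundary Omega ->
  exists rho : R, 0 < rho /\
    exists f : 'rV[R]_n.+1 -> R,
      Linfty mu [set x | Omega x /\ distc Omega x < rho] f /\
      weak_sol mu s p [set x | Omega x /\ distc Omega x < rho]
        (fun x => distc Omega x `^ s) f.

Proof.
move=> /andP[s0 s1] p1 lmu oO _ _ bO Ob.
have neO := bounded_compl_neq0 bO.
have [r0 r00 tang] := tangent_balls oO neO bO Ob.
have tang' x : Omega x -> distc Omega x < r0 / 2 -> exists v : 'rV[R]_n.+1,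
    [/\ eucl v = 1, forall y, eucl (y - (x + (r0 - distc Omega x) *: v)) < r0 -> Omega y &
     forall y, eucl (y - (x - (r0 + distc Omega x) *: v)) < r0 -> ~ Omega y].
  by move=> Ox dx; apply: tang => //; lra.
exists (r0 / 2); split; first by rewrite divr_gt0.
eexists; split; first exact: (linfty_limit lmu oO bO s0 s1 p1 r00 tang').
move=> U' oU' _ U'U phi [mphi [phi0 [phip phiE]]].
have divE (a : R) (z : Rn R n.+1 * Rn R n.+1) :
    a / eucl (z.1 - z.2) `^ (n.+1%:R + p * s) = a * eucl (z.1 - z.2) `^ (- (n.+1%:R + p * s)).
  by rewrite powRN.
have phiE' : (\int[(mu \x mu)%E]_z (`|phi z.1 - phi z.2| `^ p * eucl (z.1 - z.2) `^ (- (n.+1%:R + p * s)))%:E < +oo)%E.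
  by apply: le_lt_trans phiE; rewrite le_eqVlt; apply/orP; left; apply/eqP; apply: eq_integral => z _; rewrite divE.
have H := limit_identity lmu oO bO s0 s1 p1 r00 tang' oU' U'U mphi phi0 phip phiE'.
apply: (etrans _ H); apply: eq_integral => z _.
by rewrite divE mulrAC.
Qed.
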